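(* Let $H$ be a nonzero complex Hilbert space, let $p$ be a monic polynomial with simple zeros $\Lambda=\{\lambda_1,\dots,\lambda_d\}$, $d\ge1$, and let $A\in\mathcal B(H)$ be such that $N=p(A)$ is normal. Then for all $[f]\in C_\Lambda(p(\sigma(A)))/\mathcal I_{\sigma(A)}$ (with representative $f\in C_\Lambda(p(\sigma(A)))$) one has $$\sigma(\chi_A(f))=\sigma([f]),$$ where $\chi_A(f)=\sum_{j=1}^d\delta_j(A)f_j(N)\in\mathcal B(H)$ and $\sigma([f])$ is the spectrum of $[f]$ in the quotient algebra $C_\Lambda(p(\sigma(A)))/\mathcal I_{\sigma(A)}$.
   Context: $\mathcal B(H)$ is the algebra of bounded linear operators on $H$. Here $p(z)=(z-\lambda_1)\cdots(z-\lambda_d)$ and $\delta_j(z)=\prod_{k\neq j}\frac{z-\lambda_k}{\lambda_j-\lambda_k}$. For compact nonempty $M\subset\mathbb C$, $C_\Lambda(M)$ is the commutative unital Banach algebra of continuous functions $f:M\to\mathbb C^d$ with unit $\mathbf 1=(1,\dots,1)^t$ and product (polyproduct) given componentwise by $$(f\circledcirc g)_i(w)=f_i(w)g_i(w)-w\sum_{j\neq i}\frac{(f_i(w)-f_j(w))(g_i(w)-g_j(w))}{p'(\lambda_j)(\lambda_i-\lambda_j)},$$ and norm $\|f\|=\sup_{|g|_M\le1}|f\circledcirc g|_M$, where $|f|_M=\max_{w\in M}\max_j|f_j(w)|$. For $f\in C_\Lambda(M)$ put $\hat f(z)=\sum_{j=1}^d\delta_j(z)f_j(p(z))$, $z\in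 p^{-1}(M)$. With $M=p(\sigma(A))$, $\mathcal I_{\sigma(A)}=\{f\in C_\Lambda(M):\hat f(z)=0\text{ for all }z\in\sigma(A)\}$ is a closed ideal, $[f]=f+\mathcal I_{\sigma(A)}$, and the quotient is a unital Banach algebra with norm $\|[f]\|=\inf_{g\in\mathcal I_{\sigma(A)}}\|f+g\|$. For the normal operator $N$ and $f_j$ continuous on $\sigma(N)=p(\sigma(A))$, $f_j(N)$ is given by the continuous functional calculus: $f_j(N)=\lim_n q_{j,n}(N,N^* )$ for polynomials $q_{j,n}(w,\overline w)$ converging uniformly to $f_j$ on $\sigma(N)$. *)

(* Defs.v *)
From HB Require Import structures.
From mathcomp Require Import all_boot all_order all_algebra sesquilinear.
From mathcomp Require Import generic_quotient ring_quotient.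
From mathcomp Require Import complex.
From mathcomp Require Import all_classical reals topology normedtype sequences.
From mathcomp Require Import ring.

Set Implicit Arguments.
Unset Strict Implicit.
Unset Printing Implicit Defensive.

Import Order.TTheory GRing.Theory Num.Theory.
Import numFieldNormedType.Exports.

Local Open Scope classical_set_scope.
Local Open Scope ring_scope.

(* The library puts the norm topology only on abstract numeric fields and on  *)
(* [K^o]; these instances transfer it to [R[i]].                              *)
HB.instance Definition _ (R : rcfType) :=
  PseudoPointedMetric.copy R[i] (R[i] : numClosedFieldType)^o.
HB.instance Definition _ (R : rcfType) :=
  GRing.ComAlgebra.copy R[i] (R[i] : numClosedFieldType)^o.
HB.instance Definition _ (R : rcfType) :=
  Vector.copy R[i] (R[i] : numClosedFieldType)^o.
HB.instance Definition _ (R : rcfType) :=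
  NormedModule.copy R[i] (R[i] : numClosedFieldType)^o.

HB.mixin Record isHilbert (R : realType) H & CompleteNormedModule R[i] H := {
  hdot : {dot H for (@Num.conj R[i])} ;
  normr_hdot : forall x : H, `|x| ^+ 2 = hdot x x
}.

#[short(type="hilbertType")]
HB.structure Definition Hilbert (R : realType) :=
  {H of CompleteNormedModule R[i] H & isHilbert R H}.

HB.mixin Record isNontrivialHilbert (R : realType) H & Hilbert R H := {
  hilbert_neq0 : exists x : H, x != 0
}.

#[short(type="nzHilbertType")]
HB.structure Definition NzHilbert (R : realType) :=
  {H of Hilbert R H & isNontrivialHilbert R H}.

Section BoundedOperators.
Context {R : realType} {H : nzHilbertType R}.

Definition bounded_linear : {pred H -> H} := fun T : H -> H =>
  `[< linear T /\ exists2 k : R[i], 0 <= k & forall x, `|T x| <= k * `|x| >].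

Lemma bounded_linear_submod : submod_closed bounded_linear.
Proof.
split.
  apply/asboolP; split; first by move=> a x y /=; rewrite scaler0 addr0.
  by exists 0 => // x; rewrite mul0r normr0.
move=> a S T /asboolP[lS [k k0 kS]] /asboolP[lT [l l0 lTb]]; apply/asboolP.
split=> [b x y|].
  rewrite !fctE lS lT !scalerDr !scalerA (mulrC a).
  by rewrite -!addrA; congr (_ + _); rewrite addrCA.
exists (`|a| * k + l) => [|x]; first by rewrite addr_ge0// mulr_ge0.
rewrite !fctE (le_trans (ler_normD _ _))// mulrDl lerD// normrZ -mulrA.
by rewrite ler_wpM2l.
Qed.
HB.instance Definition _ := GRing.isSubmodClosed.Build R[i] (H -> H)
  bounded_linear (GRing.submod_closed_semi bounded_linear_submod).

Lemma id_bounded_linear : idfun \in bounded_linear.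
Proof. by apply/asboolP; split=> //; exists 1 => // x; rewrite mul1r. Qed.

Lemma comp_bounded_linear S T :
  S \in bounded_linear -> T \in bounded_linear -> S \o T \in bounded_linear.
Proof.
move=> /asboolP[lS [k k0 kS]] /asboolP[lT [l l0 lTb]]; apply/asboolP; split.
  by move=> a x y; rewrite /= lT lS.
exists (k * l) => [|x /=]; first exact: mulr_ge0.
by rewrite (le_trans (kS _))// -mulrA ler_wpM2l.
Qed.

End BoundedOperators.

Record bop (R : realType) (H : nzHilbertType R) : Type :=
  Bop { bop_fun :> H -> H ; bop_subproof : bop_fun \in bounded_linear }.

HB.instance Definition _ (R : realType) (H : nzHilbertType R) :=
  [isSub of bop H for @bop_fun R H].
HB.instance Definition _ (R : realType) (H : nzHilbertType R) :=
  [Choice of bop H by <:].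
HB.instance Definition _ (R : realType) (H : nzHilbertType R) :=
  [SubChoice_isSubLmodule of bop H by <:].

Section BopAlgebra.
Context {R : realType} {H : nzHilbertType R}.
Implicit Types S T U : bop H.

Lemma bopP S T : S =1 T -> S = T.
Proof. by move=> eST; apply/val_inj/funext. Qed.

Lemma bop_linear T : linear T.
Proof. by have /asboolP[] := bop_subproof T. Qed.

Definition bop_one : bop H := Bop id_bounded_linear.
Definition bop_mul S T : bop H :=
  Bop (comp_bounded_linear (bop_subproof S) (bop_subproof T)).

Fact bop_mulA : associative bop_mul. Proof. by move=> S T U; exact: bopP. Qed.
Fact bop_mul1 : left_id bop_one bop_mul. Proof. by move=> S; exact: bopP. Qed.
Fact bop_mulr1 : right_id bop_one bop_mul. Proof. by move=> S; exact: bopP. Qed.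
Fact bop_mulDl : left_distributive bop_mul +%R.
Proof. by move=> S T U; exact: bopP. Qed.
Fact bop_mulDr : right_distributive bop_mul +%R.
Proof.
move=> S T U; apply: bopP => x /=.
by have := bop_linear S 1 (T x) (U x); rewrite !scale1r.
Qed.
Fact bop_one_neq0 : bop_one != 0.
Proof.
have [x x0] := @hilbert_neq0 R H.
by apply: contra x0 => /eqP/(congr1 (fun T : bop H => T x))/= ->.
Qed.
HB.instance Definition _ := GRing.Zmodule_isNzRing.Build (bop H)
  bop_mulA bop_mul1 bop_mulr1 bop_mulDl bop_mulDr bop_one_neq0.

Fact bop_scalerAl (a : R[i]) S T : a *: (S * T) = (a *: S) * T.
Proof. exact: bopP. Qed.
HB.instance Definition _ :=
  GRing.LSemiModule_isLSemiAlgebra.Build R[i] (bop H) bop_scalerAl.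

Fact bop_scalerAr (a : R[i]) S T : a *: (S * T) = S * (a *: T).
Proof.
have S0 : S 0 = 0.
  by have := bop_linear S (-1) 0 0; rewrite scaler0 addr0 scaleN1r addNr.
apply: bopP => x /=.
by have := bop_linear S a (T x) 0; rewrite S0 !addr0.
Qed.
HB.instance Definition _ :=
  GRing.LSemiAlgebra_isSemiAlgebra.Build R[i] (bop H) bop_scalerAr.

End BopAlgebra.

(* The algebra structure of [A] over [K] enters only through the scalar map   *)
(* [iota : z |-> z 1], because the library's algebras are nontrivial rings,   *)
(* while nontriviality of the quotient algebra below is a theorem.            *)
Definition spectrum (K : nzRingType) (A : pzRingType) (iota : K -> A) (a : A) :
    set K :=
  [set z | ~ exists b, (iota z - a) * b = 1 /\ b * (iota z - a) = 1].

Section OperatorTheory.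
Context {R : realType} {H : nzHilbertType R}.
Implicit Types (A N T : bop H) (p : {poly R[i]}) (q : {poly {poly R[i]}}).

Definition op_spectrum T : set R[i] := spectrum (in_alg (bop H)) T.

(* Exists and is unique by the Riesz representation theorem. *)
Definition adjoint T : bop H :=
  xget 0 [set S : bop H | forall x y, hdot (T x) y = hdot x (S y)].

Definition normal T : Prop := T * adjoint T = adjoint T * T.

Definition op_norm T : R :=
  sup [set complex.Re `|T x| | x in [set x : H | `|x| <= 1]].

(* [q(S, T)], for [q] a polynomial in the second variable with coefficients   *)
(* in the first: the powers of [S] are on the left.                           *)
Definition op_eval2 q (S T : bop H) : bop H := (map_poly (horner_alg S) q).[T].

(* [T] is [g(N)]: the first conjunct says that [q n (w, conj w)] converges    *)
(* to [g w] uniformly on the spectrum of [N].                                 *)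
Definition is_fun_calc N (g : R[i] -> R[i]) T : Prop :=
  exists q : nat -> {poly {poly R[i]}},
    {uniform op_spectrum N,
      (fun n w => (q n).[(Num.conj w)%:P].[w]) @ \oo --> g} /\
    op_norm (op_eval2 (q n) N (adjoint N) - T) @[n --> \oo] --> (0 : R).

Definition fun_calc N (g : R[i] -> R[i]) : bop H :=
  xget 0 [set T | is_fun_calc N g T].

End OperatorTheory.

Record simple_zeros (R : realType) (d : nat) : Type := SimpleZeros {
  zero_of :> 'I_d -> R[i] ; zero_of_inj : injective zero_of }.

Section Interpolation.
Context {R : realType} {d : nat} (L : simple_zeros R d).
Implicit Types (a b c : 'cV[R[i]]_d) (w : R[i]).

Definition zpoly : {poly R[i]} := \prod_(j < d) ('X - (L j)%:P).

Definition zdelta (j : 'I_d) : {poly R[i]} :=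
  \prod_(k < d | k != j) ((L j - L k)^-1 *: ('X - (L k)%:P)).

Definition polyprod w a b : 'cV[R[i]]_d :=
  \col_i (a i 0 * b i 0 - w * \sum_(j < d | j != i)
    (a i 0 - a j 0) * (b i 0 - b j 0) / (zpoly^`().[L j] * (L i - L j))).

Let colpoly a : {poly R[i]} := \sum_j a j 0 *: zdelta j.

Let dL j : R[i] := \prod_(k < d | k != j) (L j - L k).

Let dL_neq0 j : dL j != 0.
Proof.
apply/prodf_neq0 => k kj; rewrite subr_eq0; apply: contra kj => /eqP.
by move/(@zero_of_inj _ _ L) ->.
Qed.

Let zpolyE j : zpoly = ('X - (L j)%:P) * \prod_(k < d | k != j) ('X - (L k)%:P).
Proof. by rewrite /zpoly (bigD1 j). Qed.

Let zpoly_deriv j : zpoly^`().[L j] = dL j.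
Proof.
rewrite (zpolyE j) derivM derivXsubC mul1r hornerD hornerM hornerXsubC subrr.
rewrite mul0r addr0 horner_prod; apply: eq_bigr => k _.
by rewrite hornerXsubC.
Qed.

Let zdelta_zpoly j : ('X - (L j)%:P) * zdelta j = (dL j)^-1 *: zpoly.
Proof.
by rewrite /zdelta scaler_prod prodfV -scalerAr -zpolyE.
Qed.

Let zdelta_eval j k : (zdelta j).[L k] = (j == k)%:R.
Proof.
rewrite /zdelta horner_prod; case: eqVneq => [<-|jk].
  apply: big1 => i ij; rewrite hornerZ hornerXsubC mulVf// subr_eq0.
  by apply: contra ij => /eqP/(@zero_of_inj _ _ L) ->.
rewrite (bigD1 k) 1?eq_sym//= hornerZ hornerXsubC subrr mulr0.
by rewrite mul0r.
Qed.

Let size_zpoly : size zpoly = d.+1.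
Proof. by rewrite size_prod_XsubC /index_enum -enumT size_enum_ord. Qed.

Let size_zdelta j : (size (zdelta j) <= d)%N.
Proof.
have := congr1 (fun p : {poly _} => size p) (zdelta_zpoly j).
rewrite size_scale ?invr_eq0// size_zpoly => sz.
have d0 : zdelta j != 0.
  by apply/eqP => z0; have := zdelta_eval j j; rewrite z0 horner0 eqxx => /esym/eqP; rewrite oner_eq0.
by move: sz; rewrite size_monicM ?monicXsubC// size_XsubC => -[<-].
Qed.

Let size_colpoly a : (size (colpoly a) <= d)%N.
Proof.
apply: (leq_trans (size_sum _ _ _)); apply/bigmax_leqP => j _.
exact: leq_trans (size_scale_leq _ _) (size_zdelta j).
Qed.

Let colpoly_eval a j : (colpoly a).[L j] = a j 0.
Proof.
rewrite horner_sum (bigD1 j)//= hornerZ zdelta_eval eqxx mulr1 big1 ?addr0//.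
by move=> k kj; rewrite hornerZ zdelta_eval (negbTE kj) mulr0.
Qed.

Let eq_small (p q : {poly R[i]}) : (size p <= d)%N -> (size q <= d)%N ->
  (forall j, p.[L j] = q.[L j]) -> p = q.
Proof.
move=> sp sq pq; apply/eqP; rewrite -subr_eq0; apply: contraT => pq0.
have : (size [seq L j | j : 'I_d] < size (p - q)%R)%N.
  apply: max_poly_roots => //.
    by apply/allP => _ /mapP[j _ ->]; rewrite /root hornerD hornerN pq subrr.
  by rewrite map_inj_uniq ?enum_uniq//; exact: zero_of_inj.
rewrite size_map size_enum_ord ltnNge => /negP[].
by apply: (leq_trans (size_polyD _ _)); rewrite geq_max size_polyN sp.
Qed.

Let sum_zdelta (i : 'I_d) : \sum_j zdelta j = 1.
Proof.
have -> : \sum_j zdelta j = colpoly (const_mx 1).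
  by apply: eq_bigr => j _; rewrite mxE scale1r.
apply: eq_small => //; first by rewrite size_poly1; case: (d) i => // -[].
by move=> j; rewrite colpoly_eval mxE hornerC.
Qed.

Let zdeltaM i j : i != j -> zdelta i * zdelta j =
  (L i - L j)^-1 *: (zpoly * ((dL j)^-1 *: zdelta i - (dL i)^-1 *: zdelta j)).
Proof.
move=> ij.
have Lij : L i - L j != 0.
  by rewrite subr_eq0; apply: contra ij => /eqP/(@zero_of_inj _ _ L) ->.
apply: (scalerI Lij); rewrite scalerA divff// scale1r.
rewrite mulrBr -!scalerAr !scalerAl -!zdelta_zpoly -mul_polyC polyCB; ring.
Qed.

(* [polyprod w] is multiplication modulo [zpoly - w] of the interpolating     *)
(* polynomials.                                                               *)
Let colpolyM w a b : exists u,
  colpoly a * colpoly b - colpoly (polyprod w a b) = u * (zpoly - w%:P).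
Proof.
pose D i j := (a i 0 - a j 0) * (b i 0 - b j 0).
pose E i j := D i j / (dL j * (L i - L j)).
pose Y := \sum_i \sum_j E i j *: zdelta i.
have Dii i : D i i = 0 by rewrite /D subrr mul0r.
have DE i j : D i j *: (zdelta i * zdelta j) =
    zpoly * (E i j *: zdelta i) + zpoly * (E j i *: zdelta j).
  have [<-|ij] := eqVneq i j.
    by rewrite /E Dii !mul0r !scale0r !mulr0 addr0.
  have Lij : L i - L j != 0.
    by rewrite subr_eq0; apply: contra ij => /eqP/(@zero_of_inj _ _ L) ->.
  have Dji : D j i = D i j by rewrite /D; ring.
  rewrite zdeltaM// scalerA scalerAr -mulrDr scalerBr !scalerA -scaleNr.
  have Lji : L j - L i != 0 by rewrite -opprB oppr_eq0.
  have dj := dL_neq0 j; have di := dL_neq0 i.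
  by congr (_ * (_ *: _ + _ *: _)); rewrite /E ?Dji; field; rewrite ?Lij ?Lji ?di ?dj.
pose X := \sum_i \sum_j (a i 0 * (b j 0 - b i 0)) *: (zdelta i * zdelta j).
have X2 : X + X = - (zpoly * Y + zpoly * Y).
  rewrite {2}/X exchange_big/= /X -big_split/=.
  under eq_bigr => i _ do rewrite -big_split/=.
  transitivity (- \sum_i \sum_j D i j *: (zdelta i * zdelta j)).
    rewrite -sumrN; apply: eq_bigr => i _; rewrite -sumrN; apply: eq_bigr => j _.
    by rewrite [zdelta j * _]mulrC -scalerDl -scaleNr; congr (_ *: _); rewrite /D; ring.
  congr (- _); under eq_bigr => i _ do
    (under eq_bigr => j _ do rewrite DE; rewrite big_split/=).
  rewrite big_split/=; congr (_ + _).
    by rewrite mulr_sumr; apply: eq_bigr => i _; rewrite mulr_sumr.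
  rewrite exchange_big/= mulr_sumr; apply: eq_bigr => i _.
  by rewrite mulr_sumr.
have {}X2 : X = - (zpoly * Y).
  have two : (2%:R : {poly R[i]}) != 0.
    by rewrite -polyC_natr polyC_eq0 pnatr_eq0.
  by apply: (mulfI two); rewrite !mulr_natl !mulr2n X2 opprD.
exists (- Y).
have -> : colpoly (polyprod w a b) =
    \sum_i (a i 0 * b i 0) *: zdelta i - w *: Y.
  rewrite scaler_sumr -sumrB; apply: eq_bigr => i _.
  rewrite mxE scalerBl -scaler_suml scalerA; congr (_ - (_ * _) *: _).
  rewrite [RHS](bigD1 i)//= {1}/E Dii mul0r add0r.
  by apply: eq_bigr => j _; rewrite zpoly_deriv.
have -> : colpoly a * colpoly b =
    X + \sum_i (a i 0 * b i 0) *: zdelta i.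
  have -> : \sum_i (a i 0 * b i 0) *: zdelta i =
      \sum_i \sum_j (a i 0 * b i 0) *: (zdelta i * zdelta j).
    apply: eq_bigr => i _; rewrite -scaler_sumr -mulr_sumr.
    by rewrite (sum_zdelta i) mulr1.
  rewrite /colpoly mulr_suml /X -big_split/=; apply: eq_bigr => i _.
  rewrite mulr_sumr -big_split/=; apply: eq_bigr => j _.
  rewrite -scalerDl -mulrDr subrK -scalerAl -scalerAr scalerA.
  by [].
rewrite X2 -mul_polyC; ring.
Qed.

Let colpoly_inj w a b u : colpoly a - colpoly b = u * (zpoly - w%:P) -> a = b.
Proof.
move=> abu; apply/colP => j; rewrite -!colpoly_eval.
have szw : size (zpoly - w%:P) = d.+1.
  rewrite size_polyDl size_zpoly// size_polyN (leq_ltn_trans (size_polyC_leq1 _))//.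
  by rewrite ltnS; case: (d) j => // -[].
suff /eqP : colpoly a - colpoly b = 0 by rewrite subr_eq0 => /eqP ->.
apply/eqP; apply: contraT => ab0.
have : (size (colpoly a - colpoly b)%R <= d)%N.
  by apply: (leq_trans (size_polyD _ _)); rewrite geq_max size_polyN !size_colpoly.
have u0 : u != 0 by apply: contra ab0 => /eqP u0; rewrite abu u0 mul0r.
have w0 : zpoly - w%:P != 0 by rewrite -size_poly_eq0 szw.
rewrite abu size_mul// szw addnS/= leqNgt => /negP[].
by rewrite -addn1 addnC leq_add2r ltnNge leqn0 size_poly_eq0.
Qed.

Lemma polyprodC w : commutative (polyprod w).
Proof.
move=> a b; apply/colP => i; rewrite !mxE mulrC; congr (_ - _ * _).
by apply: eq_bigr => j _; rewrite [(a i 0 - _) * _]mulrC.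
Qed.

Lemma polyprod1 w : left_id (const_mx 1) (polyprod w).
Proof.
move=> a; apply/colP => i; rewrite !mxE mul1r big1 ?mulr0 ?subr0// => j _.
by rewrite !mxE subrr !mul0r.
Qed.

Lemma polyprodDl w : left_distributive (polyprod w) +%R.
Proof.
move=> a b c; apply/colP => i; rewrite !mxE mulrDl.
rewrite [X in _ - X](_ : _ = w * (\sum_(j < d | j != i)
    (a i 0 - a j 0) * (c i 0 - c j 0) / (zpoly^`().[L j] * (L i - L j)) +
  \sum_(j < d | j != i)
    (b i 0 - b j 0) * (c i 0 - c j 0) / (zpoly^`().[L j] * (L i - L j)))).
  by rewrite mulrDr opprD addrACA.
rewrite -big_split/=; congr (_ * _); apply: eq_bigr => j _.
by rewrite !mxE -!mulrDl opprD addrACA.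
Qed.

Lemma polyprodA w : associative (polyprod w).
Proof.
move=> a b c.
have hatM x y : exists u, colpoly (polyprod w x y) =
    colpoly x * colpoly y - u * (zpoly - w%:P).
  by have [u e] := colpolyM w x y; exists u; rewrite -e opprB addrC subrK.
have [[u1 e1] [u2 e2]] := (hatM b c, hatM a (polyprod w b c)).
have [[u3 e3] [u4 e4]] := (hatM a b, hatM (polyprod w a b) c).
apply: (@colpoly_inj w _ _ (u4 - u2 + u3 * colpoly c - u1 * colpoly a)).
by rewrite e2 e4 e1 e3; ring.
Qed.

Definition interp a (z : R[i]) : R[i] := \sum_j (zdelta j).[z] * a j 0.

Let interpE a z : interp a z = (colpoly a).[z].
Proof.
by rewrite horner_sum; apply: eq_bigr => j _; rewrite hornerZ mulrC.
Qed.

Lemma interpM a b z :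
  interp (polyprod zpoly.[z] a b) z = interp a z * interp b z.
Proof.
have [u /(congr1 (horner^~ z))] := colpolyM zpoly.[z] a b.
rewrite !interpE !hornerE subrr mulr0 => /eqP.
by rewrite subr_eq0 => /eqP.
Qed.

End Interpolation.

Lemma continuous_colP (K T : topologicalType) d (g : T -> 'cV[K]_d) :
  continuous g <-> forall i, continuous (fun x => g x i 0).
Proof.
split=> [cg i x A gA|cg x A [P gP PA]].
  suff : nbhs (g x) [set v : 'cV[K]_d | A (v i 0)] by exact: (cg x).
  exists (fun k l => [set y | k = i -> A y]) => [k l|v /(_ i 0)/=]; last exact.
  have [->|/eqP ki] := eqVneq k i; last by apply: filterS filterT => y _ /ki.
  by rewrite ord1; apply: filterS gA => y Ay _.
rewrite nbhs_filterE.
have : \forall y \near x, forall i, P i 0 (g y i 0).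
  by apply: filter_forall => i; exact: (cg i x _ (gP i 0)).
by apply: filterS => y Py; apply: PA => i j; rewrite ord1.
Qed.

Lemma sum_fct_continuous (K : numFieldType) (T : topologicalType) (I : Type)
    (s : seq I) (P : pred I) (F : I -> T -> K) :
  (forall j, continuous (F j)) -> continuous (fun t => \sum_(j <- s | P j) F j t).
Proof.
move=> cF t; rewrite -fct_sumE.
elim/big_ind : _ => [|g h cg ch|j _]; [exact: cvg_cst|exact: cvgD|exact: cF].
Qed.

Section ColContinuity.
Context {R : realType} {d : nat} (L : simple_zeros R d) {T : topologicalType}.
Variables (u v : T -> 'cV[R[i]]_d) (h : T -> R[i]).
Hypotheses (cu : continuous u) (cv : continuous v) (ch : continuous h).

Lemma col_add_continuous : continuous (fun t => u t + v t).
Proof.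
apply/continuous_colP => i.
rewrite (_ : (fun t => _) = (fun t => u t i 0 + v t i 0)); last first.
  by apply/funext => t; rewrite mxE.
move=> t; apply: cvgD; [move: cu|move: cv] => /continuous_colP; exact.
Qed.

Lemma col_scale_continuous (a : R[i]) : continuous (fun t => a *: u t).
Proof.
apply/continuous_colP => i.
rewrite (_ : (fun t => _) = (fun t => a * u t i 0)); last first.
  by apply/funext => t; rewrite mxE.
by move=> t; apply: cvgM; [exact: cvg_cst|move: cu => /continuous_colP; exact].
Qed.

Lemma polyprod_continuous : continuous (fun t => polyprod L (h t) (u t) (v t)).
Proof.
apply/continuous_colP => i.
rewrite (_ : (fun t => _) = (fun t => u t i 0 * v t i 0 -
  h t * \sum_(j < d | j != i) (u t i 0 - u t j 0) * (v t i 0 - v t j 0) /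
    ((zpoly L)^`().[L j] * (L i - L j)))); last first.
  by apply/funext => t; rewrite mxE.
have [/continuous_colP cu' /continuous_colP cv'] := (cu, cv).
move=> t; apply: cvgB; first by apply: cvgM; [exact: cu'|exact: cv'].
apply: cvgM; first exact: ch.
apply: sum_fct_continuous => j; clear t => t.
apply: cvgM; last exact: cvg_cst.
by apply: cvgM; apply: cvgB; [exact: cu'|exact: cu'|exact: cv'|exact: cv'].
Qed.

End ColContinuity.

Definition cLambda (R : realType) (d : nat) (L : simple_zeros R d)
  (M : set R[i]) : Type := continuousType M 'cV[R[i]]_d.

Section CLambda.
Context {R : realType} {d : nat} {L : simple_zeros R d} {M : set R[i]}.

Definition cLambda_fun (f : cLambda L M) : M -> 'cV[R[i]]_d := Continuous.sort f.
Coercion cLambda_fun : cLambda >-> Funclass.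

HB.instance Definition _ := Choice.copy (cLambda L M)
  (continuousType M 'cV[R[i]]_d).

Implicit Types f g h : cLambda L M.

Lemma cLambdaP f g : f =1 g -> f = g.
Proof. by move/(continuousEP f g). Qed.

Definition mkcLambda (u : M -> 'cV[R[i]]_d) (cu : continuous u) : cLambda L M :=
  (mkcts cu : continuousType M 'cV[R[i]]_d).

Let cLambda_cts f : continuous f. Proof. exact: (@cts_fun _ _ f). Qed.

Fact cLambda_add_cts f g : continuous (fun w => f w + g w).
Proof. exact: col_add_continuous. Qed.

Fact cLambda_scale_cts (a : R[i]) f : continuous (fun w => a *: f w).
Proof. exact: col_scale_continuous. Qed.

Fact cLambda_const_cts a : continuous (fun _ : M => a : 'cV[R[i]]_d).
Proof. exact: cst_continuous. Qed.

Fact cLambda_mul_cts f g :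
  continuous (fun w : M => polyprod L (set_val w) (f w) (g w)).
Proof. by apply: polyprod_continuous => //; exact: initial_continuous. Qed.

Definition cLambda_zero : cLambda L M := mkcLambda (@cLambda_const_cts 0).
Definition cLambda_one : cLambda L M :=
  mkcLambda (@cLambda_const_cts (const_mx 1)).
Definition cLambda_add f g : cLambda L M := mkcLambda (@cLambda_add_cts f g).
Definition cLambda_scale a f : cLambda L M := mkcLambda (@cLambda_scale_cts a f).
Definition cLambda_opp f : cLambda L M := cLambda_scale (-1) f.
Definition cLambda_mul f g : cLambda L M := mkcLambda (@cLambda_mul_cts f g).

Fact cLambda_addA : associative cLambda_add.
Proof. by move=> f g h; apply: cLambdaP => w; exact: addrA. Qed.
Fact cLambda_addC : commutative cLambda_add.
Proof. by move=> f g; apply: cLambdaP => w; exact: addrC. Qed.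
Fact cLambda_add0 : left_id cLambda_zero cLambda_add.
Proof. by move=> f; apply: cLambdaP => w; exact: add0r. Qed.
Fact cLambda_addN : left_inverse cLambda_zero cLambda_opp cLambda_add.
Proof.
by move=> f; apply: cLambdaP => w; have := addNr (f w); rewrite -scaleN1r.
Qed.
HB.instance Definition _ := GRing.isZmodule.Build (cLambda L M)
  cLambda_addA cLambda_addC cLambda_add0 cLambda_addN.

Fact cLambda_scaleA a b f :
  cLambda_scale a (cLambda_scale b f) = cLambda_scale (a * b) f.
Proof. by apply: cLambdaP => w; exact: scalerA. Qed.
Fact cLambda_scale1 : left_id 1 cLambda_scale.
Proof. by move=> f; apply: cLambdaP => w; exact: scale1r. Qed.
Fact cLambda_scaleDr : right_distributive cLambda_scale +%R.
Proof. by move=> a f g; apply: cLambdaP => w; exact: scalerDr. Qed.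
Fact cLambda_scaleDl f : {morph cLambda_scale^~ f : a b / a + b}.
Proof. by move=> a b; apply: cLambdaP => w; exact: scalerDl. Qed.
HB.instance Definition _ := GRing.Zmodule_isLmodule.Build R[i] (cLambda L M)
  cLambda_scaleA cLambda_scale1 cLambda_scaleDr cLambda_scaleDl.

Fact cLambda_mulA : associative cLambda_mul.
Proof. by move=> f g h; apply: cLambdaP => w; exact: polyprodA. Qed.
Fact cLambda_mulC : commutative cLambda_mul.
Proof. by move=> f g; apply: cLambdaP => w; exact: polyprodC. Qed.
Fact cLambda_mul1 : left_id cLambda_one cLambda_mul.
Proof. by move=> f; apply: cLambdaP => w; exact: polyprod1. Qed.
Fact cLambda_mulDl : left_distributive cLambda_mul +%R.
Proof. by move=> f g h; apply: cLambdaP => w; exact: polyprodDl. Qed.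
HB.instance Definition _ := GRing.Zmodule_isComPzRing.Build (cLambda L M)
  cLambda_mulA cLambda_mulC cLambda_mul1 cLambda_mulDl.

(* [f] extended by [0] outside of [M] *)
Definition ext0 f (w : R[i]) : 'cV[R[i]]_d := oapp f 0 (insub w).

Definition hat f (z : R[i]) : R[i] :=
  \sum_(j < d) (zdelta L j).[z] * ext0 f (zpoly L).[z] j 0.

Let hatE f z : hat f z = interp L (ext0 f (zpoly L).[z]) z.
Proof. by []. Qed.

Lemma hatB f g z : hat (f - g) z = hat f z - hat g z.
Proof.
rewrite /hat -sumrB; apply: eq_bigr => j _; rewrite -mulrBr; congr (_ * _).
rewrite /ext0; case: insub => [w|]/=; last by rewrite mxE subr0.
have -> : (f - g) w = f w - g w by rewrite -[- g w]scaleN1r.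
by rewrite !mxE.
Qed.

Lemma hatM f g z : hat (f * g) z = hat f z * hat g z.
Proof.
rewrite !hatE /ext0; case: insubP => [w _ wE|_]/=; first by rewrite -interpM -wE.
by rewrite [in LHS]/interp [in RHS]/interp big1 ?mul0r// => j _; rewrite mxE mulr0.
Qed.

End CLambda.

Section Quotient.
Context {R : realType} {d : nat} (L : simple_zeros R d) (M S : set R[i]).

(* For [M = p(S)] this is the ideal I_S. *)
Definition cLambda_ideal : {pred cLambda L M} :=
  fun f => `[< forall z, S z -> hat f z = 0 >].

Fact cLambda_ideal_zmod : zmod_closed cLambda_ideal.
Proof.
split=> [|f g /asboolP f0 /asboolP g0]; apply/asboolP => z Sz.
  by have := hatB 0 (0 : cLambda L M) z; rewrite !subrr.
by rewrite hatB f0// g0// subrr.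
Qed.
HB.instance Definition _ :=
  GRing.isZmodClosed.Build (cLambda L M) cLambda_ideal cLambda_ideal_zmod.

Lemma cLambda_idealMl f g : f \in cLambda_ideal -> f * g \in cLambda_ideal.
Proof.
by move=> /asboolP f0; apply/asboolP => z Sz; rewrite hatM f0// mul0r.
Qed.

Definition cLambda_quot : Type := {ideal_quot cLambda_ideal}.

HB.instance Definition _ := GRing.Zmodule.on cLambda_quot.

Definition cclass (f : cLambda L M) : cLambda_quot :=
  (\pi_{ideal_quot cLambda_ideal} f)%qT.

Lemma cclass_eq f g : (cclass f == cclass g) = (f - g \in cLambda_ideal).
Proof. by rewrite Quotient.idealrBE. Qed.

Lemma cclass_surj (x : cLambda_quot) : exists f, cclass f = x.
Proof. by exists (repr (x : {ideal_quot cLambda_ideal})); exact: reprK. Qed.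

Lemma cclassB f g : cclass (f - g) = cclass f - cclass g.
Proof. exact: raddfB. Qed.

Lemma cclassD f g : cclass (f + g) = cclass f + cclass g.
Proof. exact: raddfD. Qed.

Definition quot_one : cLambda_quot := cclass 1.
Definition quot_mul (x y : cLambda_quot) : cLambda_quot :=
  cclass (repr (x : {ideal_quot cLambda_ideal}) *
          repr (y : {ideal_quot cLambda_ideal}))%qT.

Lemma cclassM f g : cclass (f * g) = quot_mul (cclass f) (cclass g).
Proof.
have reprB h : repr (cclass h : {ideal_quot cLambda_ideal}) - h \in cLambda_ideal.
  by rewrite -cclass_eq; apply/eqP; exact: reprK.
apply/eqP; rewrite eq_sym cclass_eq; set f' := repr _; set g' := repr _.
rewrite (_ : _ - _ = (f' - f) * g' + (g' - g) * f); last first.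
  by rewrite !mulrBl [g' * f]mulrC [g * f]mulrC addrA subrK.
by rewrite rpredD// cLambda_idealMl// reprB.
Qed.

Fact quot_mulA : associative quot_mul.
Proof.
move=> x y z; have [[[f <-] [g <-]] [h <-]] :=
  (cclass_surj x, cclass_surj y, cclass_surj z).
by rewrite -!cclassM mulrA.
Qed.
Fact quot_mulC : commutative quot_mul.
Proof.
move=> x y; have [[f <-] [g <-]] := (cclass_surj x, cclass_surj y).
by rewrite -!cclassM mulrC.
Qed.
Fact quot_mul1 : left_id quot_one quot_mul.
Proof. by move=> x; have [f <-] := cclass_surj x; rewrite -cclassM mul1r. Qed.
Fact quot_mulDl : left_distributive quot_mul +%R.
Proof.
move=> x y z; have [[[f <-] [g <-]] [h <-]] :=
  (cclass_surj x, cclass_surj y, cclass_surj z).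
by rewrite -cclassD -!cclassM mulrDl cclassD.
Qed.
HB.instance Definition _ := GRing.Zmodule_isComPzRing.Build cLambda_quot
  quot_mulA quot_mulC quot_mul1 quot_mulDl.

Definition quot_spectrum (x : cLambda_quot) : set R[i] :=
  spectrum (fun z : R[i] => cclass (z *: (1 : cLambda L M))) x.

End Quotient.

Definition chi (R : realType) (d : nat) (L : simple_zeros R d) (M : set R[i])
    (H : nzHilbertType R) (A : bop H) (f : cLambda L M) : bop H :=
  \sum_(j < d) horner_alg A (zdelta L j) *
    fun_calc (horner_alg A (zpoly L)) (fun w => ext0 f w j 0).

(* Main.v *)
Require Import Defs.
From HB Require Import structures.
From mathcomp Require Import all_boot all_order all_algebra sesquilinear.
From mathcomp Require Import complex finmap.
From mathcomp Require Import all_classical reals topology normedtype sequences.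
From mathcomp Require Import cyclic separable cyclotomic.
From mathcomp Require Import ring lra.

Set Implicit Arguments.
Unset Strict Implicit.
Unset Printing Implicit Defensive.

Import Order.TTheory GRing.Theory Num.Theory.
Import numFieldNormedType.Exports.

Local Open Scope classical_set_scope.
Local Open Scope ring_scope.
Local Open Scope complex_scope.

(** Both spectra equal the set of values of [hat f] on the spectrum of [A].

    For the operator this is Gelfand theory in the bicommutant of [A], a
    commutative algebra that contains the inverses of its invertible elements,
    so that the spectra of its elements are the sets of values of its
    characters ([bic_spectrumP]). By Fuglede's theorem the bicommutant contains
    the adjoints of its normal elements, hence [N = p(A)], [N^*] and all the
    [f_j(N)], which are limits of polynomials in [N] and [N^*]. A character [h]
    sends [N^*] to the conjugate of [h N] ([character_adjoint]), hence [f_j(N)]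
    to [f_j(p(h A))] and [chi A f] to [hat f (h A)], while [h A] runs through
    the spectrum of [A] ([op_spectrum_chi]). The existence of the [f_j(N)]
    follows from the same ideas: some character attains the norm of a
    polynomial [q] in [N] and [N^*] ([norm_attaining_character]), so this norm
    is at most the supremum of [q] on the spectrum of [N], and polynomials in
    [w] and its conjugate are dense in the continuous functions
    ([weierstrass_conj]).

    For the quotient algebra the point is that [f] is invertible modulo the
    ideal as soon as [hat f] has no zero on the spectrum [S] of [A]
    ([hat_invertible]). Extend [1 / hat f] from [S] to a continuous function
    [al] on the preimage of [p(S)] and let [Pi w] be the product of the
    [1 - al(z) X] over all the roots [z] of [p - w]. The coefficients of [Pi w]
    are symmetric functions of the roots and so are continuous in [w]
    ([symmetric_continuous]); substituting [f] for [X] yields an element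
    [1 - f g] of the algebra, whose [hat] at [z] in [S] contains the factor
    [1 - al(z) hat f (z) = 0].

    Characters exist because spectra are nonempty ([snorm_spectrum_neq0]). This
    fact and Fuglede's theorem ([fuglede]) usually rest on Liouville's theorem,
    which is replaced here by sums over roots of unity. *)

(** * The modulus and compact sets in the complex plane *)

Section RealNorm.
Context {R : realType}.

(** Norms over [R[i]] take their values in [R[i]], where the order is only
    partial; their real part lives in the totally ordered field [R]. *)
Definition rnorm (V : normedZmodType R[i]) (x : V) : R := complex.Re `|x|.

Lemma rnormE (V : normedZmodType R[i]) (x : V) : `|x| = (rnorm x)%:C.
Proof. by rewrite /rnorm RRe_real// normr_real. Qed.

Section Zmod.
Variable V : normedZmodType R[i].
Implicit Types x y : V.

Lemma rnorm_ge0 x : 0 <= rnorm x.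
Proof. by rewrite -lecR -rnormE normr_ge0. Qed.

Lemma rnorm_le x (r : R) : (rnorm x <= r) = (`|x| <= r%:C).
Proof. by rewrite rnormE lecR. Qed.

Lemma rnorm0 : rnorm (0 : V) = 0.
Proof. by apply: complexI; rewrite -rnormE normr0. Qed.

Lemma rnorm_eq0 x : (rnorm x == 0) = (x == 0).
Proof. by rewrite -(inj_eq (@complexI R)) -rnormE normr_eq0. Qed.

Lemma rnorm_gt0 x : (0 < rnorm x) = (x != 0).
Proof. by rewrite lt_neqAle eq_sym rnorm_eq0 rnorm_ge0 andbT. Qed.

Lemma rnormD x y : rnorm (x + y) <= rnorm x + rnorm y.
Proof. by rewrite rnorm_le (le_trans (ler_normD _ _))// !rnormE rmorphD. Qed.

Lemma rnormN x : rnorm (- x) = rnorm x.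
Proof. by rewrite /rnorm normrN. Qed.

Lemma rnormB x y : rnorm (x - y) = rnorm (y - x).
Proof. by rewrite -rnormN opprB. Qed.

Lemma rnormBD y x z : rnorm (x - z) <= rnorm (x - y) + rnorm (y - z).
Proof. by rewrite -[x in X in X <= _](subrK y) -addrA rnormD. Qed.

Lemma rnorm_sum I (s : seq I) (P : pred I) (F : I -> V) :
  rnorm (\sum_(i <- s | P i) F i) <= \sum_(i <- s | P i) rnorm (F i).
Proof.
elim/big_ind2: _ => [|u x v y ux vy|//]; first by rewrite rnorm0.
by rewrite (le_trans (rnormD _ _))// lerD.
Qed.

End Zmod.

Lemma rnormZ (V : normedModType R[i]) (a : R[i]) (x : V) :
  rnorm (a *: x) = rnorm a * rnorm x.
Proof. by apply: complexI; rewrite rmorphM/= -!rnormE normrZ. Qed.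

Implicit Types z w : R[i].

Lemma rnormM z w : rnorm (z * w) = rnorm z * rnorm w.
Proof. by apply: complexI; rewrite rmorphM/= -!rnormE normrM. Qed.

Lemma rnorm1 : rnorm (1 : R[i]) = 1.
Proof. by rewrite /rnorm normr1. Qed.

Lemma rnormX z n : rnorm (z ^+ n) = rnorm z ^+ n.
Proof. by elim: n => [|n ih]; rewrite ?expr0 ?rnorm1// !exprS rnormM ih. Qed.

Lemma rnormV z : rnorm z^-1 = (rnorm z)^-1.
Proof. by apply: complexI; rewrite fmorphV/= -!rnormE normfV. Qed.

Lemma rnorm_real (r : R) : rnorm (r%:C : R[i]) = `|r|.
Proof.
by apply: complexI; rewrite -rnormE normc_def/= expr0n/= addr0 sqrtr_sqr.
Qed.

Lemma rnorm_nat n : rnorm (n%:R : R[i]) = n%:R.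
Proof. by rewrite -(rmorph_nat (real_complex R)) rnorm_real normr_nat. Qed.

Lemma rnormJ z : rnorm (Num.conj z) = rnorm z.
Proof. by rewrite /rnorm norm_conjC. Qed.

Lemma conjcE z : Num.conj z = z^*%C.
Proof. by []. Qed.

Lemma rnormC z : z * Num.conj z = (rnorm z ^+ 2)%:C.
Proof. by rewrite rmorphXn/= -rnormE normCK. Qed.

Lemma rnorm_sqr z : rnorm z ^+ 2 = complex.Re z ^+ 2 + complex.Im z ^+ 2.
Proof. by apply: complexI; rewrite add_Re2_Im2 rnormE rmorphXn. Qed.

Lemma rnorm_Re z : `|complex.Re z| <= rnorm z.
Proof. by rewrite -lecR -rnormE normc_ge_Re. Qed.

Lemma nbhs_rnorm (V : normedModType R[i]) (x : V) (A : set V) :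
  nbhs x A <-> exists2 e : R, 0 < e & forall y, rnorm (x - y) < e -> A y.
Proof.
split=> [/nbhs_ballP[e/= e0 eA]|[e e0 eA]].
  have eE : e = (complex.Re e)%:C by rewrite RRe_real// gtr0_real.
  exists (complex.Re e); first by rewrite -ltcR -eE.
  by move=> y xy; apply: eA; rewrite -ball_normE/= rnormE eE ltcR.
apply/nbhs_ballP; exists e%:C => /=; first by rewrite ltcR.
by move=> y; rewrite -ball_normE/= rnormE ltcR => /eA.
Qed.

Lemma cvg_rnorm (V : normedModType R[i]) T (F : set_system T) (f : T -> V) (l : V) :
  Filter F -> f @ F --> l <->
  forall e : R, 0 < e -> \forall x \near F, rnorm (l - f x) < e.
Proof.
move=> FF; split=> [fl e e0|h A /nbhs_rnorm[e e0 eA]].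
  have : nbhs l [set y | rnorm (l - y) < e] by apply/nbhs_rnorm; exists e.
  exact: fl.
by have := h _ e0; apply: filterS => x /eA.
Qed.

(** The disc is a closed part of a square, which is the continuous image of a
    product of two segments. *)
Lemma compact_rdisc (r : R) : compact [set z : R[i] | rnorm z <= r].
Proof.
pose g (u : R * R) : R[i] := u.1 +i* u.2.
have gB u v : rnorm (g u - g v) <= `|u.1 - v.1| + `|u.2 - v.2|.
  have -> : g u - g v = (u.1 - v.1)%:C + 'i%C * (u.2 - v.2)%:C.
    by rewrite (complexE (g u - g v)).
  rewrite (le_trans (rnormD _ _))// rnorm_real lerD// rnormM rnorm_real.
  rewrite (_ : rnorm _ = 1) ?mul1r//.
  by apply: complexI; rewrite -rnormE normc_def/= expr0n expr1n add0r sqrtr1.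
have cg : continuous g.
  move=> u; apply/cvg_rnorm => e e0.
  have e2 : 0 < e / 2 by rewrite divr_gt0.
  exists (ball u.1 (e / 2), ball u.2 (e / 2)).
    by split; exact: nbhsx_ballx.
  move=> v [/= v1 v2]; rewrite (le_lt_trans (gB _ _))// [ltRHS]splitr ltrD//.
have cK : compact (g @` (`[-r, r]%classic `*` `[-r, r]%classic)).
  apply: continuous_compact; first exact: continuous_subspaceT.
  by apply: compact_setX; exact: segment_compact.
apply: (subclosed_compact _ cK).
  have -> : [set z : R[i] | rnorm z <= r] = ~` [set z | r < rnorm z].
    by apply/seteqP; split=> z /=; rewrite leNgt => /negP.
  apply: open_closedC; rewrite openE => z /= rz; apply/nbhs_rnorm.
  exists (rnorm z - r); first by rewrite subr_gt0.
  move=> w; rewrite ltrBrDr => zw.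
  have := rnormD (z - w) w; rewrite subrK /=; lra.
move=> z /= zr; exists (complex.Re z, complex.Im z); last by case: z zr.
have := rnorm_sqr z; have := rnorm_ge0 z; set a := complex.Re z; set b := complex.Im z.
move=> n0 ns; split=> /=; rewrite in_itv/= -ler_norml.
  by rewrite (le_trans _ zr)// -(ler_pXn2r (n:=2)) ?nnegrE// real_normK ?num_real//; nra.
by rewrite (le_trans _ zr)// -(ler_pXn2r (n:=2)) ?nnegrE// real_normK ?num_real//; nra.
Qed.

Lemma compact_closed_bounded (A : set R[i]) (r : R) :
  closed A -> (forall z, A z -> rnorm z <= r) -> compact A.
Proof. by move=> cA Ar; exact: (subclosed_compact cA (@compact_rdisc r)). Qed.

(** An oscillation smaller than 1 near each point is all that will be known of
    the norms of resolvents. *)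
Lemma real_compact_bounded (T : topologicalType) (K : set T) (f : T -> R) :
  compact K -> (forall x, \forall y \near x, `|f x - f y| < 1) ->
  exists c, forall x, K x -> f x <= c.
Proof.
move=> /compact_near_coveringP cK fK.
have := cK R (pinfty_nbhs R) (fun c x => f x <= c) _ _.
case=> [x Kx|c [_ h]].
  exists ([set y | `|f x - f y| < 1], [set c | f x + 1 <= c]).
    by split=> /=; [exact: fK|apply: nbhs_pinfty_ge; exact: num_real].
  move=> [y c] [/= /ltr_normlP[]]; lra.
by exists (c + 1); apply: h; rewrite ltrDl.
Qed.

Lemma geometric_small (q c e : R) : 0 <= q < 1 -> 0 < e ->
  exists n0, forall n, (n0 <= n)%N -> q ^+ n * c <= e.
Proof.
move=> /andP[q0 q1] e0.
have c1 : 0 < `|c| + 1 by rewrite ltr_wpDl.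
have := @cvg_expr R q; rewrite ger0_norm// => /(_ q1).
move=> /cvgr0Pnorm_le/(_ (e / (`|c| + 1))); rewrite divr_gt0// => /(_ isT)[n0 _ h].
exists n0 => n nn; have := h n nn.
rewrite /= ger0_norm ?exprn_ge0// ler_pdivlMr// => qn.
rewrite (le_trans _ qn)// ler_wpM2l ?exprn_ge0//.
by rewrite (le_trans (ler_norm c))// lerDl.
Qed.

Lemma inv_succ_small (e : R) : 0 < e ->
  exists n0, forall n, (n0 <= n)%N -> n.+1%:R^-1 <= e.
Proof.
move=> e0; exists (Num.truncn e^-1) => n hn.
rewrite -[e]invrK lef_pV2 ?posrE ?invr_gt0 ?ltr0n//.
by rewrite ltW// (lt_le_trans (truncnS_gt _))// ler_nat.
Qed.

End RealNorm.

(** * Roots of unity and seminorms on algebras *)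

Section RootsOfUnity.
Context {R : realType}.
Implicit Types (z w : R[i]).

(** [X^n - 1] is separable, so it has [n] roots, and finite groups of units of
    a field are cyclic. *)
Lemma prim_root_exists n : (0 < n)%N -> exists z : R[i], n.-primitive_root z.
Proof.
move=> n0; pose p : {poly R[i]} := 'X^n - 1.
have [rs pE] := closed_field_poly_normal p.
rewrite (monicP (monicXnsubC _ n0)) scale1r in pE.
have rs1 : all n.-unity_root rs.
  by apply/allP => z; rewrite -root_prod_XsubC -pE.
have srs : (n < (size rs).+1)%N.
  by rewrite -(size_prod_XsubC rs id) -pE size_XnsubC.
have [|z _ zn] := hasP (has_prim_root n0 rs1 _ srs); last by exists z.
by rewrite -separable_prod_XsubC -pE separable_Xn_sub_1// pnatr_eq0 -lt0n.
Qed.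

Lemma sum_prim_root n z m : n.-primitive_root z -> (0 < m < n)%N ->
  \sum_(k < n) (z ^+ k) ^+ m = 0.
Proof.
move=> zn /andP[m0 mn].
have zm1 : z ^+ m - 1 != 0.
  rewrite subr_eq0 -(prim_order_dvd zn).
  by rewrite gtnNdvd.
apply: (mulfI zm1); rewrite mulr0.
under eq_bigr do rewrite exprAC.
by rewrite -subrX1 exprAC (prim_expr_order zn) expr1n subrr.
Qed.

Lemma rnorm_prim_root n z : n.-primitive_root z -> rnorm z = 1.
Proof.
move=> zn; have n0 := prim_order_gt0 zn.
have := congr1 (@rnorm R R[i]) (prim_expr_order zn).
rewrite rnormX rnorm1 => /eqP.
by rewrite pexpr_eq1 ?rnorm_ge0// => /eqP.
Qed.

End RootsOfUnity.

Lemma scalar_algX (K : comNzRingType) (B : algType K) (c : K) m :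
  c%:A ^+ m = (c ^+ m)%:A :> B.
Proof. by rewrite -[RHS]in_algE rmorphXn. Qed.

Section Seminorm.
Context {R : realType} {B : algType R[i]}.

(** Seminorms rather than norms: calculations modulo an ideal are carried out
    in the algebra itself, where congruent elements are those whose difference
    is null for the quotient seminorm. *)
Record alg_seminorm := AlgSeminorm {
  snorm :> B -> R ;
  snormD : forall x y, snorm (x + y) <= snorm x + snorm y ;
  snormM : forall x y, snorm (x * y) <= snorm x * snorm y ;
  snormZ : forall (c : R[i]) x, snorm (c *: x) = rnorm c * snorm x ;
  snorm1 : snorm 1 = 1 }.

Section Theory.
Variable mu : alg_seminorm.
Implicit Types x y a : B.

Lemma snorm0 : mu 0 = 0.
Proof. by have := snormZ mu 0 0; rewrite scale0r rnorm0 mul0r. Qed.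

Lemma snormN x : mu (- x) = mu x.
Proof. by rewrite -scaleN1r snormZ rnormN rnorm1 mul1r. Qed.

Lemma snorm_ge0 x : 0 <= mu x.
Proof. by have := snormD mu x (- x); rewrite subrr snorm0 snormN; lra. Qed.

Lemma snorm_sum I (s : seq I) (P : pred I) (F : I -> B) :
  mu (\sum_(i <- s | P i) F i) <= \sum_(i <- s | P i) mu (F i).
Proof.
elim/big_ind2: _ => [|u x v y ux vy|//]; first by rewrite snorm0.
by rewrite (le_trans (snormD _ _ _))// lerD.
Qed.

Lemma snormX x n : mu (x ^+ n) <= mu x ^+ n.
Proof.
elim: n => [|n ih]; first by rewrite !expr0 snorm1.
by rewrite !exprS (le_trans (snormM _ _ _))// ler_wpM2l// snorm_ge0.
Qed.

Lemma snorm_null x y : mu y = 0 -> mu (x + y) = mu x.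
Proof.
move=> y0; apply/le_anti; have := snormD mu x y; have := snormD mu (x + y) (- y).
by rewrite addrK snormN y0 !addr0 => -> ->.
Qed.

Lemma snorm_nullM x y : mu y = 0 -> mu (x * y) = 0.
Proof.
move=> y0; apply/le_anti; rewrite snorm_ge0 andbT.
by rewrite (le_trans (snormM _ _ _))// y0 mulr0.
Qed.

Lemma snorm_nullD x y : mu x = 0 -> mu y = 0 -> mu (x + y) = 0.
Proof. by move=> x0 y0; rewrite snorm_null. Qed.

Lemma snorm_null_sum I (s : seq I) (P : pred I) (F : I -> B) :
  (forall i, mu (F i) = 0) -> mu (\sum_(i <- s | P i) F i) = 0.
Proof.
by move=> F0; elim/big_ind: _ => [|x y|//]; [exact: snorm0|exact: snorm_nullD].
Qed.

End Theory.
End Seminorm.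

Section Resolvent.
Context {R : realType} {B : comAlgType R[i]}.
Variable mu : @alg_seminorm R B.
Variables (a : B) (r : R[i] -> B).
Hypothesis rP : forall z, mu ((z%:A - a) * r z - 1) = 0.

(** From the resolvent identity, which here holds up to null elements because
    [r z] inverts [z - a] only up to such elements. *)
Lemma resolvent_lipschitz z w :
  mu (r z - r w) <= rnorm (w - z) * mu (r z) * mu (r w).
Proof.
pose e z := (z%:A - a) * r z - 1.
have -> : r z - r w = (w - z) *: (r z * r w) + (r w * e z - r z * e w).
  rewrite -[(w - z) *: _]mulr_algl scalerBl /e; ring.
have e0 z' : mu (e z') = 0 by exact: rP.
rewrite snorm_null; last by rewrite snorm_nullD// ?snormN snorm_nullM.
by rewrite snormZ -mulrA ler_wpM2l ?rnorm_ge0// snormM.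
Qed.

Lemma resolvent_near z : \forall w \near z, `|mu (r z) - mu (r w)| < 1.
Proof.
have [K KE] : {K | K = mu (r z) + 1} by exists (mu (r z) + 1).
have K1 : 1 <= K by have := snorm_ge0 mu (r z); rewrite KE; lra.
have K0 : 0 < K by lra.
apply/nbhs_rnorm; exists (2 * K ^+ 2)^-1.
  by rewrite invr_gt0 mulr_gt0// exprn_gt0.
move=> w zw.
have zw' : rnorm (w - z) * (2 * K ^+ 2) < 1.
  by rewrite rnormB -ltr_pdivlMr ?mul1r// mulr_gt0// exprn_gt0.
have := resolvent_lipschitz z w; have n0 := rnorm_ge0 (w - z).
have [w0 z0] := (snorm_ge0 mu (r w), snorm_ge0 mu (r z)).
set n := rnorm (w - z) in zw' n0 *; set u := mu (r z) in KE z0 *.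
set v := mu (r w) in w0 *.
set D := mu _ => hD.
have uv : u <= D + v by rewrite /u -[r z](subrK (r w)); exact: snormD.
have vu : v <= D + u.
  by rewrite /v -[r w](subrK (r z)) -[D]snormN opprB; exact: snormD.
have nK : n * K <= 2^-1 / K.
  rewrite ler_pdivlMr// -mulrA -expr2; lra.
have nu2 : n * u <= 2^-1 / K.
  by rewrite (le_trans _ nK)// ler_wpM2l//; lra.
have K2 : 2^-1 / K <= 2^-1 by rewrite ler_pdivrMr//; lra.
have v2 : v <= 2 * u.
  have : n * u * v <= 2^-1 * v by rewrite ler_wpM2r// (le_trans nu2).
  by move: hD; clear -vu; lra.
have D1 : D < 1.
  have : D <= 2^-1 / K * (2 * u).
    by rewrite (le_trans hD)// ler_pM// mulr_ge0.
  have -> : 2^-1 / K * (2 * u) = u / K by field; rewrite gt_eqF.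
  move/le_lt_trans; apply; rewrite ltr_pdivrMr// KE; lra.
by rewrite ltr_norml; apply/andP; split; lra.
Qed.

End Resolvent.

(** * The spectrum is nonempty *)

Section GelfandMazur.
Context {R : realType} {B : comAlgType R[i]}.
Variable mu : @alg_seminorm R B.

Section Averages.
Variables (a : B) (r : R[i] -> B).
Hypothesis rP : forall z, mu ((z%:A - a) * r z - 1) = 0.

(** A discrete Cauchy integral of the resolvent over the circle of radius
    [x]. By [circle_meanE] it is the inverse of [1 - (a / x)^n], up to null
    elements. *)
Definition circle_mean n (w : R[i]) (x : R) : B :=
  n%:R^-1 *: \sum_(k < n) ((x%:C * w ^+ k) *: r (x%:C * w ^+ k)).
Local Notation G := circle_mean.

(** Factor [z^n - a^n] through [z - a] at each of the [n] points: [z^n] is the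
    same everywhere and the sums of the lower powers of [z] vanish. *)
Lemma circle_meanE n w x : n.-primitive_root w ->
  mu (x%:C ^+ n *: (1 - G n w x) + a ^+ n * G n w x) = 0.
Proof.
move=> wn; have n0 := prim_order_gt0 wn.
have nn0 : (n%:R : R[i]) != 0 by rewrite pnatr_eq0 -lt0n.
pose z (k : 'I_n) := x%:C * w ^+ k.
pose e u := (u%:A - a) * r u - 1.
pose S u : B := \sum_(i < n) u%:A ^+ (n.-1 - i) * a ^+ i.
have zn k : z k ^+ n = x%:C ^+ n.
  by rewrite /z exprMn exprAC (prim_expr_order wn) expr1n mulr1.
have key k : (x%:C ^+ n)%:A * (z k *: r (z k)) - a ^+ n * (z k *: r (z k)) =
    z k *: S (z k) + (z k *: S (z k)) * e (z k).
  rewrite -mulrBl -(zn k).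
  rewrite -scalar_algX subrXX -/(S _) -!scalerAr -!scalerAl -scalerDr; congr (_ *: _).
  by rewrite /e; ring.
have sumS : \sum_k z k *: S (z k) = (n%:R * x%:C ^+ n)%:A.
  transitivity (\sum_(i < n) (\sum_k (z k) ^+ (n - i)) *: a ^+ i).
    under eq_bigr do rewrite /S scaler_sumr.
    rewrite exchange_big/=; apply: eq_bigr => i _.
    rewrite scaler_suml; apply: eq_bigr => k _.
    rewrite scalar_algX mulr_algl scalerA -exprS.
    by rewrite -subn1 -subnDA addnC subnDA subn1 prednK// subn_gt0.
  rewrite (bigD1 (Ordinal n0))//= subn0 expr0.
  under eq_bigr do rewrite zn.
  rewrite sumr_const card_ord big1 ?addr0 ?mulr_natl// => i i0.
  under eq_bigr do rewrite /z exprMn.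
  rewrite -mulr_sumr (sum_prim_root wn) ?mulr0 ?scale0r//.
  have i0' : (0 < i)%N.
    by rewrite lt0n; apply: contra i0 => /eqP i0; apply/eqP/val_inj.
  by rewrite subn_gt0 ltn_ord/= ltn_subrL i0' n0.
have -> : x%:C ^+ n *: (1 - G n w x) + a ^+ n * G n w x =
    - (n%:R^-1 *: \sum_k (z k *: S (z k)) * e (z k)).
  have -> : \sum_k (z k *: S (z k)) * e (z k) =
     ((x%:C ^+ n)%:A - a ^+ n) * \sum_k z k *: r (z k) - (n%:R * x%:C ^+ n)%:A.
    rewrite mulr_sumr -sumS -sumrB; apply: eq_bigr => k _.
    by rewrite mulrBl key addrC addKr.
  rewrite [in RHS]scalerBr [in RHS]scalerA mulKf// scalerAr -/(G n w x).
  by rewrite [in LHS]scalerBr -[_ *: G _ _ _]mulr_algl; ring.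
rewrite snormN snormZ snorm_null_sum ?mulr0// => k.
by apply: snorm_nullM; exact: rP.
Qed.

(** By [circle_meanE] both arguments are [- a^n G(s) G(t)] up to null elements.
    For [s < t] and [n] large, [G(s) (1 - G(t))] is therefore small. *)
Lemma circle_mean_step n w (s t : R) : n.-primitive_root w ->
  mu (t%:C ^+ n *: (G n w s * (1 - G n w t))) =
  mu (s%:C ^+ n *: ((1 - G n w s) * G n w t)).
Proof.
move=> wn; set u := G n w s; set v := G n w t.
have hs := circle_meanE s wn; have ht := circle_meanE t wn.
rewrite -/u in hs; rewrite -/v in ht.
set es := (X in mu X = 0) in hs; set et := (X in mu X = 0) in ht.
have -> : t%:C ^+ n *: (u * (1 - v)) =
    s%:C ^+ n *: ((1 - u) * v) + (u * et - v * es).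
  pose A (c : R[i]) : B := c%:A.
  have AE c y : c *: y = A c * y by rewrite /A mulr_algl.
  rewrite /et /es !AE; move: (A _) (A _) => cs ct; ring.
by rewrite snorm_null// snorm_nullD ?snormN ?snorm_nullM.
Qed.

Lemma circle_mean_bound n w (x K : R) : (0 < n)%N -> rnorm w = 1 -> 0 <= K ->
  (forall z, rnorm z <= `|x| -> mu (r z) <= K) -> mu (G n w x) <= `|x| * K.
Proof.
move=> n0 w1 K0 rK; rewrite snormZ rnormV rnorm_nat.
rewrite mulrC ler_pdivrMr ?ltr0n// (le_trans (snorm_sum _ _ _ _))//.
rewrite mulr_natr -[X in _ *+ X]card_ord -sumr_const.
apply: ler_sum => k _; rewrite snormZ.
have -> : rnorm (x%:C * w ^+ k) = `|x|.
  by rewrite rnormM rnormX w1 expr1n mulr1 rnorm_real.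
rewrite ler_wpM2l// rK//.
by rewrite rnormM rnormX w1 expr1n mulr1 rnorm_real.
Qed.

Lemma circle_mean_lip n w (x y rho K : R) : (0 < n)%N -> rnorm w = 1 -> 0 <= K ->
  `|x| <= rho -> `|y| <= rho ->
  (forall z, rnorm z <= rho -> mu (r z) <= K) ->
  mu (G n w x - G n w y) <= `|x - y| * (K + rho * K ^+ 2).
Proof.
move=> n0 w1 K0 xr yr rK; rewrite -scalerBr -sumrB snormZ rnormV rnorm_nat.
rewrite mulrC ler_pdivrMr ?ltr0n// (le_trans (snorm_sum _ _ _ _))//.
rewrite mulr_natr -[X in _ *+ X]card_ord -sumr_const.
apply: ler_sum => k _.
have nE (t : R) : rnorm (t%:C * w ^+ k) = `|t|.
  by rewrite rnormM rnormX w1 expr1n mulr1 rnorm_real.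
set u := x%:C * _; set v := y%:C * _.
have uv : rnorm (u - v) = `|x - y| by rewrite -mulrBl -rmorphB nE.
have -> : u *: r u - v *: r v = (u - v) *: r u + v *: (r u - r v).
  by rewrite scalerBl scalerBr addrA subrK.
rewrite (le_trans (snormD _ _ _))// mulrDr !snormZ uv lerD//.
  by rewrite ler_wpM2l// rK// nE.
rewrite nE mulrCA ler_pM// ?snorm_ge0//.
rewrite (le_trans (resolvent_lipschitz rP _ _))// rnormB uv -mulrA ler_wpM2l//.
by rewrite expr2 ler_pM ?snorm_ge0// rK ?nE.
Qed.

End Averages.

(** If all the resolvents of [a] existed, the circle means would depend on the
    radius continuously, uniformly in [n]. They vanish at radius 0 and are close
    to 1 at large radii. But if the mean at the radius [t] has seminorm at most
    3/4, then [circle_mean_step] makes the mean at any smaller radius [s] tend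
    to 0 when [n] grows; since short steps increase the seminorm by at most 1/4,
    it stays below 1/4 along any finite chain of short steps, for [n] large. *)
Lemma snorm_spectrum_neq0 (a : B) :
  exists z : R[i], forall b, mu ((z%:A - a) * b - 1) <> 0.
Proof.
apply: contrapT => /forallNP h.
have {h} /choice[r rP] : forall z : R[i], exists b, mu ((z%:A - a) * b - 1) = 0.
  by move=> z; have /existsNP[b /contrapT bP] := h z; exists b.
pose G := circle_mean r.
have ma0 := snorm_ge0 mu a.
(* At the radius [4 (mu a + 1)] the mean is close to 1; the margin 1 leaves room
   for one more step. *)
pose rho := 4 * (mu a + 1) + 1.
have [K0 rK0] := real_compact_bounded (@compact_rdisc R rho) (resolvent_near rP).
pose K := `|K0|.
have K_ge0 : 0 <= K by exact: normr_ge0.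
have rK z : rnorm z <= rho -> mu (r z) <= K.
  by move=> /rK0 /le_trans; apply; exact: ler_norm.
have rho0 : 0 < rho by rewrite /rho; lra.
pose C := K + rho * K ^+ 2 + 1.
have C1 : 1 <= C.
  by rewrite /C lerDr addr_ge0// mulr_ge0 ?exprn_ge0// ltW.
pose dl := (4 * C)^-1.
have dl0 : 0 < dl by rewrite invr_gt0; lra.
have dlC : dl * (K + rho * K ^+ 2) <= 4^-1.
  have : dl * C = 4^-1 by rewrite /dl; field; lra.
  by rewrite /C mulrDr mulr1; lra.
have dl1 : dl <= 4^-1 by rewrite /dl lef_pV2 ?posrE//; lra.
pose D := (1 + rho * K) * (rho * K).
have P j : j.+1%:R * dl <= rho -> exists n0, forall n, (n0 <= n)%N ->
    forall w, n.-primitive_root w -> mu (G n w (j%:R * dl)) <= 4^-1.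
  elim: j => [_|j ih jr].
    exists 0%N => n _ w wn; rewrite mul0r /G /circle_mean.
    by rewrite big1 ?scaler0 ?snorm0 ?invr_ge0// => k _; rewrite mul0r scale0r.
  have step k : k.+1%:R * dl = k%:R * dl + dl by rewrite -natr1 mulrDl mul1r.
  have jd0 : 0 <= j%:R * dl by rewrite mulr_ge0 ?ler0n// ltW.
  have [|n1 hn1] := ih; first by rewrite (le_trans _ jr)// [leRHS]step lerDl ltW.
  pose q : R := (j.+1%:R / j.+2%:R).
  have q01 : 0 <= q < 1.
    by rewrite divr_ge0 ?ler0n//= ltr_pdivrMr ?ltr0n// mul1r ltr_nat.
  have [|n2 hn2] := @geometric_small R q D 16^-1 q01; first by rewrite invr_gt0.
  exists (maxn n1 n2) => n; rewrite geq_max => /andP[n1n n2n] w wn.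
  have n0 := prim_order_gt0 wn; have w1 := rnorm_prim_root wn.
  set s := j.+1%:R * dl; pose t := j.+2%:R * dl.
  have tE : t = s + dl by exact: step.
  have sE : s = j%:R * dl + dl by exact: step.
  have s0 : 0 < s by rewrite sE ltr_wpDl.
  have t0 : 0 < t by rewrite tE addr_gt0.
  have tr : t <= rho by [].
  have sr : s <= rho by rewrite (le_trans _ tr)// tE lerDl ltW.
  have gs := hn1 n n1n w wn.
  have lip (x y : R) : `|x| <= rho -> `|y| <= rho -> `|x - y| = dl ->
      mu (G n w x - G n w y) <= 4^-1.
    by move=> xr yr xy; rewrite (le_trans (circle_mean_lip rP n0 w1 K_ge0 xr yr rK))// xy.
  have h1 : mu (G n w s - G n w (j%:R * dl)) <= 4^-1.
    apply: lip; rewrite ?ger0_norm ?(ltW s0)//; first by rewrite (le_trans _ sr)// sE lerDl ltW.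
      by rewrite sE addrC addKr.
    by rewrite subr_ge0 sE lerDl ltW.
  have h2 : mu (G n w t - G n w s) <= 4^-1.
    by apply: lip; rewrite ?gtr0_norm// tE addrC addKr.
  have Gb (x : R) : 0 <= x -> x <= rho -> mu (G n w x) <= rho * K.
    move=> x0 xr; rewrite (le_trans (circle_mean_bound n0 w1 K_ge0 _))//.
      by move=> z zx; rewrite rK// (le_trans zx)// ger0_norm.
    by rewrite ger0_norm// ler_wpM2r.
  have small : mu (G n w s * (1 - G n w t)) <= 16^-1.
    have := circle_mean_step rP s t wn; rewrite -/(G n w s) -/(G n w t) !snormZ.
    rewrite -!rmorphXn !rnorm_real !gtr0_norm ?exprn_gt0// => hst.
    have tn0 : 0 < t ^+ n by rewrite exprn_gt0.
    rewrite (le_trans _ (hn2 n n2n))//.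
    have -> : q ^+ n = s ^+ n / t ^+ n.
      rewrite /q -expr_div_n; congr (_ ^+ _); rewrite /s /t.
      by rewrite -mulf_div divff ?mulr1 ?gt_eqF.
    rewrite mulrAC ler_pdivlMr// mulrC hst ler_wpM2l ?exprn_ge0 ?(ltW s0)//.
    rewrite (le_trans (snormM _ _ _))// /D ler_pM ?snorm_ge0 ?Gb ?(ltW t0)//.
    by rewrite (le_trans (snormD _ _ _))// snorm1 snormN lerD2l Gb ?(ltW s0).
  have S0 := snorm_ge0 mu (G n w s).
  have Gs2 : mu (G n w s) <= 2^-1.
    rewrite -[G n w s](subrK (G n w (j%:R * dl))).
    by rewrite (le_trans (snormD _ _ _))//; lra.
  have Gt34 : mu (G n w t) <= 3 / 4.
    by rewrite -[G n w t](subrK (G n w s)) (le_trans (snormD _ _ _))//; lra.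
  have : mu (G n w s) <= 16^-1 + mu (G n w s) * (3 / 4).
    have {1}-> : G n w s = G n w s * (1 - G n w t) + G n w s * G n w t by ring.
    rewrite (le_trans (snormD _ _ _))// lerD// (le_trans (snormM _ _ _))//.
    by rewrite ler_wpM2l.
  by lra.
pose L := (Num.truncn (4 * (mu a + 1) / dl)).+1.
have x0 : 0 <= 4 * (mu a + 1) / dl by rewrite divr_ge0 ?(ltW dl0)//; lra.
have Ld : 4 * (mu a + 1) <= L%:R * dl.
  rewrite -ler_pdivrMr// ltW//; exact: truncnS_gt.
have Lr : L.+1%:R * dl <= rho.
  have : (Num.truncn (4 * (mu a + 1) / dl))%:R * dl <= 4 * (mu a + 1).
    by rewrite -ler_pdivlMr// truncn_le.
  rewrite /L -!natr1 !mulrDl mul1r /rho; move: dl1; clear; lra.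
have [n0 hn0] := P L Lr.
have [w wn] := @prim_root_exists R n0.+1 isT.
have Gw := hn0 _ (leqnSn n0) w wn.
have := circle_meanE rP (L%:R * dl) wn; rewrite -/(G _ _ _).
set x := L%:R * dl in Ld Gw *; set g := G _ _ _ in Gw *.
move=> hg.
have xp : 0 < x by lra.
have e1 : x ^+ n0.+1 * mu (1 - g) = mu (a ^+ n0.+1 * g).
  have -> : a ^+ n0.+1 * g = - (x%:C ^+ n0.+1 *: (1 - g)) +
     (x%:C ^+ n0.+1 *: (1 - g) + a ^+ n0.+1 * g) by rewrite addKr.
  by rewrite [RHS]snorm_null// snormN snormZ -rmorphXn rnorm_real gtr0_norm// exprn_gt0.
have e2 : mu (1 - g) <= 4^-1 * mu g.
  rewrite -(ler_pM2l (exprn_gt0 n0.+1 xp)) e1 (le_trans (snormM _ _ _))//.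
  rewrite mulrA ler_wpM2r ?snorm_ge0// (le_trans (snormX _ _ _))//.
  rewrite !exprS.
  have ax : mu a <= x * 4^-1 by lra.
  rewrite -mulrAC ler_pM ?exprn_ge0// lerXn2r ?nnegrE ?(ltW xp)//; lra.
have g0 := snorm_ge0 mu g.
have : 1 <= mu g + mu (1 - g).
  by have := snormD mu g (1 - g); rewrite addrC subrK snorm1.
lra.
Qed.

End GelfandMazur.

(** * Characters of commutative algebras *)

Section Gelfand.
Context {R : realType} {B : comAlgType R[i]}.

Definition is_ideal (J : set B) : Prop :=
  [/\ J 0, forall x y, J x -> J y -> J (x + y) & forall b x, J x -> J (b * x)].

(** Zorn's lemma; the last property of [J] says that [B / J] is a field. *)
Lemma maximal_ideal_above (x : B) : (forall y, x * y <> 1) ->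
  exists J : set B, [/\ is_ideal J, J x, ~ J 1 &
    forall y, ~ J y -> exists b, J (b * y - 1)].
Proof.
move=> xN1.
(* The membership of [x] is required of nonempty [J] only, so that the union of
   the empty chain is admissible. *)
pose P (J : set B) := [/\ forall u v, J u -> J v -> J (u + v),
  forall b u, J u -> J (b * u), ~ J 1 & J !=set0 -> J x].
have [F FP tF|J [[JD JM J1 Jx] Jmax]] := @Zorn_bigcup B P.
  split.
  - move=> u v [X FX Xu] [Y FY Yv]; have [XY|YX] := tF _ _ FX FY.
      by exists Y => //; have [YD _ _ _] := FP _ FY; apply: YD => //; exact: XY.
    by exists X => //; have [XD _ _ _] := FP _ FX; apply: XD => //; exact: YX.
  - by move=> b u [X FX Xu]; exists X => //; have [_ XM _ _] := FP _ FX; exact: XM.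
  - by move=> [X FX X1]; have [_ _ + _] := FP _ FX; exact.
  - move=> [u [X FX Xu]]; exists X => //; have [_ _ _ Xx] := FP _ FX.
    by apply: Xx; exists u.
have max K : P K -> J `<=` K -> K `<=` J.
  move=> PK JK; apply: contrapT => KJ.
  by apply: (Jmax K) => //; split.
have J_x : J x.
  apply: contrapT => nJx.
  have J0 : J = set0.
    by apply/seteqP; split=> // u Ju; apply: nJx; apply: Jx; exists u.
  apply: nJx; apply: (max [set b * x | b in setT]).
  - split.
    + by move=> _ _ [b _ <-] [c _ <-]; exists (b + c) => //; rewrite mulrDl.
    + by move=> b _ [c _ <-]; exists (b * c) => //; rewrite mulrA.
    + by move=> [b _ /esym]; rewrite mulrC => /esym; exact: xN1.
    + by move=> _; exists 1 => //; rewrite mul1r.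
  - by rewrite J0.
  - by exists 1 => //; rewrite mul1r.
exists J; split=> //.
  by split=> //; rewrite -(mul0r x); exact: JM.
move=> y nJy.
pose K := [set u + b * y | u in J & b in setT].
have JK : J `<=` K by move=> u Ju; exists u => //; exists 0 => //; rewrite mul0r addr0.
have [K1|K1] := pselect (K 1).
  have [u Ju [b _ ub]] := K1; exists b.
  by rewrite -ub opprD addrCA subrr addr0 -mulN1r; exact: JM.
exfalso; apply: nJy; apply: (max K) => //; last first.
  by exists 0; [rewrite -(mul0r x); exact: JM|exists 1 => //; rewrite add0r mul1r].
split=> //.
- move=> _ _ [u Ju [b _ <-]] [v Jv [c _ <-]]; exists (u + v); first exact: JD.
  by exists (b + c) => //; ring.
- move=> b _ [u Ju [c _ <-]]; exists (b * u); first exact: JM.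
  by exists (b * c) => //; ring.
- by move=> _; exact: JK.
Qed.

Section QuotientSeminorm.
Variables (nu : @alg_seminorm R B) (J : set B).
Hypothesis Jideal : is_ideal J.
Hypothesis J1 : forall j, J j -> 1 <= nu (1 + j).

Let qset x := [set nu (x + j) | j in J].
Let q x := inf (qset x).

Let qset_inf x : has_inf (qset x).
Proof.
split; last by exists 0 => _ [j _ <-]; exact: snorm_ge0.
by exists (nu (x + 0)), 0 => //; case: Jideal.
Qed.

Let q_le x j : J j -> q x <= nu (x + j).
Proof.
by move=> Jj; apply: ge_inf; [case: (qset_inf x)|exists j].
Qed.

Let q_lt x (e : R) : 0 < e -> exists2 j, J j & nu (x + j) < q x + e.
Proof. by move=> e0; have [_ [j Jj <-]] := inf_adherent e0 (qset_inf x); exists j. Qed.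

Let q_ge0 x : 0 <= q x.
Proof. by apply: lb_le_inf; [case: (qset_inf x)|move=> _ [j _ <-]; exact: snorm_ge0]. Qed.

Let qD x y : q (x + y) <= q x + q y.
Proof.
apply/ler_addgt0Pr => e e0; have e2 : 0 < e / 2 by rewrite divr_gt0.
have [[j Jj hj] [k Jk hk]] := (q_lt x e2, q_lt y e2).
case: Jideal => _ JD _.
apply: (le_trans (q_le (x + y) (JD _ _ Jj Jk))).
by rewrite addrACA (le_trans (snormD _ _ _))//; lra.
Qed.

Let qM x y : q (x * y) <= q x * q y.
Proof.
case: Jideal => _ JD JM.
have key (e : R) : 0 < e -> q (x * y) <= (q x + e) * (q y + e).
  move=> e0; have [[j Jj hj] [k Jk hk]] := (q_lt x e0, q_lt y e0).
  have Jxy : J (x * k + (y + k) * j) by apply: JD; exact: JM.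
  apply: (le_trans (q_le _ Jxy)).
  have -> : x * y + (x * k + (y + k) * j) = (x + j) * (y + k) by ring.
  by rewrite (le_trans (snormM _ _ _))// ler_pM ?snorm_ge0 ?ltW.
apply/ler_addgt0Pr => e e0.
have [qx qy] := (q_ge0 x, q_ge0 y).
pose s := q x + q y + 1.
have s1 : 0 < s by rewrite /s; lra.
pose d := Num.min 1 (e / s).
have d0 : 0 < d by rewrite lt_min ltr01 divr_gt0.
have d1 : d <= 1 by rewrite ge_min lexx.
have ds : d * s <= e by rewrite -ler_pdivlMr// ge_min lexx orbT.
rewrite (le_trans (key _ d0))//; move: ds; rewrite /s; nra.
Qed.

Let qZ (c : R[i]) x : q (c *: x) = rnorm c * q x.
Proof.
case: Jideal => J0 JD JM.
have JZ b j : J j -> J (b *: j) by rewrite -mulr_algl; exact: JM.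
have le b y : q (b *: y) <= rnorm b * q y.
  apply/ler_addgt0Pr => e e0.
  have b1 : 0 < rnorm b + 1 by rewrite ltr_wpDl ?rnorm_ge0.
  have [|j Jj hj] := @q_lt y (e / (rnorm b + 1)); first by rewrite divr_gt0.
  rewrite (le_trans (q_le _ (JZ b _ Jj)))// -scalerDr snormZ.
  rewrite (le_trans (ler_wpM2l (rnorm_ge0 b) (ltW hj)))// mulrDr lerD2l.
  by rewrite mulrCA ler_piMr ?(ltW e0)// ler_pdivrMr// mul1r lerDl.
apply/le_anti; rewrite le/=.
have [->|c0] := eqVneq c 0; first by rewrite rnorm0 mul0r.
have n0 : 0 < rnorm c by rewrite rnorm_gt0.
have := le c^-1 (c *: x); rewrite scalerA mulVf// scale1r rnormV.
by rewrite -ler_pdivlMl ?invr_gt0// invrK.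
Qed.

Let q1 : q 1 = 1.
Proof.
apply/le_anti/andP; split.
  by rewrite -[leRHS](snorm1 nu) -[X in nu X]addr0 q_le//; case: Jideal.
by apply: lb_le_inf; [case: (qset_inf 1)|move=> _ [j Jj <-]; exact: J1].
Qed.

Definition quotient_seminorm : @alg_seminorm R B := AlgSeminorm qD qM qZ q1.

Lemma quotient_seminorm0 j : J j -> quotient_seminorm j = 0.
Proof.
case: Jideal => J0 JD JM Jj; apply/le_anti; rewrite q_ge0 andbT.
have Jj' : J (- j) by rewrite -mulN1r; exact: JM.
by rewrite (le_trans (q_le _ Jj'))// subrr snorm0.
Qed.

End QuotientSeminorm.

Record is_character (h : B -> R[i]) : Prop := IsCharacter {
  charD : forall x y, h (x + y) = h x + h y ;
  charM : forall x y, h (x * y) = h x * h y ;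
  charZ : forall c x, h (c *: x) = c * h x ;
  char1 : h 1 = 1 }.

Section CharacterTheory.
Variables (h : B -> R[i]) (hh : is_character h).

Lemma charB x y : h (x - y) = h x - h y.
Proof. by rewrite -scaleN1r (charD hh) (charZ hh) mulN1r. Qed.

Lemma char_neq_unit x b : h x = 0 -> x * b <> 1.
Proof.
move=> hx xb; have /eqP := char1 hh.
by rewrite -xb (charM hh) hx mul0r eq_sym oner_eq0.
Qed.

Lemma char_sum I (s : seq I) (P : pred I) (F : I -> B) :
  h (\sum_(i <- s | P i) F i) = \sum_(i <- s | P i) h (F i).
Proof.
apply: (big_morph h (charD hh)).
by have := charZ hh 0 0; rewrite scale0r mul0r.
Qed.

Lemma charX x n : h (x ^+ n) = h x ^+ n.
Proof.
by elim: n => [|n ih]; rewrite ?expr0 ?(char1 hh)// !exprS (charM hh) ih.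
Qed.

Lemma char_horner (p : {poly R[i]}) x : h (horner_alg x p) = p.[h x].
Proof.
rewrite /horner_alg /horner_morph/= !horner_coef size_map_poly char_sum.
by apply: eq_bigr => i _; rewrite coef_map/= mulr_algl (charZ hh) charX.
Qed.

End CharacterTheory.

(** Gelfand's theorem. A maximal ideal [J] that contains [x] keeps away from 1,
    because elements close to 1 are invertible. So [snorm_spectrum_neq0] applies
    to the quotient seminorm: each [y] differs from some scalar by a non-unit
    modulo [J], that is, by an element of [J], and this scalar is [h y]. *)
Lemma exists_character (nu : @alg_seminorm R B) (x : B) :
  (forall u, nu (1 - u) < 1 -> exists b, u * b = 1) ->
  (forall y, x * y <> 1) ->
  exists h, [/\ is_character h, h x = 0 & forall y, rnorm (h y) <= nu y].
Proof.
move=> nu_unit /maximal_ideal_above[J [Jideal Jx J1 Jmax]].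
have [J0 JD JM] := Jideal.
have JN j : J j -> J (- j) by rewrite -mulN1r; exact: JM.
have J1' j : J j -> 1 <= nu (1 + j).
  move=> Jj; rewrite leNgt; apply/negP => h; apply: J1.
  have [|b <-] := nu_unit (- j); first by rewrite opprK.
  by rewrite mulrC; apply: JM; exact: JN.
pose q := quotient_seminorm Jideal J1'.
have q0 := quotient_seminorm0 Jideal J1'.
have ex y : exists z : R[i], J (z%:A - y).
  have [z hz] := snorm_spectrum_neq0 q y; exists z; apply: contrapT => nJ.
  by have [b Jb] := Jmax _ nJ; apply: (hz b); apply: q0; rewrite mulrC.
have scal (c : R[i]) : J (c%:A) -> c = 0.
  move=> Jc; apply: contrapT => /eqP c0; apply: J1.
  have -> : 1 = c^-1%:A * c%:A :> B by rewrite mulr_algl scalerA mulVf// scale1r.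
  exact: JM.
have uniq y z w : J (z%:A - y) -> J (w%:A - y) -> z = w.
  move=> Jz Jw; apply/eqP; rewrite -subr_eq0; apply/eqP/scal.
  rewrite scalerBl (_ : _ - _ = (z%:A - y) - (w%:A - y)); last first.
    by rewrite opprB addrA subrK.
  by apply: JD => //; exact: JN.
have [h hP] := choice ex.
have hh : is_character h.
  split.
  - move=> u v; apply: (uniq (u + v)); first exact: hP.
    by rewrite scalerDl opprD addrACA; apply: JD; exact: hP.
  - move=> u v; apply: (uniq (u * v)); first exact: hP.
    have -> : (h u * h v)%:A - u * v =
        (h v)%:A * ((h u)%:A - u) + u * ((h v)%:A - v).
      rewrite -scalerA -[h u *: (_ *: _)]mulr_algl; ring.
    by apply: JD; apply: JM; exact: hP.
  - move=> c u; apply: (uniq (c *: u)); first exact: hP.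
    have -> : (c * h u)%:A - c *: u = c%:A * ((h u)%:A - u).
      by rewrite mulr_algl scalerBr scalerA.
    by apply: JM; exact: hP.
  - by apply: (uniq 1); [exact: hP|rewrite scale1r subrr].
exists h; split=> //; first apply: (uniq x) => //.
  by rewrite scale0r add0r; exact: JN.
move=> y; rewrite leNgt; apply/negP => yh.
have hy0 : h y != 0.
  by rewrite -rnorm_eq0 gt_eqF// (le_lt_trans _ yh)// snorm_ge0.
have hy1 : 0 < rnorm (h y) by rewrite (le_lt_trans _ yh)// snorm_ge0.
have [|b] := nu_unit (1 - (h y)^-1 *: y).
  by rewrite opprB addrC subrK snormZ rnormV ltr_pdivrMl// mulr1.
by apply: (char_neq_unit hh); rewrite (charB hh) (char1 hh) (charZ hh) mulVf ?subrr.
Qed.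

End Gelfand.

(** * The operator norm *)

Section OperatorNorm.
Context {R : realType} {H : nzHilbertType R}.
Implicit Types (S T U : bop H) (x y : H).

Lemma bopD T x y : T (x + y) = T x + T y.
Proof. by have := bop_linear T 1 x y; rewrite !scale1r. Qed.

Lemma bop0 T : T 0 = 0.
Proof. by apply: (addrI (T 0)); rewrite -bopD !addr0. Qed.

Lemma bopZ T c x : T (c *: x) = c *: T x.
Proof. by have := bop_linear T c x 0; rewrite bop0 !addr0. Qed.

Lemma bop_bounded T : exists2 k : R, 0 <= k & forall x, rnorm (T x) <= k * rnorm x.
Proof.
have /asboolP[_ [k k0 kT]] := bop_subproof T.
have kE : k = (complex.Re k)%:C by rewrite RRe_real// ger0_real.
exists (complex.Re k) => [|x]; first by rewrite -lecR -kE.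
by rewrite -lecR rmorphM/= -kE -!rnormE.
Qed.

Lemma exists_bop (f : H -> H) (k : R) : linear f -> 0 <= k ->
  (forall x, rnorm (f x) <= k * rnorm x) -> exists T : bop H, forall x, T x = f x.
Proof.
move=> lf k0 kf.
have fb : f \in bounded_linear.
  apply/asboolP; split=> //; exists k%:C; first by rewrite lecR.
  by move=> x; rewrite !rnormE -rmorphM lecR.
by exists (Bop fb).
Qed.

Let nset T := [set complex.Re `|T x| | x in [set x : H | `|x| <= 1]].

Let nset_sup T : has_sup (nset T).
Proof.
split; first by exists (complex.Re `|T 0|), 0 => //=; rewrite normr0.
have [k k0 kT] := bop_bounded T.
exists k => _ [x /= x1 <-]; rewrite (le_trans (kT x))// ler_piMr//.
by rewrite -lecR -rnormE.
Qed.

Lemma op_norm_le1 T x : rnorm x <= 1 -> rnorm (T x) <= op_norm T.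
Proof.
move=> x1; apply: sup_upper_bound; first exact: nset_sup.
by exists x => //=; rewrite rnormE lecR.
Qed.

Lemma op_norm_ge0 T : 0 <= op_norm T.
Proof. by have := @op_norm_le1 T 0; rewrite bop0 !rnorm0; apply. Qed.

Lemma op_normP T x : rnorm (T x) <= op_norm T * rnorm x.
Proof.
have [->|x0] := eqVneq x 0; first by rewrite bop0 !rnorm0 mulr0.
have n0 : 0 < rnorm x by rewrite rnorm_gt0.
rewrite -ler_pdivrMr//.
have nE : rnorm ((rnorm x)^-1%:C : R[i]) = (rnorm x)^-1.
  by rewrite rnorm_real ger0_norm// invr_ge0 rnorm_ge0.
have := @op_norm_le1 T ((rnorm x)^-1%:C *: x).
by rewrite bopZ !rnormZ nE mulVf ?gt_eqF// lexx mulrC => /(_ isT).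
Qed.

Lemma op_norm_lub T (k : R) : 0 <= k -> (forall x, rnorm (T x) <= k * rnorm x) ->
  op_norm T <= k.
Proof.
move=> k0 kT; apply: ge_sup; first by case: (nset_sup T).
move=> _ [x /= x1 <-]; rewrite (le_trans (kT x))// ler_piMr//.
by rewrite -lecR -rnormE.
Qed.

Lemma op_norm_eq0 T : op_norm T <= 0 -> T = 0.
Proof.
move=> T0; apply: bopP => x; apply/eqP; rewrite -rnorm_eq0.
apply/eqP/le_anti; rewrite rnorm_ge0 andbT (le_trans (op_normP T x))//.
by rewrite mulr_le0_ge0// rnorm_ge0.
Qed.

Lemma op_normD S T : op_norm (S + T) <= op_norm S + op_norm T.
Proof.
apply: op_norm_lub => [|x]; first by rewrite addr_ge0// op_norm_ge0.
by rewrite (le_trans (rnormD _ _))// mulrDl lerD// op_normP.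
Qed.

Lemma op_normM S T : op_norm (S * T) <= op_norm S * op_norm T.
Proof.
apply: op_norm_lub => [|x]; first by rewrite mulr_ge0// op_norm_ge0.
rewrite (le_trans (op_normP S (T x)))// -mulrA ler_wpM2l ?op_norm_ge0//.
exact: op_normP.
Qed.

Lemma op_normZ c T : op_norm (c *: T) = rnorm c * op_norm T.
Proof.
have le b S : op_norm (b *: S) <= rnorm b * op_norm S.
  apply: op_norm_lub => [|x]; first by rewrite mulr_ge0 ?rnorm_ge0 ?op_norm_ge0.
  by rewrite rnormZ -mulrA ler_wpM2l ?rnorm_ge0 ?op_normP.
apply/le_anti; rewrite le/=; have [->|c0] := eqVneq c 0.
  by rewrite rnorm0 mul0r op_norm_ge0.
have n0 : 0 < rnorm c by rewrite rnorm_gt0.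
have := le c^-1 (c *: T); rewrite scalerA mulVf// scale1r rnormV.
by rewrite -ler_pdivlMl ?invr_gt0// invrK.
Qed.

Lemma op_norm1 : op_norm (1 : bop H) = 1.
Proof.
apply/le_anti/andP; split; first by apply: op_norm_lub => // x; rewrite mul1r.
have [x x0] := @hilbert_neq0 R H.
have n0 : 0 < rnorm x by rewrite rnorm_gt0.
by have := op_normP 1 x; rewrite ler_pMl.
Qed.

Definition op_seminorm : @alg_seminorm R (bop H) :=
  AlgSeminorm op_normD op_normM op_normZ op_norm1.

Local Notation nu := op_seminorm.

Lemma op_normN T : op_norm (- T) = op_norm T.
Proof. exact: (snormN nu). Qed.

Lemma op_normX T n : op_norm (T ^+ n) <= op_norm T ^+ n.
Proof. exact: (snormX nu). Qed.

Lemma op_norm_sum I (s : seq I) (P : pred I) (F : I -> bop H) :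
  op_norm (\sum_(i <- s | P i) F i) <= \sum_(i <- s | P i) op_norm (F i).
Proof. exact: (snorm_sum nu). Qed.

(** Pointwise limits exist as [H] is complete, and the Cauchy condition passes
    to the limit uniformly on bounded sets. *)
Lemma op_complete (S : nat -> bop H) :
  (forall e : R, 0 < e -> exists n0, forall m n, (n0 <= m)%N -> (n0 <= n)%N ->
     op_norm (S m - S n) <= e) ->
  exists T, forall e : R, 0 < e -> exists n0, forall n, (n0 <= n)%N ->
     op_norm (S n - T) <= e.
Proof.
move=> cS.
have cx x : cvg (S n x @[n --> \oo]).
  apply/cauchy_cvgP/cauchy_ballP => e e0.
  have eE : e = (complex.Re e)%:C by rewrite RRe_real// gtr0_real.
  have e0' : 0 < complex.Re e by rewrite -ltcR -eE.
  have x1 : 0 < rnorm x + 1 by rewrite ltr_wpDl// rnorm_ge0.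
  have [|n0 hn0] := cS (complex.Re e / (2 * (rnorm x + 1))).
    by rewrite divr_gt0// mulr_gt0.
  near_simpl.
  exists ([set n | (n0 <= n)%N], [set n | (n0 <= n)%N]); first by split; exists n0.
  move=> [m n] [/= n0m n0n]; rewrite -ball_normE/= rnormE eE ltcR.
  rewrite (le_lt_trans (op_normP (S m - S n) x))//.
  rewrite (le_lt_trans (ler_wpM2r (rnorm_ge0 x) (hn0 _ _ n0m n0n)))//.
  rewrite mulrAC ltr_pdivrMr ?mulr_gt0// ltr_pM2l//.
  by have := rnorm_ge0 x; lra.
pose f x : H := lim (S n x @[n --> \oo]).
have fP x : S n x @[n --> \oo] --> f x by exact: cx.
have fS (e : R) : 0 < e -> exists n0, forall n, (n0 <= n)%N ->
    forall x, rnorm (S n x - f x) <= e * rnorm x.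
  move=> e0; have [n0 hn0] := cS e e0; exists n0 => n n0n x.
  apply/ler_addgt0Pr => b b0.
  have /cvg_rnorm/(_ _ b0)[n1 _ hn1] := fP x.
  pose m := maxn n0 n1.
  rewrite (le_trans (rnormBD (S m x) _ _))// lerD//.
    by rewrite (le_trans (op_normP (S n - S m) x))// ler_wpM2r ?rnorm_ge0// hn0// leq_maxl.
  by rewrite rnormB ltW// hn1//= leq_maxr.
have lf : linear f.
  move=> c x y; apply: (@cvg_unique _ (norm_hausdorff (V:=H)) _ _ _ _ (fP _)).
  have -> : (fun n => S n (c *: x + y)) = (fun n => c *: S n x + S n y).
    by apply/funext => n; rewrite bopD bopZ.
  by apply: cvgD; [apply: cvgZ; [exact: cvg_cst|exact: fP]|exact: fP].
have [n1 hn1] := fS 1 ltr01.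
have [|x|T TE] := @exists_bop f (op_norm (S n1) + 1) lf.
- by rewrite addr_ge0// op_norm_ge0.
- rewrite -[f x](subrK (S n1 x)) (le_trans (rnormD _ _))// addrC mulrDl lerD//.
    exact: op_normP.
  by rewrite rnormB hn1.
exists T => e e0; have [n0 hn0] := fS e e0; exists n0 => n n0n.
apply: op_norm_lub => [|x]; first exact: ltW.
have -> : (S n - T) x = S n x - f x by rewrite -TE.
exact: hn0.
Qed.

Lemma neumann U : op_norm (1 - U) < 1 ->
  exists V, U * V = 1 /\ V * U = 1.
Proof.
set u := 1 - U => u1.
have UE : U = 1 - u by rewrite /u opprB addrC subrK.
pose S n := \sum_(k < n) u ^+ k.
have US n : U * S n = 1 - u ^+ n.
  by rewrite UE -opprB mulNr -subrX1 opprB.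
have SU n : S n * U = 1 - u ^+ n.
  rewrite -US; have : GRing.comm (S n) u.
    by apply/commr_sym/commr_sum => k _; exact: commrX.
  by move=> Su; rewrite UE mulrBr mulrBl mulr1 mul1r Su.
have u0 := op_norm_ge0 u.
have q01 : 0 <= op_norm u < 1 by rewrite u0.
have d0 : 0 < 1 - op_norm u by rewrite subr_gt0.
have Sdiff m n : (n <= m)%N -> op_norm (S m - S n) <= op_norm u ^+ n * (1 - op_norm u)^-1.
  move=> nm; have -> : S m - S n = u ^+ n * S (m - n)%N.
    rewrite /S -(big_mkord xpredT (fun k => u ^+ k)) (big_cat_nat (n := n))//=.
    rewrite big_mkord addrAC subrr add0r -{1}[n]add0n big_addn big_mkord mulr_sumr.
    by apply: eq_bigr => k _; rewrite -exprD addnC.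
  rewrite (le_trans (op_normM _ _))// ler_pM ?op_norm_ge0//.
    exact: op_normX.
  rewrite (le_trans (op_norm_sum _ _ _))//.
  rewrite (@le_trans _ _ (\sum_(k < (m - n)%N) op_norm u ^+ k))//.
    by apply: ler_sum => k _; exact: op_normX.
  rewrite -[leRHS]mul1r ler_pdivlMr// mulrC -[1 - op_norm u]opprB mulNr -subrX1 opprB lerBlDr lerDl.
  exact: exprn_ge0.
have [e e0|V VP] := @op_complete S.
  have [n0 hn0] := geometric_small (1 - op_norm u)^-1 q01 e0.
  exists n0 => m n n0m n0n; have [nm|mn] := leqP n m.
    by rewrite (le_trans (Sdiff _ _ nm))// hn0.
  rewrite -op_normN opprB.
  by rewrite (le_trans (Sdiff _ _ (ltnW mn)))// hn0.
have small (e : R) : 0 < e -> exists n, op_norm (S n - V) <= e /\ op_norm (u ^+ n) <= e.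
  move=> e0; have [n0 h0] := VP e e0; have [n1 h1] := geometric_small 1 q01 e0.
  exists (maxn n0 n1); split; first by rewrite h0// leq_maxl.
  by rewrite (le_trans (op_normX _ _))// -[leLHS]mulr1 h1// leq_maxr.
have c0 : 0 < op_norm U + 1 by rewrite ltr_wpDl// op_norm_ge0.
have half (e : R) : 0 < e -> 0 < e / (op_norm U + 1) by move=> e0; rewrite divr_gt0.
have fin (e : R) : e / (op_norm U + 1) * (op_norm U + 1) = e by rewrite divfK// gt_eqF.
exists V; split; apply/eqP; rewrite -subr_eq0; apply/eqP/op_norm_eq0/ler_addgt0Pr => e e0;
  have [n [hV hu]] := small _ (half _ e0); rewrite add0r.
  have -> : U * V - 1 = - (U * (S n - V)) - u ^+ n by rewrite mulrBr US opprB -addrA -opprD subrK.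
  rewrite (le_trans (op_normD _ _))// !op_normN -[leRHS]fin [leRHS]mulrDr mulr1 lerD//.
  by rewrite (le_trans (op_normM _ _))// mulrC ler_wpM2r// op_norm_ge0.
have -> : V * U - 1 = - ((S n - V) * U) - u ^+ n by rewrite mulrBl SU opprB -addrA -opprD subrK.
rewrite (le_trans (op_normD _ _))// !op_normN -[leRHS]fin [leRHS]mulrDr mulr1 lerD//.
by rewrite (le_trans (op_normM _ _))// ler_wpM2r// op_norm_ge0.
Qed.

End OperatorNorm.

(** * Riesz representation and the adjoint *)

Section InnerProduct.
Context {R : realType} {H : nzHilbertType R}.
Implicit Types (S T U : bop H) (x y z : H) (c : R[i]).

Lemma hdotDl x y z : hdot (x + y) z = hdot x z + hdot y z.
Proof. exact: linearDl. Qed.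

Lemma hdotZl c x z : hdot (c *: x) z = c * hdot x z.
Proof. exact: linearZl_LR. Qed.

Lemma hdotC x y : hdot x y = Num.conj (hdot y x).
Proof. by rewrite [LHS]hermC expr0 mul1r. Qed.

Lemma hdotDr x y z : hdot z (x + y) = hdot z x + hdot z y.
Proof. exact: linearDr. Qed.

Lemma hdotZr c x z : hdot z (c *: x) = Num.conj c * hdot z x.
Proof. by rewrite hdotC hdotZl rmorphM/= -hdotC. Qed.

Lemma hdotNr x z : hdot z (- x) = - hdot z x.
Proof. exact: linearNr. Qed.

Lemma hdotxx x : hdot x x = (rnorm x ^+ 2)%:C.
Proof. by rewrite -normr_hdot rnormE rmorphXn. Qed.

Lemma rnorm_sqrE x : rnorm x ^+ 2 = complex.Re (hdot x x).
Proof. by rewrite hdotxx. Qed.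

Lemma rnormD_sqr x y :
  rnorm (x + y) ^+ 2 = rnorm x ^+ 2 + rnorm y ^+ 2 + 2 * complex.Re (hdot x y).
Proof.
rewrite !rnorm_sqrE hdotDl !hdotDr (hdotC y x).
case: (hdot x x) => a a'; case: (hdot y y) => b b'; case: (hdot x y) => u v /=; ring.
Qed.

Lemma parallelogram x y :
  rnorm (x + y) ^+ 2 + rnorm (x - y) ^+ 2 = 2 * rnorm x ^+ 2 + 2 * rnorm y ^+ 2.
Proof.
rewrite !rnormD_sqr rnormN hdotNr; case: (hdot x y) => a b /=; ring.
Qed.

Lemma hdot_eq0 x : (forall y, hdot y x = 0) -> x = 0.
Proof.
move=> /(_ x); rewrite hdotxx => /(congr1 (@complex.Re R))/= /eqP.
by rewrite expf_eq0/= rnorm_eq0 => /eqP.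
Qed.

Lemma cauchy_schwarz x y : rnorm (hdot x y) <= rnorm x * rnorm y.
Proof.
have [->|y0] := eqVneq y 0.
  by have := hdotZr 0 0 x; rewrite scale0r conjC0 mul0r => ->; rewrite !rnorm0 mulr0.
have n0 : 0 < rnorm y by rewrite rnorm_gt0.
set d := hdot x y.
pose t : R := (rnorm y ^+ 2)^-1.
have := sqr_ge0 (rnorm (x + (- (t%:C * d)) *: y)).
rewrite rnormD_sqr rnormZ rnormN rnormM rnorm_real hdotZr -/d.
have t0 : 0 < t by rewrite invr_gt0 exprn_gt0.
have -> : complex.Re (Num.conj (- (t%:C * d)) * d) = - (t * rnorm d ^+ 2).
  rewrite rnorm_sqr; case: (d) => a b /=; ring.
rewrite gtr0_norm// => h.
have ty : t * rnorm y ^+ 2 = 1 by rewrite mulVf// gt_eqF// exprn_gt0.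
have h2 : t * rnorm d ^+ 2 <= rnorm x ^+ 2.
  have e : (t * rnorm d * rnorm y) ^+ 2 = t * rnorm d ^+ 2.
    transitivity (t * rnorm d ^+ 2 * (t * rnorm y ^+ 2)); first by ring.
    by rewrite ty mulr1.
  by move: h; rewrite e; lra.
rewrite -(ler_pXn2r (n := 2)) ?nnegrE ?mulr_ge0 ?rnorm_ge0//.
rewrite exprMn -[leLHS]mul1r -ty.
have -> : t * rnorm y ^+ 2 * rnorm d ^+ 2 = (t * rnorm d ^+ 2) * rnorm y ^+ 2 by ring.
by rewrite ler_wpM2r// sqr_ge0.
Qed.

Lemma Re_hdot_le x y : complex.Re (hdot x y) <= rnorm x * rnorm y.
Proof.
by rewrite (le_trans (ler_norm _))// (le_trans (rnorm_Re _))// cauchy_schwarz.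
Qed.

(** The vector sought minimizes [|x|^2 - 2 Re (phi x)]. Minimizing sequences are
    Cauchy by the parallelogram identity, and the first variation at the minimum
    [y] in the direction [x] is the real part of [hdot x y - phi x]. *)
Lemma riesz (phi : H -> R[i]) (k : R) :
  (forall x y, phi (x + y) = phi x + phi y) ->
  (forall c x, phi (c *: x) = c * phi x) -> 0 <= k ->
  (forall x, rnorm (phi x) <= k * rnorm x) ->
  exists y, forall x, phi x = hdot x y.
Proof.
move=> phiD phiZ k0 phik.
have phiN x : phi (- x) = - phi x by rewrite -scaleN1r phiZ mulN1r.
pose Q x := rnorm x ^+ 2 - 2 * complex.Re (phi x).
have Re_phi x : `|complex.Re (phi x)| <= k * rnorm x.
  exact: le_trans (rnorm_Re _) (phik x).
have Qlb x : - k ^+ 2 <= Q x.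
  have := sqr_ge0 (rnorm x - k); have := Re_phi x; rewrite ler_norml /Q.
  by move=> /andP[_]; nra.
pose E := [set Q x | x in setT].
have iE : has_inf E.
  by split; [exists (Q 0), 0|exists (- k ^+ 2) => _ [x _ <-]; exact: Qlb].
have [m mE] : {m | m = inf E} by exists (inf E).
have mQ x : m <= Q x by rewrite mE; apply: ge_inf; [case: iE|exists x].
have QD x y : Q (x + y) = Q x + rnorm y ^+ 2 + 2 * complex.Re (hdot x y - phi y).
  rewrite /Q rnormD_sqr phiD; case: (phi x) (phi y) (hdot x y) => [? ?] [? ?] [? ?] /=; ring.
have near_min (e : R) : 0 < e -> exists x, Q x < m + e.
  by move=> e0; have [_ [x _ <-] xe] := inf_adherent e0 iE; exists x; rewrite mE.
have Qhalf x y : rnorm (x - y) ^+ 2 <= 2 * (Q x - m) + 2 * (Q y - m).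
  have := mQ (2^-1 *: (x + y)); have := parallelogram x y.
  have h2 : complex.Re (phi (2^-1 *: (x + y))) = (complex.Re (phi x) + complex.Re (phi y)) / 2.
    rewrite phiZ phiD -(rmorph_nat (real_complex R)) -fmorphV.
    by case: (phi x) (phi y) => [? ?] [? ?] /=; field.
  have n2 : rnorm (2^-1 *: (x + y)) = rnorm (x + y) / 2.
    by rewrite rnormZ rnormV rnorm_nat mulrC.
  by rewrite /Q h2 n2 expr_div_n; lra.
have {near_min} /choice[u uP] : forall n, exists x, Q x < m + n.+1%:R^-1.
  by move=> n; apply: near_min; rewrite invr_gt0 ltr0n.
have cu : cvg (u n @[n --> \oo]).
  apply/cauchy_cvgP/cauchy_ballP => e e0.
  have eE : e = (complex.Re e)%:C by rewrite RRe_real// gtr0_real.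
  have e0' : 0 < complex.Re e by rewrite -ltcR -eE.
  have [|n0 hn0] := @inv_succ_small R (complex.Re e ^+ 2 / 5); first by rewrite divr_gt0// exprn_gt0.
  near_simpl.
  exists ([set n | (n0 <= n)%N], [set n | (n0 <= n)%N]); first by split; exists n0.
  move=> [i j] [/= n0i n0j]; rewrite -ball_normE/= rnormE eE ltcR.
  rewrite -(ltr_pXn2r (n := 2)) ?nnegrE ?rnorm_ge0 ?(ltW e0')//.
  have := Qhalf (u i) (u j); have := uP i; have := uP j.
  have := hn0 i n0i; have := hn0 j n0j.
  have := exprn_gt0 2 e0'; move: (rnorm _ ^+ 2) (_ ^+ 2) (Q _) (Q _) (j.+1%:R^-1) (i.+1%:R^-1).
  by move=> *; lra.
have [y uy] : exists y, u n @[n --> \oo] --> y by exists (lim (u n @[n --> \oo])).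
have Qy : Q y <= m.
  apply/ler_addgt0Pr => e e0.
  have [b bE] : {b | b = 2 * rnorm y + 2 * k + 1} by exists (2 * rnorm y + 2 * k + 1).
  have b0 : 0 < b by have := rnorm_ge0 y; rewrite bE; lra.
  have [|n0 hn0] := @inv_succ_small R (e / 2); first by rewrite divr_gt0.
  have eb : 0 < e / (2 * b) by rewrite divr_gt0// mulr_gt0.
  have /cvg_rnorm/(_ _ eb)[n1 _ hn1] := uy.
  pose n := maxn n0 n1.
  have h1 := hn0 n (leq_maxl _ _); have h2 := hn1 n (leq_maxr _ _).
  have h3 := uP n.
  have : Q (u n) = Q (y + (u n - y)) by rewrite addrC subrK.
  rewrite QD => h4.
  have : - complex.Re (hdot y (u n - y) - phi (u n - y)) <=
      (rnorm y + k) * rnorm (u n - y).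
    have := Re_hdot_le y (- (u n - y)); have := Re_phi (u n - y).
    rewrite ler_norml => /andP[_]; rewrite hdotNr rnormN.
    case: (hdot y (u n - y)) (phi (u n - y)) => [? ?] [? ?] /=; lra.
  have d0 := rnorm_ge0 (u n - y).
  rewrite rnormB in h2; set d := rnorm (u n - y) in h2 h4 d0 * => h5.
  have : d * b <= e / 2.
    have -> : e / 2 = e / (2 * b) * b by field; lra.
    by rewrite ler_wpM2r// ltW.
  have := sqr_ge0 d; rewrite bE; move: h1 h3 h4 h5 d0.
  by move: (complex.Re _) (n.+1%:R^-1) (Q (u n)) (Q y) (rnorm y) => *; nra.
exists y => x; apply/eqP; rewrite eq_sym -subr_eq0; apply/eqP.
set psi := hdot x y - phi x.
(* The variation of the minimized function in the direction of
   [- s (psi)^* x]. *)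
have var (s : R) : 0 <= s ^+ 2 * (rnorm psi ^+ 2 * rnorm x ^+ 2) - 2 * s * rnorm psi ^+ 2.
  pose t : R[i] := - (s%:C * Num.conj psi).
  have := mQ (y + t *: x); rewrite QD rnormZ.
  have -> : rnorm t = `|s| * rnorm psi by rewrite rnormN rnormM rnormJ rnorm_real.
  rewrite phiZ hdotZr.
  have -> : complex.Re (Num.conj t * hdot y x - t * phi x) = - (s * rnorm psi ^+ 2).
    have -> : complex.Re (Num.conj t * hdot y x - t * phi x) =
        complex.Re (t * psi).
      rewrite (hdotC y x) /psi mulrBr.
      case: (t) (hdot x y) (phi x) => [? ?] [? ?] [? ?] /=; ring.
    by rewrite rnorm_sqr /t; case: (psi) => ? ? /=; ring.
  have := real_normK (num_real s); set v := `|s| => vs.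
  rewrite !exprMn vs; lra.
apply/eqP; rewrite -rnorm_eq0 -sqrf_eq0; apply/eqP.
have p0 := sqr_ge0 (rnorm psi); have x0 := sqr_ge0 (rnorm x).
set p := rnorm psi ^+ 2 in var p0 *; set r := rnorm x ^+ 2 in var x0.
have := var (r + 1)^-1.
have r1 : 0 < r + 1 by lra.
have -> : (r + 1)^-1 ^+ 2 * (p * r) - 2 * (r + 1)^-1 * p =
    - (p * ((r + 2) * (r + 1)^-1 ^+ 2)) by field; lra.
rewrite oppr_ge0 pmulr_lle0; last by rewrite mulr_gt0 ?exprn_gt0 ?invr_gt0//; lra.
by move=> ?; apply/le_anti; rewrite p0 andbT.
Qed.

(** By the Riesz representation the choice that defines [adjoint] succeeds. *)
Lemma adjointP T x y : hdot (T x) y = hdot x (adjoint T y).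
Proof.
suff [S SP] : exists S : bop H, forall x y, hdot (T x) y = hdot x (S y).
  by apply: (@xgetPex _ 0 [set S : bop H | forall x y, hdot (T x) y = hdot x (S y)]);
     exists S.
have /choice[f fP] : forall y, exists z, forall x, hdot (T x) y = hdot x z.
  move=> {}y; apply: (@riesz _ (op_norm T * rnorm y)).
  - by move=> u v; rewrite bopD hdotDl.
  - by move=> c u; rewrite bopZ hdotZl.
  - by rewrite mulr_ge0 ?op_norm_ge0 ?rnorm_ge0.
  - move=> u; rewrite (le_trans (cauchy_schwarz _ _))// mulrAC.
    by rewrite ler_wpM2r ?rnorm_ge0// op_normP.
have [|||S SE] := @exists_bop R H f (op_norm T).
- move=> c u v; apply/eqP; rewrite -subr_eq0; apply/eqP/hdot_eq0 => z.
  by rewrite !(hdotDr, hdotNr, hdotZr) -!fP !(hdotDr, hdotZr) subrr.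
- exact: op_norm_ge0.
- move=> u; have [->|fu0] := eqVneq (f u) 0.
    by rewrite rnorm0 mulr_ge0 ?op_norm_ge0 ?rnorm_ge0.
  have n0 : 0 < rnorm (f u) by rewrite rnorm_gt0.
  rewrite -(ler_pM2l n0) -expr2 rnorm_sqrE -fP (le_trans (Re_hdot_le _ _))//.
  by rewrite mulrA ler_wpM2r ?rnorm_ge0// mulrC op_normP.
by exists S => u v; rewrite SE.
Qed.

Lemma adjoint_unique T S : (forall x y, hdot (T x) y = hdot x (S y)) -> adjoint T = S.
Proof.
move=> TS; apply: bopP => y; apply/eqP; rewrite -subr_eq0; apply/eqP/hdot_eq0 => x.
by rewrite hdotDr hdotNr -adjointP TS subrr.
Qed.

Lemma adjointPr T x y : hdot (adjoint T x) y = hdot x (T y).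
Proof. by rewrite hdotC -adjointP -hdotC. Qed.

Lemma adjointK T : adjoint (adjoint T) = T.
Proof. by apply: adjoint_unique => x y; rewrite adjointPr. Qed.

Lemma adjointM S T : adjoint (S * T) = adjoint T * adjoint S.
Proof. by apply: adjoint_unique => x y; rewrite -!adjointP. Qed.

Lemma adjointD S T : adjoint (S + T) = adjoint S + adjoint T.
Proof. by apply: adjoint_unique => x y; rewrite hdotDl hdotDr -!adjointP. Qed.

Lemma adjointZ c T : adjoint (c *: T) = Num.conj c *: adjoint T.
Proof.
by apply: adjoint_unique => x y; rewrite hdotZl hdotZr conjCK -adjointP.
Qed.

Lemma adjoint1 : adjoint (1 : bop H) = 1.
Proof. by apply: adjoint_unique. Qed.

Lemma op_norm_adjoint T : op_norm (adjoint T) = op_norm T.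
Proof.
have le S : op_norm (adjoint S) <= op_norm S.
  apply: op_norm_lub => [|x]; first exact: op_norm_ge0.
  have [->|fx0] := eqVneq (adjoint S x) 0.
    by rewrite rnorm0 mulr_ge0 ?op_norm_ge0 ?rnorm_ge0.
  set y := adjoint S x in fx0 *.
  have n0 : 0 < rnorm y by rewrite rnorm_gt0.
  rewrite -(ler_pM2l n0) -expr2 rnorm_sqrE {2}/y -adjointP (le_trans (Re_hdot_le _ _))//.
  by rewrite mulrA ler_wpM2r ?rnorm_ge0// mulrC op_normP.
by apply/le_anti; rewrite le/= -{1}[T]adjointK le.
Qed.

Lemma rnorm_adjoint_sqr T x : rnorm (T x) ^+ 2 = complex.Re (hdot x ((adjoint T * T) x)).
Proof. by rewrite rnorm_sqrE adjointP. Qed.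

End InnerProduct.

(** * Fuglede's theorem *)

Lemma bernoulli_ge {R : realType} (t : R) m : 0 <= t <= 1 ->
  1 - m%:R * t <= (1 - t) ^+ m.
Proof.
move=> /andP[t0 t1]; elim: m => [|m ih]; first by rewrite mul0r subr0 expr0.
rewrite exprS (@le_trans _ _ ((1 - t) * (1 - m%:R * t)))//; last first.
  by rewrite ler_wpM2l// subr_ge0.
rewrite -natr1; have := ler0n R m; nra.
Qed.

(** This takes the place of the boundedness of [exp] on bounded sets. *)
Lemma half_power_bounds {R : realType} (t : R) m : 0 <= t -> (0 < m)%N ->
  m%:R * t = 2^-1 ->
  [/\ t < 1, 2^-1 <= (1 - t) ^+ m & (1 + t) ^+ (2 * m) <= 4].
Proof.
move=> t0 m0 mt; have m1 : (1 : R) <= m%:R by rewrite ler1n.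
have t1 : t <= 2^-1 by rewrite -mt ler_peMl.
have t2 : t < 1 by lra.
have h1 : 2^-1 <= (1 - t) ^+ m.
  have := @bernoulli_ge R t m; rewrite mt t0 (ltW t2) => /(_ isT); lra.
have h2 : (1 + t) ^+ m <= 2.
  have : ((1 + t) * (1 - t)) ^+ m <= 1.
    by rewrite exprn_ile1//; nra.
  rewrite exprMn; have : 0 <= (1 + t) ^+ m by rewrite exprn_ge0// addr_ge0.
  by move: h1; move: (_ ^+ m) (_ ^+ m) => v u; nra.
split=> //; rewrite mulnC exprM.
have : 0 <= (1 + t) ^+ m by rewrite exprn_ge0// addr_ge0.
by move: h2; move: (_ ^+ m) => u; nra.
Qed.

Section Fuglede.
Context {R : realType} {H : nzHilbertType R}.
Implicit Types (S T U X N : bop H) (x y z : H) (c : R[i]).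

Lemma comm_alg c X : GRing.comm (c%:A) X.
Proof. by rewrite /GRing.comm mulr_algl mulr_algr. Qed.

(** Cauchy's estimate. The mean over the [n]-th roots of unity times [r] is
    exact for polynomials of degree less than [n]. *)
Lemma cauchy_coef1 (p : {poly bop H}) n (r K : R) : (1 < n)%N -> (size p <= n)%N ->
  0 <= r -> (forall l : R[i], rnorm l = r -> op_norm p.[l%:A] <= K) ->
  r * op_norm p`_1 <= K.
Proof.
move=> n1 pn r0 pK; have n0 : (0 < n)%N by exact: ltnW.
have [w wn] := @prim_root_exists R n n0.
have w1 := rnorm_prim_root wn.
have nn0 : (n%:R : R[i]) != 0 by rewrite pnatr_eq0 -lt0n.
have key : \sum_(k < n) ((w ^+ k) ^+ n.-1) *: p.[(r%:C * w ^+ k)%:A] =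
    (n%:R * r%:C) *: p`_1.
  transitivity (\sum_(i < n)
      (r%:C ^+ i * \sum_(k < n) (w ^+ k) ^+ (n.-1 + i)) *: p`_i).
    under eq_bigr do rewrite (horner_coef_wide _ pn) scaler_sumr.
    rewrite exchange_big/=; apply: eq_bigr => i _.
    rewrite mulr_sumr scaler_suml; apply: eq_bigr => k _.
    rewrite scalar_algX mulr_algr scalerA exprMn exprD.
    by rewrite mulrCA.
  rewrite (bigD1 (Ordinal n1))//= [X in _ + X]big1 ?addr0.
    rewrite expr1 addn1 prednK// mulrC.
    under eq_bigr do rewrite exprAC (prim_expr_order wn) expr1n.
    by rewrite sumr_const card_ord.
  move=> i i1; suff -> : \sum_(k < n) (w ^+ k) ^+ (n.-1 + i) = 0.
    by rewrite mulr0 scale0r.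
  have [i0|i0] := posnP i.
    by rewrite i0 addn0 (sum_prim_root wn)// ltn_predL n0 andbT -ltnS prednK.
  have i2 : (1 < i)%N.
    by rewrite ltn_neqAle i0 andbT eq_sym; apply: contra i1 => /eqP i1; apply/eqP/val_inj.
  have -> : (n.-1 + i = n + i.-1)%N by rewrite -[in LHS](prednK i0) addnS -addSn prednK.
  under eq_bigr do rewrite exprD exprAC (prim_expr_order wn) expr1n mul1r.
  by rewrite (sum_prim_root wn)// (leq_ltn_trans (leq_pred _))// andbT -ltnS prednK.
have := congr1 (@op_norm R H) key; rewrite (op_normZ _ p`_1) rnormM rnorm_nat rnorm_real.
rewrite ger0_norm// => e.
have nr : (0 : R) < n%:R by rewrite ltr0n.
rewrite -(ler_pM2l nr) mulrA -e (le_trans (op_norm_sum _ _ _))//.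
rewrite mulr_natl -[X in _ *+ X]card_ord -sumr_const; apply: ler_sum => k _.
rewrite op_normZ !rnormX w1 !expr1n mul1r pK//.
by rewrite rnormM rnormX w1 expr1n mulr1 rnorm_real ger0_norm.
Qed.

Section TwistedConjugation.
Variables (N X : bop H) (c : R).
Hypotheses (nN : normal N) (NX : N * X = X * N).
Hypothesis Nc : op_norm N <= c.

Let c0 : 0 <= c. Proof. exact: le_trans (op_norm_ge0 N) Nc. Qed.

Let W (mu : R[i]) := (1 + mu *: adjoint N) * (1 - Num.conj mu *: N).

Let scaled_le (mu : R[i]) T : op_norm T <= c ->
  op_norm ((mu *: T) ^+ 2) <= (rnorm mu * c) ^+ 2.
Proof.
move=> Tc; rewrite (le_trans (op_normX _ _))// lerXn2r ?nnegrE ?op_norm_ge0//.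
  by rewrite mulr_ge0 ?rnorm_ge0.
by rewrite op_normZ ler_wpM2l ?rnorm_ge0.
Qed.

Let W_le mu : op_norm (W mu) <= 1 + (rnorm mu * c) ^+ 2.
Proof.
set t := (rnorm mu * c) ^+ 2.
have t0 : 0 <= t by exact: sqr_ge0.
have [A AE] : {A | A = mu *: adjoint N} by exists (mu *: adjoint N).
have [B BE] : {B | B = Num.conj mu *: N} by exists (Num.conj mu *: N).
have WE : W mu = (1 + A) * (1 - B) by rewrite /W AE BE.
have adA : adjoint A = B by rewrite AE BE adjointZ adjointK.
have adB : adjoint B = A by rewrite -adA adjointK.
have AB : A * B = B * A by rewrite AE BE -!(scalerAl, scalerAr) nN !scalerA mulrC.
have adW : adjoint (W mu) = (1 - A) * (1 + B).
  by rewrite WE adjointM -![- B]scaleN1r !adjointD adjointZ adjoint1 adA adB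
     rmorphN rmorph1 scaleN1r.
have WW : adjoint (W mu) * W mu = (1 - A ^+ 2) * (1 - B ^+ 2).
  rewrite adW WE -[_ * (1 + B) * _]mulrA [(1 + B) * _]mulrA.
  have -> : (1 + B) * (1 + A) = (1 + A) * (1 + B).
    by rewrite !mulrDl !mulrDr !mul1r !mulr1 AB addrACA.
  rewrite -[(1 + A) * _ * _]mulrA [(1 - A) * _]mulrA.
  congr (_ * _); rewrite !mulrDl !mulrDr !mul1r !mulr1 expr2 ?mulrN ?mulNr.
    by rewrite addrA addrK.
  by rewrite addrA subrK.
have le1 T : op_norm (T ^+ 2) <= t -> op_norm (1 - T ^+ 2) <= 1 + t.
  by move=> h; rewrite (le_trans (op_normD _ _))// op_norm1 op_normN lerD2l.
have hA : op_norm (A ^+ 2) <= t by rewrite AE scaled_le// op_norm_adjoint.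
have hB : op_norm (B ^+ 2) <= t.
  by rewrite BE (le_trans (scaled_le _ Nc))// rnormJ.
apply: op_norm_lub => [|x]; first by rewrite addr_ge0.
rewrite -(ler_pXn2r (n := 2)) ?nnegrE ?rnorm_ge0 ?mulr_ge0 ?addr_ge0 ?rnorm_ge0//.
rewrite rnorm_adjoint_sqr WW (le_trans (Re_hdot_le _ _))//.
rewrite exprMn [X in _ <= _ * X]expr2 mulrCA ler_wpM2l ?rnorm_ge0//.
rewrite (le_trans (op_normP _ _))// ler_wpM2r ?rnorm_ge0//.
by rewrite (le_trans (op_normM _ _))// expr2 ler_pM ?op_norm_ge0// le1.
Qed.

(** Write [A = mu N^*] and [B = A^*]. Then [W = (1 + A) (1 - B)] and
    [W' = (1 - A) (1 + B)] are unitary up to second order in [mu], because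
    [W^* W = (1 - A^2) (1 - B^2)]. Since [B] commutes with [X], the operator
    [W^m X W'^m] is [(1 + A)^m X (1 - A)^m] up to the factor [(1 - B^2)^m], which
    is bounded below. *)
Lemma twisted_conj_le (mu : R[i]) m : let t := (rnorm mu * c) ^+ 2 in t < 1 ->
  (1 - t) ^+ m *
    op_norm ((1 + mu *: adjoint N) ^+ m * X * (1 - mu *: adjoint N) ^+ m) <=
  (1 + t) ^+ (2 * m) * op_norm X.
Proof.
move=> t t1; set F := _ * X * _.
have t0 : 0 <= t by exact: sqr_ge0.
have [A AE] : {A | A = mu *: adjoint N} by exists (mu *: adjoint N).
have [B BE] : {B | B = Num.conj mu *: N} by exists (Num.conj mu *: N).
have AB : GRing.comm A B.
  by rewrite /GRing.comm AE BE -!(scalerAl, scalerAr) nN !scalerA mulrC.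
have XB : GRing.comm X B by rewrite /GRing.comm BE -scalerAl -scalerAr NX.
have FE : F = (1 + A) ^+ m * X * (1 - A) ^+ m by rewrite /F AE.
have c1 T U : GRing.comm T U -> GRing.comm (1 + T) U.
  by move=> TU; apply/commr_sym/commrD; [exact: commr1|exact: commr_sym].
have cN T U : GRing.comm T U -> GRing.comm T (- U) by exact: commrN.
have WWE : (1 - B ^+ 2) ^+ m * F = W mu ^+ m * X * W (- mu) ^+ m.
  have -> : W mu = (1 + A) * (1 - B) by rewrite AE BE.
  have -> : W (- mu) = (1 - A) * (1 + B) by rewrite AE BE /W rmorphN !scaleNr opprK.
  have cAB : GRing.comm (1 + A) (1 - B).
    by apply: (c1 _ _); apply: commrD; [exact: commr1|exact: cN].
  have cAB' : GRing.comm (1 - A) (1 + B).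
    apply: (c1 _ _); apply: commr_sym; apply: (cN _ _); apply: commr_sym.
    by apply: commrD; [exact: commr1|].
  rewrite !exprMn_comm//.
  have cXm : GRing.comm X ((1 - B) ^+ m).
    by apply/commrX/commrD; [exact: commr1|exact: cN].
  have cB1 T : GRing.comm T B -> GRing.comm T ((1 - B ^+ 2) ^+ m).
    by move=> TB; apply/commrX/commrD; [exact: commr1|apply: (cN _ _); exact: commrX].
  have BB : (1 - B) ^+ m * (1 + B) ^+ m = (1 - B ^+ 2) ^+ m.
    rewrite -exprMn_comm; last by apply: (c1 _ _); apply: commr_sym; apply: (cN _ _); exact: c1.
    by congr (_ ^+ _); rewrite mulrDl !mulrDr !mul1r !mulr1 expr2 mulNr addrA addrK.
  have cA : GRing.comm ((1 - B) ^+ m) ((1 - A) ^+ m).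
    apply: commrX; apply: commr_sym; apply: commrX.
    apply: (c1 _ _); apply: commr_sym; apply: (cN _ _).
    by apply: (c1 _ _); apply: commr_sym; exact: (cN _ _).
  have VP := cB1 _ (commr_sym (commrX m (commr_sym (c1 _ _ AB)))).
  have VX := cB1 _ XB.
  have VQ : GRing.comm ((1 - A) ^+ m) ((1 - B ^+ 2) ^+ m).
    apply: cB1; apply: commr_sym; apply: commrX; apply: commr_sym.
    by apply: (c1 _ _); apply: commr_sym; apply: (cN _ _); exact: commr_sym.
  rewrite FE !mulrA -VP -[_ * _ * X]mulrA -VX [_ * (X * _)]mulrA.
  rewrite -[_ * (1 - B ^+ 2) ^+ m * _]mulrA -VQ -BB [(1 - A) ^+ m * (_ * _)]mulrA -cA.
  rewrite -[in RHS](mulrA ((1 + A) ^+ m) _ X) -cXm.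
  by rewrite !mulrA.
have hB : op_norm (B ^+ 2) <= t.
  by rewrite BE (le_trans (scaled_le _ Nc))// rnormJ.
have t10 : 0 <= 1 - t by rewrite subr_ge0 ltW.
have low k x : (1 - t) ^+ k * rnorm x <= rnorm (((1 - B ^+ 2) ^+ k) x).
  elim: k => [|k ih]; first by rewrite !expr0 mul1r.
  rewrite exprS -mulrA; set y := ((1 - B ^+ 2) ^+ k) x in ih *.
  have -> : ((1 - B ^+ 2) ^+ k.+1) x = y - (B ^+ 2) y by rewrite exprS.
  apply: (@le_trans _ _ ((1 - t) * rnorm y)); first by rewrite ler_wpM2l.
  rewrite mulrBl mul1r lerBlDr.
  have := rnormD (y - (B ^+ 2) y) ((B ^+ 2) y); rewrite subrK => /le_trans; apply.
  by rewrite lerD2l (le_trans (op_normP _ _))// ler_wpM2r ?rnorm_ge0.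
have up : op_norm ((1 - B ^+ 2) ^+ m * F) <= (1 + t) ^+ (2 * m) * op_norm X.
  rewrite WWE (le_trans (op_normM _ _))// mulnC exprM expr2.
  have -> : forall u v : R, u * u * v = u * v * u by move=> u v; ring.
  have ge (u : R[i]) : op_norm (W u ^+ m) <= (1 + (rnorm u * c) ^+ 2) ^+ m.
    rewrite (le_trans (op_normX _ _))// lerXn2r ?nnegrE ?op_norm_ge0//.
    by rewrite addr_ge0// sqr_ge0.
  rewrite ler_pM ?op_norm_ge0//; last by rewrite (le_trans (ge _))// rnormN.
  by rewrite (le_trans (op_normM _ _))// ler_wpM2r ?op_norm_ge0// ge.
have [->|t1'] := eqVneq ((1 - t) ^+ m) 0.
  by rewrite mul0r mulr_ge0 ?op_norm_ge0 ?exprn_ge0// addr_ge0.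
have p0 : 0 < (1 - t) ^+ m by rewrite lt_neqAle eq_sym t1' exprn_ge0.
rewrite mulrC -ler_pdivlMr//; apply: op_norm_lub => [|x].
  by rewrite divr_ge0 ?exprn_ge0// mulr_ge0 ?op_norm_ge0// exprn_ge0// addr_ge0.
rewrite mulrAC ler_pdivlMr// mulrC (le_trans (low m (F x)))//.
by rewrite (le_trans (op_normP ((1 - B ^+ 2) ^+ m * F) x))// ler_wpM2r// rnorm_ge0.
Qed.

End TwistedConjugation.

(** Rosenblum's proof, in which the entire function
    [exp (l N') X exp (- l N')], where [N'] is the adjoint of [N], is bounded and
    hence constant, with the polynomial [(1 + l N' / m)^m X (1 - l N' / m)^m] in
    the role of this function. Its coefficient of degree 1 is [N' X - X N']. When [m] is of the
    order of [r^2] it is bounded by [8 |X|] on the circle of radius [r], so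
    Cauchy's estimate bounds the coefficient by [8 |X| / r], for every [r]. *)
Theorem fuglede N X : normal N -> N * X = X * N -> adjoint N * X = X * adjoint N.
Proof.
move=> nN NX; apply/eqP; rewrite -subr_eq0; apply/eqP/op_norm_eq0.
set D := _ - _.
pose c := (Num.truncn (op_norm N)).+1.
have Nc : op_norm N <= c%:R by rewrite ltW// truncnS_gt.
suff key r : (0 < r)%N -> r%:R * op_norm D <= 8 * op_norm X.
  rewrite leNgt; apply/negP => D0.
  pose r := (Num.truncn (8 * op_norm X / op_norm D)).+1.
  have := key r isT; rewrite -ler_pdivlMr// leNgt truncnS_gt//.
move=> r0.
(* so that [m t = 1/2] for [t = (r c / m)^2] *)
pose m := (2 * (r * c) ^ 2)%N.
have rc : (0 < r * c)%N by rewrite muln_gt0 r0.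
have m0 : (0 < m)%N by rewrite muln_gt0/= expn_gt0 rc.
have mR : (0 : R) < m%:R by rewrite ltr0n.
pose M := (m%:R^-1 : R[i]) *: adjoint N.
pose p : {poly bop H} := (1 + M%:P * 'X) ^+ m * X%:P * (1 - M%:P * 'X) ^+ m.
have evalE l : p.[l%:A] = (1 + (l / m%:R) *: adjoint N) ^+ m * X *
    (1 - (l / m%:R) *: adjoint N) ^+ m.
  have cl q : comm_poly q (l%:A : bop H) by exact: comm_alg.
  rewrite hornerM_comm// hornerM_comm// hornerC !horner_exp_comm//.
  by rewrite !(hornerD, hornerN, hornerMX, hornerC) mulr_algr /M scalerA.
have sz1 (e : bop H) : (size (1 + e%:P * 'X)%R <= 2)%N.
  rewrite (leq_trans (size_polyD _ _))// geq_max size_poly1/=.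
  rewrite (leq_trans (size_polyMleq _ _))// size_polyX addn2/= ltnS.
  exact: size_polyC_leq1.
have szX (q : {poly bop H}) k : (size q <= 2)%N -> (size (q ^+ k)%R <= k.+1)%N.
  move=> q2; rewrite (leq_trans (size_poly_exp_leq _ _))// ltnS.
  by rewrite -[leqRHS]mul1n leq_mul2r; apply/orP; right; rewrite -subn1 leq_subLR.
have sz : (size p <= (2 * m).+1)%N.
  have h1 := szX _ m (sz1 M); have h2 := szX _ m (sz1 (- M)).
  rewrite polyCN mulNr in h2.
  rewrite /p (leq_trans (size_polyMleq _ _))//.
  have h3 : (size ((1 + M%:P * 'X) ^+ m * X%:P)%R <= m.+1)%N.
    rewrite (leq_trans (size_polyMleq _ _))//.
    rewrite (leq_trans (n := (m.+1 + 1).-1))//; last by rewrite addn1.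
    by rewrite -!subn1 leq_sub2r// leq_add// size_polyC_leq1.
  rewrite (leq_trans (n := (m.+1 + m.+1).-1))//; last by rewrite addSn addnS mul2n addnn.
  by rewrite -!subn1 leq_sub2r// leq_add.
have coef0 (e : bop H) k : ((1 + e%:P * 'X) ^+ k)`_0 = 1.
  by elim: k => [|k ih]; rewrite ?expr0 ?coef1// exprS coefM big_ord1 ih coefD coef1 coefMX/= addr0 mulr1.
have coef1' (e : bop H) k : ((1 + e%:P * 'X) ^+ k)`_1 = k%:R *: e.
  elim: k => [|k ih]; first by rewrite expr0 coef1 scale0r.
  rewrite exprS coefM !big_ord_recl big_ord0/= ih coef0 !coefD !coef1 !coefMX/= coefC/=.
  by rewrite !addr0 add0r mul1r mulr1 -natr1 scalerDl scale1r.
have p1 : p`_1 = D.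
  have M0 := coef0 (- M) m; have M1 := coef1' (- M) m.
  rewrite polyCN mulNr in M0 M1.
  rewrite /p coefM !big_ord_recl big_ord0/= M0 M1 !coefMC coef0 coef1'.
  rewrite mul1r mulr1 addr0 addrC /M scalerN !scalerA mulfV ?pnatr_eq0 -?lt0n//.
  by rewrite !scale1r mulrN.
rewrite -p1; apply: (@cauchy_coef1 p (2 * m).+1) => //.
  by rewrite ltnS muln_gt0.
move=> l lr; rewrite evalE.
set mu := l / m%:R.
have muE : rnorm mu = r%:R / m%:R by rewrite rnormM rnormV rnorm_nat lr.
pose t : R := (rnorm mu * c%:R) ^+ 2.
have mt : m%:R * t = 2^-1.
  rewrite /t muE mulrAC -natrM expr_div_n -!natrX.
  have -> : ((r * c) ^ 2)%:R = m%:R / 2 :> R by rewrite /m natrM mulrC mulKf ?pnatr_eq0.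
  by rewrite natrX; field; rewrite ?gt_eqF.
have t0 : 0 <= t by exact: sqr_ge0.
have [t1 h1 h3] := half_power_bounds t0 m0 mt.
have h := twisted_conj_le nN NX Nc m t1; rewrite -/t in h.
set F := op_norm _ in h *.
have h4 : 2^-1 * F <= 4 * op_norm X.
  rewrite (@le_trans _ _ ((1 - t) ^+ m * F))//; first by rewrite ler_wpM2r// op_norm_ge0.
  by rewrite (le_trans h)// ler_wpM2r// op_norm_ge0.
by clear -h4; move: F (op_norm X) h4 => *; lra.
Qed.

End Fuglede.

(** * The bicommutant and its characters *)

(** The bicommutant is preferred to a closed subalgebra because it contains the
    inverses of its elements, and, by Fuglede's theorem, the adjoints of its
    normal elements. *)
Definition bicommutant (R : realType) (H : nzHilbertType R) (A : bop H) :
    {pred bop H} :=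
  fun T => `[< forall X, A * X = X * A -> T * X = X * T >].

Section BicommutantClosed.
Context {R : realType} {H : nzHilbertType R}.
Variable A : bop H.

Fact bicommutant_subalg : subalg_closed (bicommutant A).
Proof.
split.
- by apply/asboolP => X _; rewrite mul1r mulr1.
- move=> c S T /asboolP hS /asboolP hT; apply/asboolP => X AX.
  by rewrite mulrDl mulrDr -scalerAl hS// hT// scalerAr.
- move=> S T /asboolP hS /asboolP hT; apply/asboolP => X AX.
  by rewrite -mulrA hT// mulrA hS// mulrA.
Qed.

HB.instance Definition _ := GRing.isSubalgClosed.Build R[i] (bop H)
  (bicommutant A) bicommutant_subalg.

End BicommutantClosed.

Record bic (R : realType) (H : nzHilbertType R) (A : bop H) : Type :=
  Bic { bic_op :> bop H ; bic_subproof : bic_op \in bicommutant A }.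

HB.instance Definition _ (R : realType) (H : nzHilbertType R) (A : bop H) :=
  [isSub of bic A for @bic_op R H A].
HB.instance Definition _ (R : realType) (H : nzHilbertType R) (A : bop H) :=
  [Choice of bic A by <:].
HB.instance Definition _ (R : realType) (H : nzHilbertType R) (A : bop H) :=
  [SubChoice_isSubAlgebra of bic A by <:].

Fact bic_mulC (R : realType) (H : nzHilbertType R) (A : bop H) :
  commutative (@GRing.mul (bic A)).
Proof.
move=> S T; apply: val_inj; rewrite !rmorphM/=.
have /asboolP hS := bic_subproof S; have /asboolP hT := bic_subproof T.
by apply: hS; rewrite hT.
Qed.
HB.instance Definition _ (R : realType) (H : nzHilbertType R) (A : bop H) :=
  GRing.PzRing_hasCommutativeMul.Build (bic A) (@bic_mulC R H A).

Section Invertibility.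
Context {R : realType} {H : nzHilbertType R}.
Implicit Types (S T U X N A : bop H).

Definition op_invertible T := exists V, T * V = 1 /\ V * T = 1.

Lemma op_spectrumP T z : op_spectrum T z <-> ~ op_invertible (z%:A - T).
Proof. by []. Qed.

Lemma bicommutantP A T : T \in bicommutant A <->
  forall X, A * X = X * A -> T * X = X * T.
Proof. by split=> [/asboolP//|h]; apply/asboolP. Qed.

Lemma bicommutant_self A : A \in bicommutant A.
Proof. exact/bicommutantP. Qed.

Lemma bicommutant_inv A T V : T \in bicommutant A -> T * V = 1 -> V * T = 1 ->
  V \in bicommutant A.
Proof.
move=> /bicommutantP hT TV VT; apply/bicommutantP => X AX.
by rewrite -[LHS]mulr1 -TV mulrA -[V * X * T]mulrA -hT// mulrA VT mul1r.
Qed.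

Lemma bicommutant_adjoint A N : normal N -> N \in bicommutant A ->
  adjoint N \in bicommutant A.
Proof.
by move=> nN /bicommutantP hN; apply/bicommutantP => X AX; apply: fuglede => //; exact: hN.
Qed.

Lemma bicommutant_comm A S T : S \in bicommutant A -> T \in bicommutant A ->
  S * T = T * S.
Proof. by move=> Sb Tb; have /(congr1 val) := mulrC (Bic Sb) (Bic Tb). Qed.

Section Characters.
Variable A : bop H.

Let nu (x : bic A) : R := op_norm x.

Let nuD x y : nu (x + y) <= nu x + nu y. Proof. exact: op_normD. Qed.
Let nuM x y : nu (x * y) <= nu x * nu y. Proof. exact: op_normM. Qed.
Let nuZ c x : nu (c *: x) = rnorm c * nu x. Proof. exact: op_normZ. Qed.
Let nu1 : nu 1 = 1. Proof. exact: op_norm1. Qed.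

Definition bic_seminorm : @alg_seminorm R (bic A) := AlgSeminorm nuD nuM nuZ nu1.

Definition bic_character (h : bic A -> R[i]) :=
  is_character h /\ forall x, rnorm (h x) <= op_norm x.

Lemma exists_bic_character (x : bic A) : ~ op_invertible x ->
  exists2 h, bic_character h & h x = 0.
Proof.
move=> nx.
have [u u1|y xy|h [hh hx hle]] := @exists_character R (bic A) bic_seminorm x.
- have [V [uV Vu]] := @neumann R H (bic_op u) u1.
  exists (Bic (bicommutant_inv (bic_subproof u) uV Vu)).
  exact/val_inj.
- apply: nx; exists (bic_op y); split; first by have /(congr1 val) := xy.
  by move: xy; rewrite mulrC => /(congr1 val).
- by exists h.
Qed.

Lemma bic_character_not_invertible h (x : bic A) : is_character h -> h x = 0 ->
  ~ op_invertible x.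
Proof.
move=> hh hx [V [xV Vx]].
have := @char_neq_unit _ _ h hh x (Bic (bicommutant_inv (bic_subproof x) xV Vx)) hx.
by apply; exact: val_inj.
Qed.

Lemma bic_character_spectrum h (x : bic A) : is_character h -> op_spectrum x (h x).
Proof.
move=> hh; apply/op_spectrumP.
have := @bic_character_not_invertible h ((h x)%:A - x) hh; apply.
by rewrite (charB hh) (charZ hh) (char1 hh) mulr1 subrr.
Qed.

(** Spectra in the bicommutant are spectra in the algebra of all operators,
    since inverses of elements of the bicommutant belong to it. *)
Lemma bic_spectrumP (x : bic A) w :
  op_spectrum x w <-> exists2 h, bic_character h & h x = w.
Proof.
split=> [/op_spectrumP nw|[h [hh _] <-]]; last exact: bic_character_spectrum.
have [h hb hw] := @exists_bic_character (w%:A - x) nw; have [hh _] := hb.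
exists h => //; apply/esym/eqP; rewrite -subr_eq0 -hw.
by rewrite (charB hh) (charZ hh) (char1 hh) mulr1.
Qed.

(** [(S x, x)] is real, so the cross term of [|S x + i t x|^2] vanishes. *)
Lemma selfadjoint_add_scalar S (t : R) : adjoint S = S ->
  op_norm (S + (0 +i* t)%:A) ^+ 2 <= op_norm S ^+ 2 + t ^+ 2.
Proof.
move=> aS; set c := 0 +i* t.
have c2 : rnorm c ^+ 2 = t ^+ 2 by rewrite rnorm_sqr/= expr0n add0r.
have s0 : 0 <= op_norm S ^+ 2 + t ^+ 2 by rewrite addr_ge0 ?sqr_ge0.
rewrite -[leRHS]sqr_sqrtr// lerXn2r ?nnegrE ?op_norm_ge0 ?sqrtr_ge0//.
apply: op_norm_lub => [|x]; first exact: sqrtr_ge0.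
rewrite -(ler_pXn2r (n := 2)) ?nnegrE ?rnorm_ge0 ?mulr_ge0 ?rnorm_ge0 ?sqrtr_ge0//.
rewrite exprMn sqr_sqrtr//.
have -> : (S + c%:A) x = S x + c *: x by [].
rewrite rnormD_sqr hdotZr rnormZ exprMn c2.
have -> : complex.Re (Num.conj c * hdot (S x) x) = 0.
  have : hdot (S x) x = Num.conj (hdot (S x) x).
    by rewrite {1}adjointP aS -hdotC.
  by case: (hdot (S x) x) => a b /= [] /eqP; rewrite -addr_eq0 -mulr2n mulrn_eq0/= => /eqP ->; ring.
rewrite mulr0 [leLHS]addr0 [leRHS]mulrDl lerD2r -exprMn lerXn2r ?nnegrE ?rnorm_ge0 ?mulr_ge0 ?op_norm_ge0 ?rnorm_ge0//.
exact: op_normP.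
Qed.

(** Arens' argument: with [b] the imaginary part,
    [(b + t)^2 <= |h (x + i t)|^2 <= |x|^2 + t^2] for all real [t]. *)
Lemma character_selfadjoint h (x : bic A) : bic_character h -> adjoint x = x ->
  complex.Im (h x) = 0.
Proof.
move=> [hh hle] ax; apply/eqP/contraT => b0.
set a := complex.Re (h x); set b := complex.Im (h x) in b0.
have key (t : R) : (b + t) ^+ 2 <= op_norm x ^+ 2 + t ^+ 2.
  rewrite (le_trans _ (selfadjoint_add_scalar t ax))//.
  have := hle (x + (0 +i* t)%:A); rewrite (charD hh) (charZ hh) (char1 hh) mulr1.
  move=> h1; rewrite (@le_trans _ _ (rnorm (h x + 0 +i* t) ^+ 2))//.
    rewrite rnorm_sqr /b; case: (h x) => ? ? /=; rewrite addr0 lerDr; exact: sqr_ge0.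
  by rewrite lerXn2r ?nnegrE ?rnorm_ge0 ?op_norm_ge0.
have := key (op_norm x ^+ 2 / b).
rewrite sqrrD lerD2r.
have -> : b * (op_norm x ^+ 2 / b) = op_norm x ^+ 2 by field.
have := sqr_ge0 (op_norm x); have : 0 < b ^+ 2 by rewrite exprn_even_gt0.
by clear ax => *; exfalso; lra.
Qed.

Lemma character_adjoint h (x y : bic A) : bic_character h -> bic_op y = adjoint x ->
  h y = Num.conj (h x).
Proof.
move=> hb yx; have [hh _] := hb.
have xy : bic_op x = adjoint y by rewrite yx adjointK.
have h1 : complex.Im (h (x + y)) = 0.
  apply: character_selfadjoint => //.
  by rewrite [in LHS]/= adjointD -yx -xy addrC.
have h2 : complex.Im (h ('i%C *: (x - y))) = 0.
  apply: character_selfadjoint => //.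
  rewrite [in LHS]/= adjointZ -[- bic_op y]scaleN1r adjointD adjointZ -yx -xy.
  have ci : Num.conj ('i%C : R[i]) = - 'i%C by apply/eqP; rewrite eq_complex/= oppr0 !eqxx.
  by rewrite rmorphN rmorph1 scaleN1r ci scaleNr -scalerN opprB.
move: h1 h2; rewrite (charZ hh) (charB hh) (charD hh) conjcE.
case: (h x) (h y) => [a b] [c d] /=.
rewrite !mul0r !mul1r add0r => h1 h2; congr (_ +i* _).
  by apply/eqP; rewrite eq_sym -subr_eq0 h2.
by apply/eqP; rewrite -subr_eq0 opprK addrC h1.
Qed.

(** [k = |x|^2] is in the spectrum of [x^* x]: if [V] inverted [k - x^* x], then
    all [u] would satisfy [|x u|^2 <= (k - (C + 1)^-1) |u|^2] with
    [C = k |V|^2], which makes the norm of [x] too small. *)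
Lemma norm_attaining_character (x y : bic A) : bic_op y = adjoint x ->
  exists2 h, bic_character h & rnorm (h x) = op_norm x.
Proof.
move=> yx.
pose k := op_norm x ^+ 2.
have k0 : 0 <= k by exact: sqr_ge0.
have [|h hb hT] := @exists_bic_character (k%:C%:A - y * x).
  move=> [V [_]]; rewrite /= yx => VT.
  have [x0|x0] := eqVneq k 0.
    have xz : bic_op x = 0.
      by apply: op_norm_eq0; move/eqP: x0; rewrite sqrf_eq0 => /eqP ->.
    have /eqP := VT; rewrite x0 xz mulr0 subr0 scale0r mulr0.
    by rewrite eq_sym oner_eq0.
  have kp : 0 < k by rewrite lt_neqAle eq_sym x0.
  pose C := k * op_norm V ^+ 2.
  have C0 : 0 <= C by rewrite mulr_ge0// sqr_ge0.
  have sqr_op_norm (T : bop H) u : rnorm (T u) ^+ 2 <= op_norm T ^+ 2 * rnorm u ^+ 2.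
    rewrite -exprMn lerXn2r ?nnegrE ?mulr_ge0 ?op_norm_ge0 ?rnorm_ge0//.
    exact: op_normP.
  pose s := Num.max 0 (k - (C + 1)^-1).
  have key u : rnorm (x u) ^+ 2 <= s * rnorm u ^+ 2.
    pose v := k%:C *: u - adjoint x (x u).
    have uV : u = V v.
      have := congr1 (fun T : bop H => T u) VT; rewrite /= => eu.
      by rewrite -[LHS]eu.
    have nv : rnorm v ^+ 2 <= k * (k * rnorm u ^+ 2 - rnorm (x u) ^+ 2).
      rewrite /v rnormD_sqr rnormN rnormZ rnorm_real ger0_norm// hdotNr hdotZl.
      rewrite -adjointP hdotxx.
      have -> : complex.Re (- (k%:C * (rnorm (x u) ^+ 2)%:C)) = - (k * rnorm (x u) ^+ 2).
        by rewrite -rmorphM -rmorphN.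
      have : rnorm (adjoint x (x u)) ^+ 2 <= k * rnorm (x u) ^+ 2.
        by rewrite (le_trans (sqr_op_norm _ _))// op_norm_adjoint.
      rewrite exprMn; lra.
    have nV : rnorm u ^+ 2 <= C * (k * rnorm u ^+ 2 - rnorm (x u) ^+ 2).
      rewrite {1}uV (le_trans (sqr_op_norm _ _))// /C.
      have := ler_wpM2l (sqr_ge0 (op_norm V)) nv.
      by rewrite (mulrA (op_norm V ^+ 2) k) (mulrC _ k).
    have nx := sqr_op_norm x u; rewrite -/k in nx.
    have C1 : 0 < C + 1 by rewrite ltr_wpDl.
    rewrite (@le_trans _ _ ((k - (C + 1)^-1) * rnorm u ^+ 2))//.
      rewrite -(ler_pM2l C1) [leRHS]mulrA (mulrBr (C + 1)) mulfV ?gt_eqF//.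
      by move: nV nx; move: (rnorm u ^+ 2) (rnorm _ ^+ 2) => p q; nra.
    by rewrite ler_wpM2r ?sqr_ge0// /s le_max lexx orbT.
  have s0 : 0 <= s by rewrite le_max lexx.
  have : k <= s.
    rewrite -[leRHS](sqr_sqrtr s0) /k lerXn2r ?nnegrE ?op_norm_ge0 ?sqrtr_ge0//.
    apply: op_norm_lub => [|u]; first exact: sqrtr_ge0.
    rewrite -(ler_pXn2r (n := 2)) ?nnegrE ?rnorm_ge0 ?mulr_ge0 ?rnorm_ge0 ?sqrtr_ge0//.
    by rewrite exprMn sqr_sqrtr.
  rewrite leNgt /s => /negP; apply; rewrite gt_max kp/= ltrBlDr ltrDl.
  by rewrite invr_gt0 ltr_wpDl.
have [hh _] := hb.
exists h => //; move: hT; rewrite (charB hh) (charZ hh) (char1 hh) mulr1 (charM hh).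
rewrite (character_adjoint hb yx) mulrC rnormC -rmorphB => /(congr1 (@complex.Re R))/= /eqP.
by rewrite subr_eq0 eqrXn2 ?rnorm_ge0 ?op_norm_ge0// => /eqP ->.
Qed.

End Characters.
End Invertibility.

(** * Polynomials in a complex variable and its conjugate *)

Section Weierstrass.
Context {R : realType}.
Implicit Types (K : set R[i]) (g : R[i] -> R[i]) (w z : R[i]).
Implicit Types q : {poly {poly R[i]}}.

Definition eval_conj q w : R[i] := q.[(Num.conj w)%:P].[w].

Lemma eval_conjB q1 q2 w : eval_conj (q1 - q2) w = eval_conj q1 w - eval_conj q2 w.
Proof. by rewrite /eval_conj !hornerD !hornerN. Qed.
Lemma eval_conjM q1 q2 w : eval_conj (q1 * q2) w = eval_conj q1 w * eval_conj q2 w.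
Proof. by rewrite /eval_conj !hornerM. Qed.
Lemma eval_conj1 w : eval_conj 1 w = 1.
Proof. by rewrite /eval_conj !hornerC. Qed.
Lemma eval_conjC c w : eval_conj c%:P%:P w = c.
Proof. by rewrite /eval_conj !hornerC. Qed.
Lemma eval_conj_sum I (s : seq I) (P : pred I) (F : I -> {poly {poly R[i]}}) w :
  eval_conj (\sum_(i <- s | P i) F i) w = \sum_(i <- s | P i) eval_conj (F i) w.
Proof. by rewrite /eval_conj !horner_sum. Qed.
Lemma eval_conjX q n w : eval_conj (q ^+ n) w = eval_conj q w ^+ n.
Proof. by rewrite /eval_conj !horner_exp. Qed.

Lemma compact_net K (e : R) : compact K -> 0 < e ->
  exists s : seq R[i], (forall z, z \in s -> K z) /\
    forall w, K w -> exists2 z, z \in s & rnorm (w - z) < e.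
Proof.
rewrite compact_cover => cK e0.
have [|w Kw|D DK Dcov] := cK R[i] K (fun z => [set w | rnorm (w - z) < e]).
- move=> z Kz; rewrite openE => w /= wz; apply/nbhs_rnorm.
  exists (e - rnorm (w - z)); first by rewrite subr_gt0.
  move=> v wv /=; rewrite (le_lt_trans (rnormBD w _ _))//.
  by rewrite rnormB; lra.
- by exists w => //=; rewrite subrr rnorm0.
exists (enum_fset D); split=> [z zD|w Kw]; first by have := DK z zD; rewrite inE.
by have [z zD wz] := Dcov w Kw; exists z.
Qed.

Lemma heine K g (e : R) : compact K -> {within K, continuous g} -> 0 < e ->
  exists2 d : R, 0 < d & forall w z, K w -> K z -> rnorm (w - z) < d ->
    rnorm (g w - g z) <= e.
Proof.
move=> /compact_near_coveringP cK /subspace_continuousP cg e0.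
pose P (d : R) w := K w -> forall z, K z -> rnorm (w - z) < d -> rnorm (g w - g z) <= e.
have := cK R (0^'+) P _ _.
case=> [w Kw|d /= d0 h].
  have e2 : 0 < e / 2 by rewrite divr_gt0.
  have /cvg_rnorm/(_ _ e2)/nbhs_rnorm[d d0 hd] := cg w Kw.
  have d2 : 0 < d / 2 by rewrite divr_gt0.
  exists ([set z | rnorm (w - z) < d / 2], [set r | r < d / 2]).
    by split; [apply/nbhs_rnorm; exists (d / 2)|exact: nbhs_right_lt].
  move=> [z r] /= [wz rd] Kz u Ku zu.
  have wu : rnorm (w - u) < d by rewrite (le_lt_trans (rnormBD z _ _))//; lra.
  have wz' : rnorm (w - z) < d by lra.
  have := hd _ wu Ku; have := hd _ wz' Kz => h1 h2.
  rewrite (le_trans (rnormBD (g w) _ _))// rnormB; lra.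
by exists (d / 2); [rewrite divr_gt0|move=> w z Kw; apply: h => //; rewrite /= ?sub0r ?normrN ?gtr0_norm ?divr_gt0//; lra].
Qed.

Lemma within_compact_bounded K g : compact K -> {within K, continuous g} ->
  exists2 c : R, 0 <= c & forall w, K w -> rnorm (g w) <= c.
Proof.
move=> cK cg; have [d d0 hd] := heine cK cg ltr01.
have [s [sK sP]] := compact_net cK d0.
exists (1 + \sum_(z <- s) rnorm (g z)) => [|w Kw].
  by rewrite addr_ge0// sumr_ge0// => z _; exact: rnorm_ge0.
have [z zs wz] := sP w Kw.
rewrite -[g w](subrK (g z)) (le_trans (rnormD _ _))// lerD//.
  by apply: hd => //; exact: sK.
rewrite (big_rem z)//= lerDl sumr_ge0// => u _; exact: rnorm_ge0.
Qed.

(** On [K], the function [g] is close to the average of its values at the points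
    [z] of a finite net with weights [(1 - |w - z|^2 / D^2)^n], as these
    concentrate on the [z] close to [w] when [n] grows. The weights are
    polynomials in [w] and its conjugate. Their sum [P] is bounded below on [K],
    so the division by [P] is replaced by a partial sum of the geometric series
    of [1 - P / C]. *)
Lemma weierstrass_conj K g (e : R) : compact K -> {within K, continuous g} ->
  0 < e -> exists q, forall w, K w -> rnorm (g w - eval_conj q w) <= e.
Proof.
move=> cK cg e0; have e3 : 0 < e / 3 by rewrite divr_gt0.
have [d' d'0 hd'] := heine cK cg e3.
have [G G0 gG] := within_compact_bounded cK cg.
have [D0 D00 wD0] : exists2 c : R, 0 <= c & forall w, K w -> rnorm w <= c.
  have cid : {within K, continuous (fun w : R[i] => w)}.
    by apply: continuous_subspaceT => w; exact: cvg_id.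
  have [c c0 hc] := within_compact_bounded cK cid.
  by exists c.
pose D := 2 * D0 + 1.
have Dp : 0 < D by rewrite /D; lra.
pose d := Num.min d' D.
have d0 : 0 < d by rewrite lt_min d'0.
have dD : d <= D by rewrite ge_min lexx orbT.
have hd w z : K w -> K z -> rnorm (w - z) < d -> rnorm (g w - g z) <= e / 3.
  by move=> Kw Kz wz; apply: hd' => //; rewrite (lt_le_trans wz)// ge_min lexx.
have d2 : 0 < d / 2 by rewrite divr_gt0.
have [s [sK sP]] := compact_net cK d2.
pose k0 w z : R := 1 - (rnorm (w - z) / D) ^+ 2.
(* The weights are [n]-th powers. Their bases are at most [a] for points at
   distance at least [d], and at least [b] for points at distance less than
   [d / 2], of which the net contains one. *)
pose a : R := 1 - (d / D) ^+ 2.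
pose b : R := 1 - (d / 2 / D) ^+ 2.
have dD1 : 0 < d / D <= 1 by rewrite divr_gt0//= ler_pdivrMr// mul1r.
have a0 : 0 <= a by case/andP: dD1 => dD0 dD1; rewrite /a subr_ge0 exprn_ile1// ltW.
have ab : a < b by case/andP: dD1 => dD0 _; rewrite /a /b ltrD2l ltrN2 mulrAC ltrXn2r ?nnegrE ?(ltW dD0)//; [rewrite divr_ge0 ?ltW|lra].
have b0 : 0 < b by lra.
have k0_01 w z : K w -> K z -> 0 <= k0 w z <= 1.
  move=> Kw Kz; have : rnorm (w - z) / D <= 1.
    rewrite ler_pdivrMr// mul1r (le_trans (rnormD _ _))// rnormN /D.
    by have := wD0 _ Kw; have := wD0 _ Kz; lra.
  have : 0 <= rnorm (w - z) / D by rewrite divr_ge0 ?rnorm_ge0// ltW.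
  by move=> h0 h1; rewrite /k0 subr_ge0 exprn_ile1//= lerBlDr lerDl sqr_ge0.
have k0_far w z : d <= rnorm (w - z) -> k0 w z <= a.
  move=> dwz; rewrite /k0 /a lerD2l lerN2 lerXn2r ?nnegrE ?divr_ge0 ?rnorm_ge0 ?(ltW d0) ?(ltW Dp)//.
  by rewrite ler_pM2r ?invr_gt0.
have k0_near w z : rnorm (w - z) < d / 2 -> b <= k0 w z.
  move=> dwz; rewrite /k0 /b lerD2l lerN2 lerXn2r ?nnegrE ?divr_ge0 ?rnorm_ge0 ?(ltW d0) ?(ltW Dp)//.
  by rewrite ler_pM2r ?invr_gt0// ltW.
pose m : R := (size s)%:R.
have ab1 : 0 <= a / b < 1 by rewrite divr_ge0 ?(ltW b0)//= ltr_pdivrMr ?mul1r.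
have [n /(_ n (leqnn n)) hn] := @geometric_small R (a / b) (2 * G * m) (e / 3) ab1 e3.
pose k w z := k0 w z ^+ n.
pose P w := \sum_(z <- s) k w z.
have k_ge0 w z : K w -> z \in s -> 0 <= k w z.
  by move=> Kw zs; rewrite exprn_ge0//; have /andP[] := k0_01 w z Kw (sK _ zs).
have k_le1 w z : K w -> z \in s -> k w z <= 1.
  by move=> Kw zs; have /andP[? ?] := k0_01 w z Kw (sK _ zs); rewrite exprn_ile1.
have Pb w : K w -> b ^+ n <= P w.
  move=> Kw; have [z zs wz] := sP w Kw.
  rewrite /P (big_rem z)//= (@le_trans _ _ (k w z))//.
    by rewrite lerXn2r ?nnegrE ?(ltW b0)//; [have /andP[] := k0_01 w z Kw (sK _ zs)|exact: k0_near].
  by rewrite lerDl big_seq sumr_ge0// => u /mem_rem us; exact: k_ge0.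
have Pm w : K w -> P w <= m.
  move=> Kw; rewrite /P /m -sum1_size natr_sum big_seq [leRHS]big_seq.
  by apply: ler_sum => z zs; exact: k_le1.
pose S w : R[i] := \sum_(z <- s) g z * (k w z)%:C.
have SP w : K w -> rnorm (S w - g w * (P w)%:C) <= 2 * (e / 3) * P w.
  move=> Kw; rewrite /S {1}/P rmorph_sum/= [in leLHS]mulr_sumr -sumrB.
  rewrite (le_trans (rnorm_sum _ _ _))//.
  have : \sum_(z <- s) rnorm (g z * (k w z)%:C - g w * (k w z)%:C) <=
      \sum_(z <- s) ((e / 3) * k w z + 2 * G * a ^+ n).
    rewrite big_seq [leRHS]big_seq; apply: ler_sum => z zs.
    rewrite -mulrBl rnormM rnorm_real ger0_norm ?k_ge0//.
    have kz := k_ge0 w z Kw zs.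
    have an : 0 <= a ^+ n by rewrite exprn_ge0.
    have [wz|wz] := ltP (rnorm (w - z)) d.
      rewrite (@le_trans _ _ (e / 3 * k w z))//.
        by rewrite ler_wpM2r// rnormB hd//; exact: sK.
      by rewrite lerDl mulr_ge0// mulr_ge0.
    rewrite (@le_trans _ _ (2 * G * a ^+ n))//; last by rewrite lerDr mulr_ge0// ltW.
    rewrite ler_pM ?rnorm_ge0//; last first.
      rewrite lerXn2r ?nnegrE// ?k0_far//.
      by have /andP[] := k0_01 w z Kw (sK _ zs).
    rewrite (le_trans (rnormD _ _))// rnormN.
    by have := gG _ Kw; have := gG _ (sK _ zs); lra.
  move/le_trans; apply.
  rewrite big_split/= -mulr_sumr -/(P w) [leRHS](_ : _ = e / 3 * P w + e / 3 * P w); last by ring.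
  rewrite lerD2l big_const_seq count_predT iter_addr_0 -[leLHS]mulr_natr -/m.
  rewrite (@le_trans _ _ (e / 3 * b ^+ n))//; last by rewrite ler_wpM2l ?(ltW e3)// Pb.
  have -> : 2 * G * a ^+ n * m = (a / b) ^+ n * (2 * G * m) * b ^+ n.
    by rewrite expr_div_n; field; rewrite expf_neq0// gt_eqF.
  by rewrite ler_wpM2r// exprn_ge0// ltW.
pose C := m + 1.
have m0 : 0 <= m by rewrite ler0n.
have C0 : 0 < C by rewrite /C; lra.
have bn0 : 0 < b ^+ n by rewrite exprn_gt0.
pose th := Num.max 0 (1 - b ^+ n / C).
have th01 : 0 <= th < 1.
  by rewrite /th le_max lexx/= gt_max ltr01/= ltrBlDr ltrDl divr_gt0.
have [l /(_ l (leqnn l)) hl] := @geometric_small R th G (e / 3) th01 e3.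
pose y w := 1 - C^-1 * P w.
have y01 w : K w -> 0 <= y w <= th.
  move=> Kw; rewrite /y; apply/andP; split.
    rewrite subr_ge0 mulrC ler_pdivrMr// mul1r (le_trans (Pm w Kw))// /C; lra.
  by rewrite /th le_max lerD2l lerN2 mulrC ler_pM2r ?invr_gt0// Pb ?orbT.
pose u w := C^-1 * \sum_(j < l) y w ^+ j.
have Pu w : P w * u w = 1 - y w ^+ l.
  have -> : P w = C * (1 - y w) by rewrite /y opprB addrC subrK mulVKf ?gt_eqF.
  rewrite /u mulrCA -mulrA [C^-1 * _]mulrA mulVf ?gt_eqF// mul1r.
  by rewrite -opprB mulNr -subrX1 opprB.
pose kp z : {poly {poly R[i]}} := (1 - ((D ^- 2)%:C)%:P%:P *
  (('X - (Num.conj z)%:P%:P) * ('X - z%:P)%:P)) ^+ n.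
have kpE w z : eval_conj (kp z) w = (k w z)%:C.
  rewrite /kp eval_conjX eval_conjB eval_conj1 !eval_conjM eval_conjC.
  have -> : eval_conj ('X - (Num.conj z)%:P%:P) w = Num.conj (w - z).
    by rewrite /eval_conj !hornerE rmorphB.
  have -> : eval_conj ('X - z%:P)%:P w = w - z by rewrite /eval_conj !hornerE.
  rewrite [Num.conj _ * _]mulrC rnormC -rmorphM.
  by rewrite /k rmorphXn rmorphB rmorph1 expr_div_n [_ / _]mulrC.
pose Pp : {poly {poly R[i]}} := \sum_(z <- s) kp z.
have PpE w : eval_conj Pp w = (P w)%:C.
  by rewrite eval_conj_sum rmorph_sum; apply: eq_bigr => z _; rewrite kpE.
exists ((\sum_(z <- s) (g z)%:P%:P * kp z) * ((C^-1)%:C%:P%:P *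
  \sum_(j < l) (1 - (C^-1)%:C%:P%:P * Pp) ^+ j)) => w Kw.
rewrite eval_conjM eval_conjM eval_conjC !eval_conj_sum.
have -> : \sum_(z <- s) eval_conj ((g z)%:P%:P * kp z) w = S w.
  by apply: eq_bigr => z _; rewrite eval_conjM eval_conjC kpE.
have -> : (C^-1)%:C * \sum_(j < l) eval_conj ((1 - (C^-1)%:C%:P%:P * Pp) ^+ j) w =
    (u w)%:C.
  rewrite /u rmorphM rmorph_sum; congr (_ * _); apply: eq_bigr => j _.
  by rewrite eval_conjX eval_conjB eval_conj1 eval_conjM eval_conjC PpE
    rmorphXn rmorphB rmorph1 rmorphM.
have /andP[y0 yth] := y01 w Kw.
have u0 : 0 <= u w.
  by rewrite mulr_ge0 ?invr_ge0 ?(ltW C0)// sumr_ge0// => j _; rewrite exprn_ge0.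
have yl : 0 <= y w ^+ l by rewrite exprn_ge0.
have -> : g w - S w * (u w)%:C =
    - ((S w - g w * (P w)%:C) * (u w)%:C) + g w * (y w ^+ l)%:C.
  have -> : (y w ^+ l)%:C = 1 - (P w)%:C * (u w)%:C :> R[i].
    by rewrite -rmorphM -(rmorph1 (real_complex R)) -rmorphB Pu opprB addrC subrK.
  ring.
rewrite (le_trans (rnormD _ _))// rnormN !rnormM !rnorm_real (ger0_norm u0) (ger0_norm yl).
have h1 : rnorm (S w - g w * (P w)%:C) * u w <= 2 * (e / 3).
  rewrite (@le_trans _ _ (2 * (e / 3) * P w * u w))//; first by rewrite ler_wpM2r// SP.
  have e30 : 0 <= 2 * (e / 3) by lra.
  have yl1 : 1 - y w ^+ l <= 1 by rewrite gerBl.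
  by rewrite -mulrA Pu ler_piMr.
have h2 : rnorm (g w) * y w ^+ l <= e / 3.
  rewrite (le_trans _ hl)// mulrC ler_pM ?rnorm_ge0 ?gG//.
  by rewrite lerXn2r ?nnegrE ?(le_trans y0).
lra.
Qed.

End Weierstrass.

(** * The continuous functional calculus *)

Section FunctionalCalculus.
Context {R : realType} {H : nzHilbertType R}.
Implicit Types (S T U X N A : bop H) (q : {poly {poly R[i]}}).

Lemma uniform_rnormP (K : set R[i]) (F : nat -> R[i] -> R[i]) (g : R[i] -> R[i]) :
  {uniform K, F @ \oo --> g} <->
  forall e : R, 0 < e -> exists n0, forall n, (n0 <= n)%N ->
    forall w, K w -> rnorm (g w - F n w) < e.
Proof.
split=> [Fg e e0|h P /uniform_nbhs[E [entE EP]]].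
  have : nbhs (g : {uniform` K -> R[i]}) [set h | forall w, K w -> rnorm (g w - h w) < e].
    apply/uniform_nbhs; exists [set xy | ball xy.1 e%:C xy.2]; split.
      by rewrite -entourage_ballE; exists e%:C => //=; rewrite ltcR.
    by move=> h /= hK w Kw; have := hK w Kw; rewrite -ball_normE/= rnormE ltcR.
  by move=> /Fg[n0 _ hn0]; exists n0.
move: entE; rewrite -entourage_ballE => -[e' /= e'0 eE].
have eR : e' = (complex.Re e')%:C by rewrite RRe_real// gtr0_real.
have [|n0 hn0] := h (complex.Re e'); first by rewrite -ltcR -eR.
exists n0 => // n nn; apply: EP => w Kw; apply: eE => /=.
by rewrite -ball_normE/= rnormE eR ltcR hn0.
Qed.

Lemma op_invertibleM S T : op_invertible S -> op_invertible T -> op_invertible (S * T).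
Proof.
move=> [V [SV VS]] [W [TW WT]]; exists (W * V); split.
  by rewrite mulrA -[S * T * W]mulrA TW mulr1.
by rewrite mulrA -[W * V * S]mulrA VS mulr1.
Qed.

Lemma op_spectrum_bounded T z : op_spectrum T z -> rnorm z <= op_norm T.
Proof.
move=> /op_spectrumP nz; rewrite leNgt; apply/negP => Tz; apply: nz.
have z1 : 0 < rnorm z by rewrite (le_lt_trans _ Tz)// op_norm_ge0.
have z0 : z != 0 by rewrite -rnorm_eq0 gt_eqF.
have [|V [UV VU]] := @neumann _ _ (1 - z^-1 *: T).
  by rewrite opprB addrC subrK op_normZ rnormV ltr_pdivrMl// mulr1.
have -> : z%:A - T = z *: (1 - z^-1 *: T) by rewrite scalerBr scalerA mulfV// scale1r.
exists (z^-1 *: V); rewrite -!scalerAl -!scalerAr !scalerA.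
by rewrite mulfV// mulVf// !scale1r.
Qed.

Lemma op_spectrum_closed T : closed (op_spectrum T).
Proof.
rewrite -[op_spectrum T]setCK; apply: open_closedC; rewrite openE => z /= /contrapT[V [TV VT]].
have c0 : 0 < op_norm V + 1 by rewrite ltr_wpDl// op_norm_ge0.
apply/nbhs_rnorm; exists (op_norm V + 1)^-1; first by rewrite invr_gt0.
move=> w zw /op_spectrumP; apply.
have -> : w%:A - T = (z%:A - T) * (1 + (w - z) *: V).
  by rewrite mulrDr mulr1 -scalerAr TV scalerBl [RHS]addrC addrA subrK.
apply: op_invertibleM; first by exists V.
apply: neumann; rewrite opprD addrA subrr add0r op_normN op_normZ rnormB.
rewrite (@le_lt_trans _ _ (rnorm (z - w) * (op_norm V + 1)))//.
  by rewrite ler_wpM2l ?rnorm_ge0// lerDl.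
by rewrite -ltr_pdivlMr// mul1r.
Qed.

(** Both closedness and boundedness come from the Neumann series. *)
Lemma compact_op_spectrum T : compact (op_spectrum T).
Proof.
exact: compact_closed_bounded (@op_spectrum_closed T) (@op_spectrum_bounded T).
Qed.

Section Evaluation.
Variable A : bop H.
Implicit Types (x y : bic A) (h : bic A -> R[i]).

Lemma bic_opM x y : bic_op (x * y) = bic_op x * bic_op y.
Proof. exact: (rmorphM (val : bic A -> bop H)). Qed.

Lemma bic_opX x n : bic_op (x ^+ n) = bic_op x ^+ n.
Proof. exact: (rmorphXn (val : bic A -> bop H)). Qed.

Definition bic_eval2 q x y : bic A := (map_poly (horner_alg x) q).[y].

Lemma bic_horner_alg x (p : {poly R[i]}) : bic_op (horner_alg x p) = horner_alg (bic_op x) p.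
Proof.
rewrite /horner_alg /horner_morph/= (horner_coef_wide _ (size_poly _ _)).
rewrite [RHS](horner_coef_wide _ (size_poly _ _)).
rewrite [LHS](raddf_sum (val : bic A -> bop H)); apply: eq_bigr => i _.
by rewrite [LHS]bic_opM bic_opX !coef_map.
Qed.

Lemma bic_eval2E q x y : bic_op (bic_eval2 q x y) = op_eval2 q x y.
Proof.
rewrite /bic_eval2 /op_eval2 (horner_coef_wide _ (size_poly _ _)).
rewrite [RHS](horner_coef_wide _ (size_poly _ _)).
rewrite [LHS](raddf_sum (val : bic A -> bop H)); apply: eq_bigr => i _.
by rewrite [LHS]bic_opM bic_opX !coef_map/= bic_horner_alg.
Qed.

Lemma character_eval2 h q x y : is_character h ->
  h (bic_eval2 q x y) = q.[(h y)%:P].[h x].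
Proof.
move=> hh; rewrite /bic_eval2 (horner_coef_wide _ (size_poly _ _)) (char_sum hh).
rewrite (horner_coef q) horner_sum; apply: eq_bigr => i _.
rewrite (charM hh) (charX hh) coef_map/= (char_horner hh).
by rewrite hornerM horner_exp hornerC.
Qed.

Lemma character_conj_eval h q x y : bic_character h -> bic_op y = adjoint x ->
  h (bic_eval2 q x y) = eval_conj q (h x).
Proof.
by move=> hb yx; rewrite character_eval2 ?(character_adjoint hb yx)//; case: hb.
Qed.

End Evaluation.

Lemma normal_bic N : normal N -> exists x y : bic N, bic_op x = N /\ bic_op y = adjoint N.
Proof.
move=> nN; have Nb := bicommutant_self N.
by exists (Bic Nb), (Bic (bicommutant_adjoint nN Nb)).
Qed.

(** A character that attains the norm of the left-hand side sends [N] to a point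
    [w] of its spectrum and [adjoint N] to the conjugate of [w]. *)
Lemma op_norm_eval2 N q : normal N -> exists2 w, op_spectrum N w &
  op_norm (op_eval2 q N (adjoint N)) = rnorm (eval_conj q w).
Proof.
move=> nN; have [x [y [xN yN]]] := normal_bic nN.
pose u := bic_eval2 q x y.
have uE : bic_op u = op_eval2 q N (adjoint N) by rewrite bic_eval2E xN yN.
have nu : normal (bic_op u).
  have /bicommutantP := bic_subproof u; apply.
  have : bic_op u * adjoint N = adjoint N * bic_op u.
    by rewrite -yN; apply: bicommutant_comm; exact: bic_subproof.
  by move=> /(congr1 (@adjoint R H)); rewrite !adjointM adjointK.
have ub := bicommutant_adjoint nu (bic_subproof u).
have [h hb hn] := @norm_attaining_character _ _ _ u (Bic ub) erefl.
exists (h x).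
  by rewrite -xN; apply: bic_character_spectrum; case: hb.
by rewrite -uE -hn /u (character_conj_eval _ hb)// xN yN.
Qed.

Lemma op_eval2B q1 q2 S T : op_eval2 (q1 - q2) S T = op_eval2 q1 S T - op_eval2 q2 S T.
Proof. by rewrite /op_eval2 rmorphB/= hornerD hornerN. Qed.

(** Approximations of [g] that converge uniformly on the spectrum yield a Cauchy
    sequence of operators, by [op_norm_eval2]. *)
Lemma fun_calcP N (g : R[i] -> R[i]) : normal N ->
  {within op_spectrum N, continuous g} -> is_fun_calc N g (fun_calc N g).
Proof.
move=> nN cg; suff [T TP] : exists T, is_fun_calc N g T.
  by apply: (@xgetPex _ 0 [set T | is_fun_calc N g T]); exists T.
have e0 n : 0 < (n.+1%:R : R)^-1 / 2 by rewrite divr_gt0// invr_gt0 ltr0n.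
have /choice[q qP] : forall n, exists q, forall w, op_spectrum N w ->
    rnorm (g w - eval_conj q w) <= n.+1%:R^-1 / 2.
  by move=> n; apply: weierstrass_conj => //; exact: compact_op_spectrum.
have small (e : R) : 0 < e -> exists n0, forall n, (n0 <= n)%N -> n.+1%:R^-1 / 2 <= e / 2.
  move=> /inv_succ_small[n0 hn0]; exists n0 => n nn.
  by rewrite ler_pM2r ?invr_gt0// hn0.
have [|T TP] := @op_complete _ _ (fun n => op_eval2 (q n) N (adjoint N)).
  move=> b bp; have [n0 hn0] := small b bp; exists n0 => m n mn nn.
  rewrite -op_eval2B; have [w wN ->] := op_norm_eval2 (q m - q n) nN.
  rewrite eval_conjB (le_trans (rnormBD (g w) _ _))// rnormB.
  have := qP m w wN; have := qP n w wN; have := hn0 m mn; have := hn0 n nn.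
  by move: (m.+1%:R^-1 : R) (n.+1%:R^-1 : R) => *; lra.
exists T, q; split.
  apply/uniform_rnormP => e ep; have [n0 hn0] := small e ep; exists n0 => n nn w wN.
  rewrite (le_lt_trans (qP n w wN))// (le_lt_trans (hn0 n nn))//.
  by rewrite ltr_pdivrMr// ltr_pMr// ltr1n.
apply/cvgr0Pnorm_le => e ep; have [n0 hn0] := TP e ep.
by exists n0 => // n nn /=; rewrite ger0_norm ?op_norm_ge0// hn0.
Qed.

Lemma op_limit_bicommutant A (S : nat -> bop H) T :
  (forall n, S n \in bicommutant A) -> op_norm (S n - T) @[n --> \oo] --> (0 : R) ->
  T \in bicommutant A.
Proof.
move=> Sb ST; apply/bicommutantP => X AX; apply/eqP; rewrite -subr_eq0; apply/eqP.
apply: op_norm_eq0; apply/ler_addgt0Pr => e ep; rewrite add0r.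
have c0 : 0 < 2 * op_norm X + 1 by have := op_norm_ge0 X; lra.
have ec : 0 < e / (2 * op_norm X + 1) by rewrite divr_gt0.
have := ST => /cvgr0Pnorm_le/(_ _ ec)[n _ /(_ n (leqnn n))/=].
rewrite ger0_norm ?op_norm_ge0// => hn.
have /bicommutantP/(_ X AX) SX := Sb n.
have -> : T * X - X * T = X * (S n - T) - (S n - T) * X.
  by rewrite mulrBr mulrBl SX opprB [RHS]addrC addrA subrK.
rewrite (le_trans (op_normD _ _))// op_normN.
have h1 := op_normM X (S n - T); have h2 := op_normM (S n - T) X.
have -> : e = e / (2 * op_norm X + 1) * (2 * op_norm X + 1) by rewrite divfK// gt_eqF.
move: hn h1 h2; have := op_norm_ge0 X; have := op_norm_ge0 (S n - T).
move: (op_norm (S n - T)) (op_norm X) (op_norm (X * _)) (op_norm (_ * X)) (e / _).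
by move=> a b c d k; nra.
Qed.

Lemma fun_calc_bicommutant A N g : normal N -> N \in bicommutant A ->
  {within op_spectrum N, continuous g} -> fun_calc N g \in bicommutant A.
Proof.
move=> nN Nb cg; have [q [_ qT]] := fun_calcP nN cg.
apply: (op_limit_bicommutant _ qT) => n.
have := bic_eval2E (q n) (Bic Nb) (Bic (bicommutant_adjoint nN Nb)).
by move=> /= <-; exact: bic_subproof.
Qed.

(** Characters are contractive, so this passes to the limit from polynomials in
    [x] and its adjoint. *)
Lemma character_fun_calc A (x t : bic A) (h : bic A -> R[i]) g :
  normal x -> {within op_spectrum x, continuous g} -> bic_character h ->
  bic_op t = fun_calc x g -> h t = g (h x).
Proof.
move=> nx cg hb tE; have [q [qg qT]] := fun_calcP nx cg.
have [hh hle] := hb.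
pose y := Bic (bicommutant_adjoint nx (bic_subproof x)).
have hx : op_spectrum x (h x) by exact: bic_character_spectrum.
apply/eqP; rewrite -subr_eq0 -rnorm_eq0; apply/eqP/le_anti; rewrite rnorm_ge0 andbT.
apply/ler_addgt0Pr => e ep; rewrite add0r.
have e2 : 0 < e / 2 by rewrite divr_gt0.
have /uniform_rnormP/(_ _ e2)[n1 h1] := qg.
have := qT => /cvgr0Pnorm_le/(_ _ e2)[n2 _ h2].
pose n := maxn n1 n2.
have := h2 n (leq_maxr _ _); rewrite /= ger0_norm ?op_norm_ge0// => k2.
have k1 : rnorm (g (h x) - eval_conj (q n) (h x)) < e / 2.
  exact: h1 n (leq_maxl _ _) _ hx.
have k3 : rnorm (h (bic_eval2 (q n) x y - t)) <= e / 2.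
  apply: le_trans k2; rewrite (le_trans (hle _))//.
  by rewrite [bic_op _]/= bic_eval2E tE.
rewrite (charB hh) (character_conj_eval _ hb)// in k3.
rewrite rnormB (le_trans (rnormBD (eval_conj (q n) (h x)) _ _))//.
by move: k1 k3; lra.
Qed.

End FunctionalCalculus.

(** * Symmetric functions of the roots of a polynomial *)

Section SymmetricFunctions.
Context {R : realType}.
Implicit Types (p : {poly R[i]}) (z w : R[i]).

Definition coef_cvg T (F : set_system T) (P : T -> {poly R[i]}) (Q : {poly R[i]}) :=
  forall m, (P t)`_m @[t --> F] --> Q`_m.

Section CoefCvg.
Variables (T : Type) (F : set_system T).
Context {FF : Filter F}.

Lemma cvg_sum_seq (I : Type) (s : seq I) (u : T -> I -> R[i]) (v : I -> R[i]) :
  (forall i, u t i @[t --> F] --> v i) ->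
  \sum_(i <- s) u t i @[t --> F] --> \sum_(i <- s) v i.
Proof.
move=> uv; elim: s => [|i s ih].
  rewrite big_nil; under eq_fun do rewrite big_nil; exact: cvg_cst.
rewrite big_cons; under eq_fun do rewrite big_cons; by apply: cvgD; [exact: uv|exact: ih].
Qed.

Lemma coef_cvgM P1 P2 Q1 Q2 : coef_cvg F P1 Q1 -> coef_cvg F P2 Q2 ->
  coef_cvg F (fun t => P1 t * P2 t) (Q1 * Q2).
Proof.
move=> h1 h2 m; rewrite coefM; under eq_fun do rewrite coefM.
by apply: cvg_sum_seq => i; apply: cvgM; [exact: h1|exact: h2].
Qed.

Lemma coef_cvg_prod (I : Type) (s : seq I) (P : I -> T -> {poly R[i]}) (Q : I -> {poly R[i]}) :
  (forall i, coef_cvg F (P i) (Q i)) ->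
  coef_cvg F (fun t => \prod_(i <- s) P i t) (\prod_(i <- s) Q i).
Proof.
move=> PQ; elim: s => [|i s ih].
  by rewrite big_nil; under eq_fun do rewrite big_nil; move=> m; exact: cvg_cst.
rewrite big_cons; under eq_fun do rewrite big_cons; by apply: coef_cvgM; [exact: PQ|exact: ih].
Qed.

Lemma coef_cvg_lin (a b : T -> R[i]) (a' b' : R[i]) :
  a t @[t --> F] --> a' -> b t @[t --> F] --> b' ->
  coef_cvg F (fun t => (a t)%:P + (b t)%:P * 'X) (a'%:P + b'%:P * 'X).
Proof.
move=> ha hb m; rewrite coefD coefC coefMX coefC.
under eq_fun do rewrite coefD coefC coefMX coefC.
case: m => [|[|m]] /=; apply: cvgD.
- exact: ha.
- exact: cvg_cst.
- exact: cvg_cst.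
- exact: hb.
- exact: cvg_cst.
- exact: cvg_cst.
Qed.

End CoefCvg.

Lemma coef_cvg_unique T (F : set_system T) (P : T -> {poly R[i]}) Q1 Q2 :
  ProperFilter F -> coef_cvg F P Q1 -> coef_cvg F P Q2 -> Q1 = Q2.
Proof.
move=> FF h1 h2; apply/polyP => m.
exact: (@cvg_unique _ (norm_hausdorff (V := R[i]))) (h1 m) (h2 m).
Qed.

Lemma ultrafilter_cvg (T : Type) (F : set_system T) (f : T -> R[i]) (l : R[i]) :
  ProperFilter F ->
  (forall U, UltraFilter U -> F `<=` U -> f @ U --> l) -> f @ F --> l.
Proof.
move=> FF h; apply/cvg_rnorm => e e0; apply: contrapT => nF.
pose A := [set t | e <= rnorm (l - f t)].
(* Otherwise [F] can be refined to a proper filter along which [f] keeps away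
   from [l]. *)
have FA : ProperFilter (within A F).
  split; last exact: within_filter.
  move=> FnA; apply: nF; apply: (@filterS _ F _ _ _ _ FnA) => t /= nA.
  by rewrite ltNge; apply/negP => /nA.
have [U [UU FU]] := ultraFilterLemma FA.
have /cvg_rnorm/(_ _ e0) h1 : f @ U --> l.
  by apply: h => // B FB; apply: FU; move: FB; apply: filterS => t Bt _.
have h2 : U A by apply: FU; exact: withinT.
have [t [/= lt le]] := @filter_ex _ U _ _ (filterI h1 h2).
by move: lt; rewrite ltNge le.
Qed.

Lemma fmap_ultra (T T' : Type) (f : T -> T') (U : set_system T) :
  UltraFilter U -> UltraFilter (f @ U).
Proof.
move=> UU; split; first exact: fmap_proper_filter.
move=> G GG UG; apply/seteqP; split=> [B GB|]; last exact: UG.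
have [//|UnB] := in_ultra_setVsetC (f @^-1` B) UU.
have GnB : G (~` B) by apply: UG.
by have [y []] := @filter_ex _ G _ _ (filterI GB GnB).
Qed.

Variables (p : {poly R[i]}) (d : nat).
Hypotheses (p_monic : p \is monic) (p_size : size p = d.+1) (d_ge1 : (0 < d)%N).

Lemma monic_sub_roots w : exists r : 'I_d -> R[i],
  p - w%:P = \prod_(i < d) ('X - (r i)%:P).
Proof.
have [s sE] := closed_field_poly_normal (p - w%:P).
have szc : (size (- w%:P) < size p)%N.
  by rewrite size_polyN p_size (leq_ltn_trans (size_polyC_leq1 _))// ltnS.
have szw : size (p - w%:P) = d.+1 by rewrite size_polyDl.
have mon : lead_coef (p - w%:P) = 1 by rewrite lead_coefDl// (monicP p_monic).
rewrite mon scale1r in sE.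
have ss : size s = d by apply: succn_inj; rewrite -szw sE size_prod_XsubC.
exists (fun i => nth 0 s i).
by rewrite sE (big_nth 0) big_mkord ss.
Qed.

(** The roots of [p - w] in an arbitrary order. In general no ordering depends
    continuously on [w], but symmetric functions of the roots do. *)
Definition fiber w : 'I_d -> R[i] := projT1 (cid (monic_sub_roots w)).

Lemma fiberE w : p - w%:P = \prod_(i < d) ('X - (fiber w i)%:P).
Proof. by rewrite /fiber; case: cid. Qed.

Lemma horner_fiber w i : p.[fiber w i] = w.
Proof.
have := congr1 (fun q => q.[fiber w i]) (fiberE w).
rewrite hornerD hornerN hornerC horner_prod (bigD1 i)//= hornerXsubC subrr mul0r.
by move/eqP; rewrite subr_eq0 => /eqP.
Qed.

Lemma fiber_surj z : exists i, z = fiber p.[z] i.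
Proof.
have := congr1 (fun q => q.[z]) (fiberE p.[z]).
rewrite hornerD hornerN hornerC subrr horner_prod => /esym/eqP/prodf_eq0[i _].
by rewrite hornerXsubC subr_eq0 => /eqP zi; exists i.
Qed.

(** If [z] is large, all the factors of [p(z)] exceed the bound on [w]. *)
Lemma fiber_bounded (r : R) : exists c : R, forall w i, rnorm w <= r -> rnorm (fiber w i) <= c.
Proof.
pose c := `|r| + rnorm p`_0 + 1 + \sum_(i < d) rnorm (fiber 0 i).
exists c => w i wr; rewrite leNgt; apply/negP => cz; set z := fiber w i in cz.
have pz : p.[z] = w by exact: horner_fiber.
have := congr1 (fun q => rnorm q.[z]) (fiberE 0).
rewrite subr0 pz horner_prod.
have big j : `|r| + 1 <= rnorm (z - fiber 0 j).
  have h1 : rnorm (fiber 0 j) <= \sum_(i < d) rnorm (fiber 0 i).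
    by rewrite (bigD1 j)//= lerDl sumr_ge0// => k _; exact: rnorm_ge0.
  have := rnormD (z - fiber 0 j) (fiber 0 j); rewrite subrK.
  have := rnorm_ge0 p`_0; move: cz h1; rewrite /c; lra.
have -> : rnorm (\prod_(j < d) ('X - (fiber 0 j)%:P).[z]) =
    \prod_(j < d) rnorm (z - fiber 0 j).
  by rewrite (big_morph (@rnorm R R[i]) rnormM rnorm1); apply: eq_bigr => j _; rewrite hornerXsubC.
move=> wE; have : `|r| + 1 <= rnorm w.
  rewrite wE (bigD1 (Ordinal d_ge1))//= (le_trans (big (Ordinal d_ge1)))//.
  rewrite ler_peMr ?rnorm_ge0//.
  elim/big_ind: _ => [//|u v u1 v1|j _]; first by rewrite -[leLHS]mulr1 ler_pM.
  by rewrite (le_trans _ (big j))// lerDr.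
by have := ler_norm r; lra.
Qed.

Lemma perm_fiber w (r : 'I_d -> R[i]) : p - w%:P = \prod_(i < d) ('X - (r i)%:P) ->
  perm_eq (map r (index_enum 'I_d)) (map (fiber w) (index_enum 'I_d)).
Proof.
move=> rE; apply: prod_XsubC_eq; rewrite !big_map.
by rewrite -rE fiberE.
Qed.

(** Along an ultrafilter that converges to [w1], each chosen root converges,
    because the roots are bounded. The limits are the roots of [p - w1] with
    their multiplicities, as the coefficients of [p - w] depend continuously on
    [w]; so they are a permutation of the chosen roots at [w1]. *)
Lemma symmetric_continuous (M : set R[i]) (G : R[i] -> R[i]) m :
  {within [set z | M p.[z]], continuous G} ->
  {within M, continuous (fun w => (\prod_(i < d) (1 - (G (fiber w i))%:P * 'X))`_m)}.
Proof.
move=> /subspace_continuousP cG; apply/subspace_continuousP => w1 Mw1.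
have PF : ProperFilter (within M (nbhs w1)).
  by split; [move=> /nbhs_singleton/(_ Mw1)|exact: within_filter].
apply: ultrafilter_cvg => U UU FU.
have UM : U M by apply: FU; apply: withinT.
have Uw : id @ U --> w1.
  by move=> B nB; apply: FU; move: nB; apply: filterS => w Bw _.
have [c hc] := fiber_bounded (rnorm w1 + 1).
have Uc i : U [set w | rnorm (fiber w i) <= c].
  have /cvg_rnorm/(_ _ ltr01) := Uw; apply: filterS => w /= w1w; apply: hc.
  by have := rnormD (w - w1) w1; rewrite subrK rnormB; lra.
have lim_ex : forall i, exists r : R[i], fiber w i @[w --> U] --> r.
  move=> i; have := @compact_rdisc R c; rewrite compact_ultra.
  by move=> /(_ _ (fmap_ultra (fiber ^~ i) UU) (Uc i))[r [_ hr]]; exists r.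
have [r rP] := choice lim_ex.
have rE : p - w1%:P = \prod_(i < d) ('X - (r i)%:P).
  apply: (@coef_cvg_unique _ U (fun w => p - w%:P)).
    move=> k; rewrite coefB coefC; under eq_fun do rewrite coefB coefC.
    apply: cvgB; first exact: cvg_cst.
    by case: k => [|k] /=; [exact: Uw|exact: cvg_cst].
  under eq_fun do rewrite fiberE.
  apply: coef_cvg_prod => i.
  have e z : 'X - z%:P = (- z)%:P + 1%:P * 'X :> {poly R[i]} by rewrite polyCN mul1r addrC.
  rewrite e; under eq_fun do rewrite e.
  by apply: coef_cvg_lin; [apply: cvgN; exact: rP|exact: cvg_cst].
have pr i : p.[r i] = w1.
  have := congr1 (fun q => q.[r i]) rE.
  rewrite hornerD hornerN hornerC horner_prod (bigD1 i)//= hornerXsubC subrr mul0r.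
  by move/eqP; rewrite subr_eq0 => /eqP.
have lim : coef_cvg U (fun w => \prod_(i < d) (1 - (G (fiber w i))%:P * 'X))
    (\prod_(i < d) (1 - (G (r i))%:P * 'X)).
  apply: coef_cvg_prod => i.
  have e z : 1 - z%:P * 'X = 1%:P + (- z)%:P * 'X :> {poly R[i]} by rewrite polyCN mulNr.
  rewrite e; under eq_fun do rewrite e.
  apply: coef_cvg_lin; first exact: cvg_cst.
  apply: cvgN; have Mr : M p.[r i] by rewrite pr.
  have h := cG (r i) Mr.
  have : fiber w i @[w --> U] --> within [set z | M p.[z]] (nbhs (r i)).
    move=> B hB.
    have UB : U [set w | M p.[fiber w i] -> B (fiber w i)] by exact: (rP i _ hB).
    suff : U [set w | B (fiber w i)] by [].
    apply: (@filterS _ U _ _ _ _ (filterI UB UM)) => w /= [h1 Mw].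
    by apply: h1; rewrite horner_fiber.
  by move=> hw; exact: cvg_comp hw h.
suff e : \prod_(i < d) (1 - (G (fiber w1 i))%:P * 'X) =
    \prod_(i < d) (1 - (G (r i))%:P * 'X) by have := lim m; rewrite -e.
have e (v : 'I_d -> R[i]) : \prod_(u <- map v (index_enum 'I_d)) (1 - (G u)%:P * 'X : {poly R[i]}) =
    \prod_(i < d) (1 - (G (v i))%:P * 'X) by rewrite big_map.
by rewrite -!e; apply: perm_big; rewrite perm_sym; exact: perm_fiber.
Qed.

End SymmetricFunctions.

(** * The spectrum in the quotient algebra *)

Section Interpolation.
Context {R : realType} {d : nat} (L : simple_zeros R d).
Hypothesis d_ge1 : (0 < d)%N.

Lemma zpoly_monic : zpoly L \is monic.
Proof. exact: monic_prod_XsubC. Qed.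

Lemma size_zpoly : size (zpoly L) = d.+1.
Proof. by rewrite size_prod_XsubC /index_enum -enumT size_enum_ord. Qed.

Lemma zdelta_zero j k : (zdelta L j).[L k] = (j == k)%:R.
Proof.
rewrite /zdelta horner_prod; case: eqVneq => [<-|jk].
  apply: big1 => i ij; rewrite hornerZ hornerXsubC mulVf// subr_eq0.
  by apply: contra ij => /eqP/(@zero_of_inj _ _ L) ->.
by rewrite (bigD1 k) 1?eq_sym//= hornerZ hornerXsubC subrr mulr0 mul0r.
Qed.

Lemma size_zdelta j : (size (zdelta L j) <= d)%N.
Proof.
rewrite (leq_trans (size_prod_leq _ _))//.
rewrite (eq_bigr (fun=> 2%N)); last first.
  move=> k kj; rewrite size_scale ?size_XsubC// invr_eq0 subr_eq0.
  by apply: contra kj => /eqP/(@zero_of_inj _ _ L) ->.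
by rewrite sum_nat_const cardC1 card_ord muln2 -addnn -addnS addKn prednK.
Qed.

Lemma sum_zdelta z : \sum_j (zdelta L j).[z] = 1.
Proof.
suff /(congr1 (fun q : {poly R[i]} => q.[z])) : \sum_j zdelta L j = 1.
  by rewrite horner_sum hornerC.
apply/eqP; rewrite -subr_eq0; apply: contraT => q0.
have := max_poly_roots q0 (rs := map L (enum 'I_d)) _ _.
rewrite size_map size_enum_ord ltnNge => /(_ _ _)/negP; case=> //.
- apply/allP => _ /mapP[k _ ->]; rewrite /root hornerD hornerN hornerC horner_sum.
  rewrite (bigD1 k)//= zdelta_zero eqxx big1 ?addr0 ?subrr// => j jk.
  by rewrite zdelta_zero (negbTE jk).
- by rewrite map_inj_uniq ?enum_uniq//; exact: zero_of_inj.
rewrite (leq_trans (size_polyD _ _))// geq_max size_polyN size_poly1 d_ge1 andbT.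
by rewrite (leq_trans (size_sum _ _ _))//; apply/bigmax_leqP => j _; exact: size_zdelta.
Qed.

End Interpolation.

Section Continuity.
Context {R : realType}.

Lemma cvg_horner T (F : set_system T) (q : {poly R[i]}) (u : T -> R[i]) l :
  Filter F -> u @ F --> l -> q.[u t] @[t --> F] --> q.[l].
Proof.
move=> FF ul; elim/poly_ind: q => [|q c ih].
  by rewrite horner0; under eq_fun do rewrite horner0; exact: cvg_cst.
rewrite hornerMXaddC; under eq_fun do rewrite hornerMXaddC.
by apply: cvgD; [apply: cvgM; [exact: ih|exact: ul]|exact: cvg_cst].
Qed.

(** A continuous function on the whole plane that is the inverse where the
    modulus is at least [e]: it serves to extend [1 / hat f] continuously beyond
    the spectrum of [A]. *)
Definition clipped_inv (e : R) (u : R[i]) : R[i] :=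
  Num.conj u * ((Num.max (rnorm u ^+ 2) (e ^+ 2))^-1)%:C.

Lemma clipped_invE e u : 0 < e -> e <= rnorm u -> clipped_inv e u * u = 1.
Proof.
move=> e0 eu; rewrite /clipped_inv max_l; last by rewrite lerXn2r ?nnegrE ?rnorm_ge0// ltW.
rewrite mulrAC [_ * u]mulrC rnormC -rmorphM mulfV ?rmorph1//.
by rewrite expf_neq0// gt_eqF// (lt_le_trans e0).
Qed.

Lemma clipped_inv_cvg T (F : set_system T) e (u : T -> R[i]) l :
  Filter F -> 0 < e -> u @ F --> l -> clipped_inv e (u t) @[t --> F] --> clipped_inv e l.
Proof.
move=> FF e0 ul; apply: cvgM.
  apply/cvg_rnorm => b b0; have /cvg_rnorm/(_ _ b0) := ul; apply: filterS => t.
  by rewrite -rmorphB rnormJ.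
have nl : rnorm (u t) @[t --> F] --> rnorm l.
  apply/cvgrPdist_lt => b b0; have /cvg_rnorm/(_ _ b0) := ul; apply: filterS => t.
  move=> h; have := rnormD (l - u t) (u t); have := rnormD (u t - l) l.
  by rewrite !subrK [rnorm (u t - l)]rnormB ltr_norml => *; apply/andP; split; lra.
have real_cvg (v : T -> R) (a : R) : v @ F --> a -> (v t)%:C @[t --> F] --> a%:C.
  move=> va; apply/cvg_rnorm => b b0; have /cvgrPdist_lt/(_ _ b0) := va.
  by apply: filterS => t; rewrite -rmorphB rnorm_real.
apply: real_cvg; apply: cvgV.
  by rewrite gt_eqF// lt_max [X in _ || X]exprn_gt0 ?orbT.
have maxE (a b : R) : Num.max a b = (a + b + `|a - b|) / 2 by rewrite maxr_absE.
rewrite maxE; under eq_fun do rewrite maxE.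
have sq : rnorm (u t) ^+ 2 @[t --> F] --> rnorm l ^+ 2.
  by rewrite expr2; under eq_fun do rewrite expr2; apply: cvgM.
apply: cvgM; last exact: cvg_cst.
apply: cvgD; first by apply: cvgD; [exact: sq|exact: cvg_cst].
by apply: cvg_norm; apply: cvgB; [exact: sq|exact: cvg_cst].
Qed.

End Continuity.

Section HatTheory.
Context {R : realType} {d : nat} {L : simple_zeros R d} {M : set R[i]}.
Hypothesis d_ge1 : (0 < d)%N.
Implicit Types (f g : cLambda L M) (z w : R[i]).

Lemma ext0E f (x : M) : ext0 f (set_val x) = f x.
Proof. by rewrite /ext0 set_valE valK. Qed.

Lemma hat_sum I (s : seq I) (P : pred I) (F : I -> cLambda L M) z :
  hat (\sum_(i <- s | P i) F i) z = \sum_(i <- s | P i) hat (F i) z.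
Proof.
have h0 : hat (0 : cLambda L M) z = 0 by have := hatB 0 (0 : cLambda L M) z; rewrite !subrr.
apply: (big_morph (fun f => hat f z)) => // f g.
have -> : f + g = f - (0 - g) by rewrite sub0r opprK.
by rewrite !hatB h0 sub0r opprK.
Qed.

Lemma ext0_continuous f j : {within M, continuous (fun w => ext0 f w j 0)}.
Proof.
apply/subspace_sigL_continuousP.
have -> : sigL M (fun w => ext0 f w j 0) = (fun x : M => f x j 0).
  by apply/funext => x; rewrite /sigL/= ext0E.
have cf : continuous f by exact: (@cts_fun _ _ f).
by move/continuous_colP: cf; exact.
Qed.

Lemma hat_continuous f : {within [set z | M (zpoly L).[z]], continuous (hat f)}.
Proof.
apply/subspace_continuousP => z /= Mz.
have zz : id @ within [set z | M (zpoly L).[z]] (nbhs z) --> z by exact: cvg_within.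
have PF := within_filter [set z | M (zpoly L).[z]] (nbhs_filter z).
apply: cvg_sum_seq => j; apply: cvgM; first by apply: cvg_horner; exact: zz.
have /subspace_continuousP/(_ _ Mz) h := @ext0_continuous f j.
have pz : (zpoly L).[u] @[u --> within [set z | M (zpoly L).[z]] (nbhs z)] -->
    within M (nbhs (zpoly L).[z]).
  move=> B hB.
  have := @cvg_horner R _ _ (zpoly L) id z PF zz _ hB.
  by rewrite /within/= /fmap/= /nbhs/=; apply: filterS => u h1 Mu; exact: h1.
exact: cvg_comp pz h.
Qed.

Definition scalar_section (c : R[i] -> R[i]) (cc : {within M, continuous c}) : cLambda L M.
Proof.
apply: (@mkcLambda R d L M (fun x => const_mx (c (set_val x)))).
apply/continuous_colP => i.
have -> : (fun x : M => (const_mx (c (set_val x)) : 'cV[R[i]]_d) i 0) = sigL M c.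
  by apply/funext => x; rewrite mxE.
exact/subspace_sigL_continuousP.
Defined.

Lemma hat_scalar_section c cc z : M (zpoly L).[z] ->
  hat (@scalar_section c cc) z = c (zpoly L).[z].
Proof.
move=> Mz; pose x : M := SigSub (mem_set Mz).
have xE : set_val x = (zpoly L).[z] by [].
rewrite /hat -xE ext0E; under eq_bigr do rewrite mxE.
by rewrite -mulr_suml sum_zdelta// mul1r.
Qed.

Lemma hat_scale c z : M (zpoly L).[z] -> hat (c *: (1 : cLambda L M)) z = c.
Proof.
move=> Mz; pose x : M := SigSub (mem_set Mz).
have xE : set_val x = (zpoly L).[z] by [].
rewrite /hat -xE ext0E; under eq_bigr do rewrite !mxE.
by rewrite -mulr_suml sum_zdelta// mul1r mulr1.
Qed.

Lemma hat1 z : M (zpoly L).[z] -> hat (1 : cLambda L M) z = 1.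
Proof. by move=> Mz; rewrite -(hat_scale 1 Mz) scale1r. Qed.

Lemma hatX f n z : M (zpoly L).[z] -> hat (f ^+ n) z = hat f z ^+ n.
Proof.
by move=> Mz; elim: n => [|n ih]; rewrite ?expr0 ?hat1// !exprS hatM ih.
Qed.

End HatTheory.

Section QuotientSpectrum.
Context {R : realType} {d : nat} (L : simple_zeros R d) (S : set R[i]).
Hypotheses (d_ge1 : (0 < d)%N) (cS : compact S).
Local Notation M := [set (zpoly L).[z] | z in S].
Implicit Types f g : cLambda L M.

Let inM z : S z -> M (zpoly L).[z]. Proof. by exists z. Qed.

Lemma hat_bounded_below f : (forall z, S z -> hat f z != 0) ->
  exists2 e : R, 0 < e & forall z, S z -> e <= rnorm (hat f z).
Proof.
move=> f0.
have cf : {within S, continuous (hat f)}.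
  by apply: (continuous_subspaceW _ (hat_continuous (f := f))) => z Sz; exact: inM.
have cim : compact (hat f @` S) by exact: continuous_compact.
have := compact_closed (@norm_hausdorff _ R[i]) cim.
rewrite -[hat f @` S]setCK => /closed_openC; rewrite setCK openE => h.
have /h/nbhs_rnorm[e e0 he] : (~` (hat f @` S)) 0.
  by move=> [z Sz z0]; move/eqP: z0; apply/negP/f0.
exists e => // z Sz; rewrite leNgt; apply/negP => ze.
by apply: (he (hat f z)); [rewrite sub0r rnormN|exists z].
Qed.

(** With [Pi w] the product of the [1 - al(z) X] over all the roots [z] of
    [p - w], the element [g] is such that [1 - f g] is [Pi] evaluated at [f]. At
    a point [z] of [S] the polynomial [Pi (p(z))] has the factor
    [1 - X / hat f z], which vanishes at [hat f z]. *)
Lemma hat_invertible f : (forall z, S z -> hat f z != 0) ->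
  exists g, forall z, S z -> hat f z * hat g z = 1.
Proof.
move=> f0; have [e e0 fe] := hat_bounded_below f0.
pose al z := clipped_inv e (hat f z).
have cal : {within [set z | M (zpoly L).[z]], continuous al}.
  apply/subspace_continuousP => z Mz.
  have /subspace_continuousP/(_ _ Mz) h := hat_continuous (f := f).
  have FF := within_filter [set z | M (zpoly L).[z]] (nbhs_filter z).
  exact: (@clipped_inv_cvg R _ _ e _ _ FF e0 h).
have pm := zpoly_monic L; have ps := size_zpoly L.
pose Pi w : {poly R[i]} := \prod_(i < d) (1 - (al (fiber pm ps d_ge1 w i))%:P * 'X).
have cPi m : {within M, continuous (fun w => (Pi w)`_m)}.
  exact: symmetric_continuous.
pose g : cLambda L M := - \sum_(m < d) scalar_section (cPi m.+1) * f ^+ m.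
exists g => z Sz; have Mz := inM Sz; set w := (zpoly L).[z].
have gE : hat g z = - \sum_(m < d) (Pi w)`_m.+1 * hat f z ^+ m.
  rewrite /g -sub0r hatB hat_sum (_ : hat 0 z = 0); last first.
    by have := hatB 0 (0 : cLambda L M) z; rewrite !subrr.
  rewrite sub0r; congr (- _); apply: eq_bigr => m _.
  by rewrite hatM hatX// hat_scalar_section.
have Pi0 : (Pi w)`_0 = 1.
  rewrite -horner_coef0 horner_prod big1// => i _.
  by rewrite hornerD hornerN hornerM hornerX mulr0 subr0 hornerC.
have szPi : (size (Pi w) <= d.+1)%N.
  rewrite (leq_trans (size_prod_leq _ _))// cardT size_enum_ord.
  rewrite (@leq_trans ((\sum_(i < d) 2).+1 - d))//; last first.
    by rewrite sum_nat_const card_ord muln2 -addnn -addSn addnK.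
  apply: leq_sub2r; rewrite ltnS; apply: leq_sum => i _.
  rewrite (leq_trans (size_polyD _ _))// geq_max size_poly1 size_polyN/=.
  rewrite (leq_trans (size_polyMleq _ _))// size_polyX addn2/= ltnS.
  exact: size_polyC_leq1.
have : (Pi w).[hat f z] = 0.
  have [i zi] := fiber_surj pm ps d_ge1 z.
  rewrite horner_prod (bigD1 i)//= -zi hornerD hornerN hornerM hornerX !hornerC.
  by rewrite /al clipped_invE ?fe// subrr mul0r.
rewrite (horner_coef_wide _ szPi) big_ord_recl expr0 mulr1 Pi0 => h.
rewrite gE mulrN mulr_sumr; apply/eqP; rewrite eqr_oppLR -addr_eq0 addrC; apply/eqP.
rewrite -[RHS]h; congr (_ + _); apply: eq_bigr => m _.
by rewrite exprS mulrCA.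
Qed.

Let quot_mulE f g : cclass S f * cclass S g = cclass S (f * g).
Proof. by rewrite cclassM. Qed.

Let quot_oneE : 1 = cclass S (1 : cLambda L M). Proof. by []. Qed.

Lemma quot_spectrumE f : quot_spectrum (cclass S f) = [set hat f z | z in S].
Proof.
apply/seteqP; split=> [z nz|_ [s Ss <-]].
  apply: contrapT => nim; apply: nz.
  have [s Ss|g gP] := @hat_invertible (z *: (1 : cLambda L M) - f).
    rewrite hatB hat_scale//; last exact: inM.
    by rewrite subr_eq0; apply/eqP => zs; apply: nim; exists s.
  exists (cclass S g).
  have e : (cclass S (z *: (1 : cLambda L M)) - cclass S f) * cclass S g = 1.
    rewrite -cclassB quot_mulE quot_oneE; apply/eqP; rewrite cclass_eq; apply/asboolP => s Ss.
    by rewrite hatB hatM gP// hat1 ?subrr//; exact: inM.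
  by split=> //; rewrite mulrC.
move=> [b [+ _]]; have [g <-] := cclass_surj b.
rewrite -cclassB quot_mulE quot_oneE => /eqP; rewrite cclass_eq => /asboolP/(_ s Ss)/eqP.
rewrite hatB hatM hatB hat_scale//; last exact: inM.
by rewrite subrr mul0r hat1 ?sub0r ?oppr_eq0 ?oner_eq0//; exact: inM.
Qed.

End QuotientSpectrum.

(** * The spectrum of the operator *)

Section OperatorSide.
Context {R : realType} {H : nzHilbertType R}.
Implicit Types (A T : bop H).

Lemma op_spectrum_horner A (p : {poly R[i]}) :
  op_spectrum (horner_alg A p) = [set p.[z] | z in op_spectrum A].
Proof.
pose a : bic A := Bic (bicommutant_self A).
have aE : bic_op (horner_alg a p) = horner_alg A p by rewrite bic_horner_alg.
rewrite -aE; apply/seteqP; split=> [w /bic_spectrumP[h hb <-]|_ [z zA <-]].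
  have [hh _] := hb; rewrite (char_horner hh).
  by exists (h a) => //; apply/(bic_spectrumP a); exists h.
have [h hb <-] := (bic_spectrumP a z).1 zA; have [hh _] := hb.
by apply/bic_spectrumP; exists h; rewrite ?(char_horner hh).
Qed.

Section Chi.
Context {d : nat} {L : simple_zeros R d} {M : set R[i]}.
Variables (A : bop H) (f : cLambda L M).
Local Notation N := (horner_alg A (zpoly L)).
Hypotheses (normal_pA : normal N) (spec_pA : op_spectrum N = M).

(** A character [h] of the bicommutant of [A] sends [f_j(N)] to [f_j(p(h A))],
    hence [chi A f] to [hat f (h A)]. *)
Lemma op_spectrum_chi : op_spectrum (chi A f) = [set hat f z | z in op_spectrum A].
Proof.
pose a : bic A := Bic (bicommutant_self A).
have aE (p : {poly R[i]}) : bic_op (horner_alg a p) = horner_alg A p by rewrite bic_horner_alg.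
have cf j : {within op_spectrum N, continuous (fun w => ext0 f w j 0)}.
  by rewrite spec_pA; exact: ext0_continuous.
have nb : N \in bicommutant A by rewrite -aE; exact: bic_subproof.
pose t j : bic A := Bic (fun_calc_bicommutant normal_pA nb (cf j)).
pose x : bic A := \sum_j horner_alg a (zdelta L j) * t j.
have xE : bic_op x = chi A f.
  rewrite [LHS](raddf_sum (val : bic A -> bop H)); apply: eq_bigr => j _.
  by rewrite [LHS]bic_opM aE.
have hx h : bic_character h -> h x = hat f (h a).
  move=> hb; have [hh _] := hb; rewrite (char_sum hh); apply: eq_bigr => j _.
  rewrite (charM hh) (char_horner hh); congr (_ * _).
  rewrite -(char_horner hh).
  have := @character_fun_calc _ _ A (horner_alg a (zpoly L)) (t j) h
    (fun w => ext0 f w j 0).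
  by rewrite aE; apply => //; exact: cf.
rewrite -xE; apply/seteqP; split=> [w /bic_spectrumP[h hb <-]|_ [z zA <-]].
  by rewrite hx//; exists (h a) => //; apply/(bic_spectrumP a); exists h.
have [h hb <-] := (bic_spectrumP a z).1 zA.
by apply/bic_spectrumP; exists h; rewrite ?hx.
Qed.

End Chi.
End OperatorSide.

Theorem theorem3p15 (R : realType) (H : nzHilbertType R)
    (d : nat) (d_ge1 : (1 <= d)%N) (L : simple_zeros R d)
    (A : bop H) (normal_pA : normal (horner_alg A (zpoly L)))
    (f : cLambda L [set (zpoly L).[z] | z in op_spectrum A]) :
  op_spectrum (chi A f) = quot_spectrum (cclass (op_spectrum A) f).
Proof.
rewrite quot_spectrumE//; last exact: compact_op_spectrum.
by apply: op_spectrum_chi => //; exact: op_spectrum_horner.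
Qed.
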